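(* Let $M$ be an irreducible calibrated $\tilde H$-module. Let $t\in T$ be (a fixed choice of) the central character of $M$ and let $J=R(w)\cap P(t)$ for any $w\in W$ such that $M_{wt}\ne0$. Then $(t,J)$ is a skew local region and $M\cong\tilde H^{(t,J)}$, where $\tilde H^{(t,J)}$ is the $\tilde H$-module with $\mathbb C$-basis $\{v_u\mid u\in\mathcal F^{(t,J)}\}$ and action $$X^\lambda v_u=(ut)(X^\lambda)\,v_u\quad(X^\lambda\in X),\qquad T_iv_u=(T_i)_{uu}v_u+\bigl(q^{-1}+(T_i)_{uu}\bigr)v_{s_iu}\quad(1\le i\le n),$$ with $\displaystyle (T_i)_{uu}=\frac{q-q^{-1}}{1-(ut)(X^{-\alpha_i})}$ and $v_{s_iu}=0$ if $s_iu\notin\mathcal F^{(t,J)}$.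
   Context: Let $R$ be a reduced crystallographic root system spanning a real vector space $\mathfrak h_{\mathbb R}^*\cong\mathbb R^n$ with Weyl group $W$ and $W$-invariant inner product $\langle\,,\rangle$, positive roots $R^+$, negative roots $R^-=-R^+$, simple roots $\alpha_1,\dots,\alpha_n$, and simple reflections $s_1,\dots,s_n$. Let $\alpha_i^\vee=2\alpha_i/\langle\alpha_i,\alpha_i\rangle$, let $\omega_1,\dots,\omega_n$ be the fundamental weights, $\langle\omega_i,\alpha_j^\vee\rangle=\delta_{ij}$, and let $P=\sum_i\mathbb Z\omega_i$ be the weight lattice. Let $X=\{X^\lambda\mid\lambda\in P\}$ be the group with $X^\lambda X^\mu=X^{\lambda+\mu}$, with $W$-action $wX^\lambda=X^{w\lambda}$, and let $\mathbb C[X]$ be its group algebra. Fix $q\in\mathbb C^*$ with $q^2\ne\pm1$. The affine Hecke algebra $\tilde H$ is the $\mathbb C$-algebra generated by $T_1,\dots,T_n$ and $X^\lambda$ ($\lambda\in P$), with relations: $T_i^2=(q-q^{-1})T_i+1$; the braid relations $T_iT_jT_i\cdots=T_jT_iT_j\cdots$ ($m_{ij}$ factors on each side, $m_{ij}$ the order of $s_is_j$ in $W$) for $i\neq j$; $X^\lambda X^\mu=X^{\lambda+\mu}$; and $$X^\lambda T_i=T_iX^{s_i\lambda}+(q-q^{-1})\frac{X^\lambda-X^{s_i\lambda}}{1-X^{-\alpha_i}}.$$ The center of $\tilde H$ is $\mathbb C[X]^W$, and all irreducible $\tilde H$-modules are finite dimensional. Let $T=\mathrm{Hom}(X,\mathbb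 C^* )$ be the set of group homomorphisms $X\to\mathbb C^*$ (extended linearly to $\mathbb C[X]$), with $W$-action $(wt)(X^\lambda)=t(X^{w^{-1}\lambda})$. A central character of an irreducible module $M$ is an element $t\in T$ such that $pm=t(p)m$ for all $m\in M$, $p\in\mathbb C[X]^W$; it is determined only up to the $W$-action. For a finite dimensional module $M$ over $\tilde H$ (or over a subalgebra containing $\mathbb C[X]$) and $t\in T$, $$M_t=\{m\in M\mid X^\lambda m=t(X^\lambda)m\ \text{for all }X^\lambda\in X\},$$ $$M_t^{\rm gen}=\{m\in M\mid\text{for each }X^\lambda\in X,\ (X^\lambda-t(X^\lambda))^km=0\text{ for some }k\in\mathbb Z_{>0}\}.$$ $t$ is a weight of $M$ if $M_t^{\rm gen}\neq0$ (equivalently $M_t\ne 0$), and $M$ is calibrated if $M_t^{\rm gen}=M_t$ for all $t\in T$. For $w\in W$ let $R(w)=\{\alpha\in R^+\mid w\alpha\in R^-\}$. For $t\in T$, $$Z(t)=\{\alpha\in R^+\mid t(X^\alpha)=1\},\qquad P(t)=\{\alpha\in R^+\mid t(X^\alpha)=q^{2}\text{ or }q^{-2}\},$$ and for $J\subseteq P(t)$, $\mathcal F^{(t,J)}=\{w\in W\mid R(w)\cap Z(t)=\emptyset,\ R(w)\cap P(t)=J\}$. A local region is a pair $(t,J)$ with $t\in T$, $J\subseteq P(t)$ and $\mathcal F^{(t,J)}\ne\emptyset$. An element $t\in T$ is calibratable if, for every pair $i,j$ with $i\ne j$, $t$ is a weight of a calibrated representation of the rank two affine Hecke subalgebra of $\tilde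 H$ generated by $T_i$, $T_j$ and $\mathbb C[X]$. A local region $(t,J)$ is skew if $wt$ is calibratable for all $w\in\mathcal F^{(t,J)}$. For a skew local region $(t,J)$ the displayed formulas for $\tilde H^{(t,J)}$ define an irreducible $\tilde H$-module.
   Formalization: ''For any w with M_{wt} ≠ 0'' is false when Z(t) ≠ ∅ (in type A3 such a w can give a J with F^(t,J) empty); here w must also satisfy R(w) ∩ Z(t) = ∅, and the existence of such a w with M_{wt} ≠ 0 is proved as part of the conclusion. *)

(* Defs.v *)
From HB Require Import structures.
From mathcomp Require Import all_boot all_order all_algebra.
From mathcomp Require Import all_classical all_reals.
From mathcomp Require Import complex finmap.

Set Implicit Arguments.
Unset Strict Implicit.
Unset Printing Implicit Defensive.

Import Order.TTheory GRing.Theory Num.Theory.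
Local Open Scope classical_set_scope.
Local Open Scope ring_scope.
Local Open Scope complex_scope.

Definition nat_comb (R : realType) (V : vectType R) (n : nat) (a : n.-tuple V)
    (v : V) : Prop :=
  exists m : 'I_n -> nat, v = \sum_(i < n) (m i)%:R *: tnth a i.

Definition pair_coroot (R : realType) (V : vectType R) (form : V -> V -> R)
    (a v : V) : R := 2 * form v a / form a a.

Definition reflection (R : realType) (V : vectType R) (form : V -> V -> R)
    (a v : V) : V := v - pair_coroot form a v *: a.

(* The reflections are orthogonal for [form], so [form] is automatically
   invariant under the Weyl group. *)
Record rootSystem (R : realType) (V : vectType R) (n : nat) := RootSystem {
  form : V -> V -> R;
  roots : seq V;
  simple : n.-tuple V;
  fundw : 'I_n -> V;
  form_sym : forall u v, form u v = form v u;
  form_linear : forall c u v w, form (c *: u + v) w = c * form u w + form v w;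
  form_pos : forall v, v != 0 -> 0 < form v v;
  roots_neq0 : 0 \notin roots;
  roots_span : <<roots>>%VS = fullv;
  roots_refl : forall a b, a \in roots -> b \in roots ->
    reflection form a b \in roots;
  roots_int : forall a b, a \in roots -> b \in roots ->
    pair_coroot form a b \is a Num.int;
  roots_reduced : forall a (c : R), a \in roots -> c *: a \in roots ->
    c = 1 \/ c = -1;
  simple_basis : basis_of fullv simple;
  simple_roots : forall i, tnth simple i \in roots;
  roots_sign : forall a, a \in roots ->
    nat_comb simple a \/ nat_comb simple (- a);
  fundwP : forall i j, pair_coroot form (tnth simple j) (fundw i) = (i == j)%:R
}.

Section Weyl.
Variables (R : realType) (V : vectType R) (n : nat) (D : rootSystem V n).

Definition sroot (i : 'I_n) : V := tnth (simple D) i.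

Definition refl (a : V) : 'End(V) := linfun (reflection (form D) a).

Definition srefl (i : 'I_n) : 'End(V) := refl (sroot i).

(* Reflections being involutions, the monoid they generate is the group they
   generate. *)
Inductive weyl : set 'End(V) :=
| weyl1 : weyl \1%VF
| weylM a w : a \in roots D -> weyl w -> weyl (refl a \o w)%VF.

Definition pos_root : set V := [set a | a \in roots D /\ nat_comb (simple D) a].

Definition neg_root : set V := [set a | pos_root (- a)].

Definition inv_set (w : 'End(V)) : set V :=
  [set a | pos_root a /\ neg_root (w a)].

Definition weight_lattice : set V :=
  [set l | exists c : 'I_n -> int, l = \sum_(i < n) (c i)%:~R *: fundw D i].

Definition is_order_ss (i j : 'I_n) (m : nat) : Prop :=
  [/\ (0 < m)%N,
      forall v, iter m (fun u => srefl i (srefl j u)) v = v &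
      forall k, (0 < k < m)%N ->
        exists v, iter k (fun u => srefl i (srefl j u)) v <> v].

Lemma reflection_is_linear a : linear (reflection (form D) a).
Proof.
move=> c u v; rewrite /reflection /pair_coroot form_linear mulrDr mulrDl.
by rewrite scalerDl scalerBr scalerA opprD addrACA mulrCA -!mulrA.
Qed.

HB.instance Definition _ a := GRing.isLinear.Build R V V *:%R
  (reflection (form D) a) (reflection_is_linear a).

Lemma reflE a v : refl a v = reflection (form D) a v.
Proof. exact: lfunE. Qed.

Lemma weyl_root w a : weyl w -> a \in roots D -> w a \in roots D.
Proof.
move=> Ww aR; elim: Ww => [|b u bR _ IH]; first by rewrite lfunE.
by rewrite comp_lfunE reflE roots_refl.
Qed.

Lemma weyl_finite : finite_set weyl.
Proof.
pose F := {ffun 'I_n -> seq_sub (roots D)}.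
pose h (f : F) : 'End(V) := linfun (fun v : V =>
  \sum_(i < n) coord (simple D) i v *: ssval (f i)).
have hE f v : h f v = \sum_(i < n) coord (simple D) i v *: ssval (f i).
  pose g v := \sum_(i < n) coord (simple D) i v *: ssval (f i).
  have gl : linear g.
    move=> c x y; rewrite /g scaler_sumr -big_split /=; apply: eq_bigr => i _.
    by rewrite linearP scalerDl scalerA.
  pose G := GRing.isLinear.Build R V V *:%R g gl.
  pose gL : {linear V -> V} := HB.pack g G.
  exact: (lfunE gL v).
apply: (@sub_finite_set _ _ (h @` setT)); last exact/finite_image/finite_finset.
move=> w Ww /=.
exists [ffun i => SeqSub (weyl_root Ww (simple_roots D i))] => //.
apply/lfunP => v; rewrite hE.
rewrite [in RHS](coord_basis (simple_basis D) (memvf v)) linear_sum /=.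
by apply: eq_bigr => i _; rewrite ffunE linearZ /= (tnth_nth 0).
Qed.

End Weyl.

Section Hecke.
Variables (R : realType) (V : vectType R) (n : nat) (D : rootSystem V n).
Local Notation C := R[i].
Local Notation P := (weight_lattice D).
Variable q : C.

(* The element (X^l - X^(s_i l)) / (1 - X^(- a_i)) of C[X], written as the
   geometric sum it is equal to: with k = <l, a_i^vee>, it is
   X^l + X^(l - a_i) + ... + X^(l - (k-1) a_i) if k >= 0, and
   - (X^(l + a_i) + ... + X^(l + |k| a_i)) if k <= 0.
   [Num.truncn] is 0 on negative numbers; see [divdiffP] below. *)
Definition divdiff (A : zmodType) (X : V -> A) (i : 'I_n) (l : V) : A :=
  let k := pair_coroot (form D) (sroot D i) l in
  \sum_(0 <= j < Num.truncn k) X (l - j%:R *: sroot D i)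
  - \sum_(1 <= j < (Num.truncn (- k)).+1) X (l + j%:R *: sroot D i).

Fixpoint alt_prod (A : pzRingType) (m : nat) (a b : A) : A :=
  if m is m'.+1 then a * alt_prod m' b a else 1.

Record hecke_relations (A : algType C) (T : 'I_n -> A) (X : V -> A) : Prop := {
  hecke_quad : forall i, T i ^+ 2 = (q - q^-1) *: T i + 1;
  hecke_braid : forall i j m, i != j -> is_order_ss D i j m ->
    alt_prod m (T i) (T j) = alt_prod m (T j) (T i);
  hecke_X0 : X 0 = 1;
  hecke_XD : forall l m, P l -> P m -> X l * X m = X (l + m);
  hecke_XT : forall i l, P l ->
    X l * T i = T i * X (srefl D i l) + (q - q^-1) *: divdiff X i l
}.

Definition is_subalg (A : algType C) (S : set A) : Prop :=
  [/\ S 1, forall (c : C) a b, S a -> S b -> S (c *: a + b) &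
      forall a b, S a -> S b -> S (a * b)].

Definition gen_subalg (A : algType C) (G : set A) : set A :=
  smallest (@is_subalg A) G.

(* [H] is the algebra presented by the generators [T i], [X l] (l in P; the
   values of [X] outside P are irrelevant) and the relations above. *)
Record affine_hecke (H : algType C) (T : 'I_n -> H) (X : V -> H) : Prop := {
  hecke_rel : hecke_relations T X;
  hecke_gen : gen_subalg (range T `|` X @` P) = setT;
  hecke_univ : forall (A : algType C) (T' : 'I_n -> A) (X' : V -> A),
    hecke_relations T' X' ->
    exists f : {lrmorphism H -> A},
      (forall i, f (T i) = T' i) /\ (forall l, P l -> f (X l) = X' l)
}.

(* Elements of C[X] are the finitely supported functions on V supported in P. *)
Definition group_alg (p : {fsfun V -> C with 0}) : Prop :=
  forall l, l \in finsupp p -> P l.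

Definition weyl_invariant (p : {fsfun V -> C with 0}) : Prop :=
  forall w l, weyl D w -> p (w l) = p l.

Definition eval_X (A : lmodType C) (x : V -> A) (p : {fsfun V -> C with 0}) : A :=
  \sum_(l <- finsupp p) p l *: x l.

(* Elements of Hom(X, C^* ), as functions on V whose values outside P are
   irrelevant. *)
Definition torus : set (V -> C) :=
  [set t | [/\ forall l, P l -> t l != 0, t 0 = 1 &
               forall l m, P l -> P m -> t (l + m) = t l * t m]].

Definition torus_act (w : 'End(V)) (t : V -> C) : V -> C :=
  fun l => t ((w^-1)%VF l).

Definition Zset (t : V -> C) : set V := [set a | pos_root D a /\ t a = 1].

Definition Pset (t : V -> C) : set V :=
  [set a | pos_root D a /\ (t a = q ^+ 2 \/ t a = q ^- 2)].

Definition Fset (t : V -> C) (J : set V) : set 'End(V) :=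
  [set w | [/\ weyl D w, inv_set D w `&` Zset t = set0 &
               inv_set D w `&` Pset t = J]].

Definition local_region (t : V -> C) (J : set V) : Prop :=
  [/\ torus t, J `<=` Pset t & Fset t J !=set0].

Section Modules.
Variables (H : algType C) (T : 'I_n -> H) (X : V -> H).

(* [rho] makes M a module over the subalgebra S of H; its values outside S are
   irrelevant. *)
Record is_module (S : set H) (M : lmodType C) (rho : H -> M -> M) : Prop := {
  module_lin : forall h, S h -> linear (rho h);
  module_linl : forall (c : C) a b m, S a -> S b ->
    rho (c *: a + b) m = c *: rho a m + rho b m;
  module_1 : forall m, rho 1 m = m;
  module_M : forall a b m, S a -> S b -> rho (a * b) m = rho a (rho b m)
}.

Definition irreducible_module (M : vectType C) (rho : H -> M -> M) : Prop :=
  (exists m : M, m != 0) /\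
  forall U : {vspace M}, (forall h m, m \in U -> rho h m \in U) ->
    U = 0%VS \/ U = fullv.

Definition module_iso (M N : lmodType C) (rho : H -> M -> M)
    (sigma : H -> N -> N) : Prop :=
  exists f : {linear M -> N},
    bijective f /\ forall h m, f (rho h m) = sigma h (f m).

Definition weight_space (M : lmodType C) (rho : H -> M -> M) (t : V -> C) : set M :=
  [set m | forall l, P l -> rho (X l) m = t l *: m].

Definition gen_weight_space (M : lmodType C) (rho : H -> M -> M) (t : V -> C) :
    set M :=
  [set m | forall l, P l -> exists k, (0 < k)%N /\
             iter k (fun v => rho (X l) v - t l *: v) m = 0].

Definition is_weight (M : lmodType C) (rho : H -> M -> M) (t : V -> C) : Prop :=
  torus t /\ gen_weight_space rho t <> [set 0].

Definition calibrated (M : vectType C) (rho : H -> M -> M) : Prop :=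
  forall t, torus t -> gen_weight_space rho t = weight_space rho t.

Definition central_character (M : lmodType C) (rho : H -> M -> M) (t : V -> C) :
    Prop :=
  torus t /\
  forall p, group_alg p -> weyl_invariant p ->
  forall m, rho (eval_X X p) m = (eval_X (t : V -> C^o) p : C) *: m.

Definition rank_two_subalg (i j : 'I_n) : set H :=
  gen_subalg ([set T i; T j] `|` X @` P).

Definition calibratable (t : V -> C) : Prop :=
  torus t /\
  forall i j, i != j ->
  exists (N : vectType C) (sigma : H -> N -> N),
    [/\ is_module (rank_two_subalg i j) sigma, calibrated sigma &
        is_weight sigma t].

Definition skew_local_region (t : V -> C) (J : set V) : Prop :=
  local_region t J /\ forall w, Fset t J w -> calibratable (torus_act w t).

(* F^(t,J) is finite by [weyl_finite], so [fset_set] is faithful here. *)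
Definition tJ_space (t : V -> C) (J : set V) : vectType C :=
  {ffun fset_set (Fset t J) -> C^o}.

(* This is 0 when u is not in F^(t,J). *)
Definition tJ_vec (t : V -> C) (J : set V) (u : 'End(V)) : tJ_space t J :=
  [ffun x => (fsval x == u)%:R].

Definition tJ_coef (t : V -> C) (i : 'I_n) (u : 'End(V)) : C :=
  (q - q^-1) / (1 - torus_act u t (- sroot D i)).

Definition is_tJ_module (t : V -> C) (J : set V)
    (sigma : H -> tJ_space t J -> tJ_space t J) : Prop :=
  [/\ is_module setT sigma,
      forall u l, Fset t J u -> P l ->
        sigma (X l) (tJ_vec t J u) = torus_act u t l *: tJ_vec t J u &
      forall u i, Fset t J u ->
        sigma (T i) (tJ_vec t J u) =
          tJ_coef t i u *: tJ_vec t J u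
          + (q^-1 + tJ_coef t i u) *: tJ_vec t J (srefl D i \o u)%VF].

End Modules.
End Hecke.

Section Lemmas.
Variables (R : realType) (V : vectType R) (n : nat) (D : rootSystem V n).

Lemma pair_corootD a u v : pair_coroot (form D) a (u + v) =
  pair_coroot (form D) a u + pair_coroot (form D) a v.
Proof.
by rewrite /pair_coroot -{1}[u]scale1r form_linear mul1r mulrDr mulrDl.
Qed.

Lemma pair_corootZ a c u : pair_coroot (form D) a (c *: u) =
  c * pair_coroot (form D) a u.
Proof.
have f0 w : form D 0 w = 0.
  have := form_linear D 1 0 0 w; rewrite scaler0 addr0 mul1r.
  by move/(congr1 (fun x => x - form D 0 w)); rewrite addrK subrr.
by rewrite /pair_coroot -[c *: u]addr0 form_linear f0 addr0 mulrCA !mulrA.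
Qed.

Lemma pair_coroot_weight i l : weight_lattice D l ->
  pair_coroot (form D) (sroot D i) l \is a Num.int.
Proof.
case=> c ->; elim/big_rec: _ => [|j x _ IH].
  by rewrite -(scale0r 0) pair_corootZ mul0r.
by rewrite pair_corootD pair_corootZ fundwP rpredD // rpredM ?rpred_int ?rpred_nat.
Qed.

Lemma truncn_le0 (x : R) : x <= 0 -> Num.truncn x = 0%N.
Proof. by move=> x0; apply/truncn0Pn; rewrite -ltNge (le_lt_trans x0). Qed.

(* [divdiff X i l] is the quotient of X^l - X^(s_i l) by 1 - X^(- a_i). *)
Lemma divdiffP (A : pzRingType) (X : V -> A) i l :
  weight_lattice D l -> (forall u v, X (u + v) = X u * X v) ->
  divdiff D X i l * (1 - X (- sroot D i)) = X l - X (srefl D i l).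
Proof.
move=> Pl XD; rewrite reflE /reflection /divdiff.
have /intrP[k kE] := pair_coroot_weight i Pl.
set a := sroot D i; rewrite {}kE mulrBr mulr1 mulrBl.
case: k => m.
  rewrite (truncn_le0 (x := - _)) ?oppr_le0 ?ler0n //.
  rewrite (@big_geq _ _ _ 1 1) // subr0 mul0r subr0 Num.Theory.natrK.
  rewrite mulr_suml -sumrB.
  rewrite (eq_bigr (fun j => - (X (l - j.+1%:R *: a) - X (l - j%:R *: a)))).
    by rewrite sumrN telescope_sumr // scale0r subr0 opprB.
  move=> j _; rewrite -XD opprB; congr (_ - X _).
  by rewrite -addrA -opprD -natr1 scalerDl scale1r.
rewrite (truncn_le0 (x := (Negz m)%:~R)) ?NegzE ?mulrNz ?oppr_le0 ?ler0n //.
rewrite (@big_geq _ _ _ 0 0) // sub0r mul0r sub0r opprK Num.Theory.natrK.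
rewrite opprK mulr_suml addrC -sumrB scaleNr opprK.
rewrite big_add1 /= (eq_bigr (fun j => - (X (l + j.+1%:R *: a) - X (l + j%:R *: a)))).
  by rewrite sumrN telescope_sumr // scale0r addr0 opprB.
move=> j _; rewrite -XD opprB; congr (X _ - _).
by rewrite -natr1 scalerDl scale1r addrA addrK.
Qed.

End Lemmas.

(* Main.v *)
Require Import Defs.
From HB Require Import structures.
From mathcomp Require Import all_boot all_order all_algebra.
From mathcomp Require Import all_classical all_reals sequences exp.
From mathcomp Require Import complex finmap fingroup perm.
From mathcomp Require Import ring lra ssrAC spectral.

(* The libraries above shadow names of [Defs]. *)
Import Defs.

Set Implicit Arguments.
Unset Strict Implicit.
Unset Printing Implicit Defensive.

Import Order.TTheory GRing.Theory Num.Theory.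
Local Open Scope classical_set_scope.
Local Open Scope ring_scope.
Local Open Scope complex_scope.

(** The weights s of a calibrated module satisfy s(X^{a_i}) <> 1, so the
    intertwiner tau_i = T_i - (q - q^-1)/(1 - X^{-a_i}) acts on all weight vectors
    and sends M_s to M_{s_i s}.  The tau_i inherit the braid relations, hence
    for a weight vector m of weight wt there is a well defined vector tau_v m for
    every v in W, and by irreducibility these vectors span M.  By Steinberg's
    theorem the weights vwt are distinct as long as R(vw) does not meet Z(t),
    which holds when tau_v m <> 0; so the weight spaces are lines.  If
    (vwt)(X^{a_i}) = q^{+-2}, then tau_i^2 = 0 on the weight space, and tau_i
    itself vanishes because M_{vwt} could not be reached again.  In all other
    cases tau_i is invertible.  Thus tau_v m <> 0 exactly when vw lies in F^(t,J),
    and rescaling tau_v m by the product of the scalars of tau over R(v) gives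
    the basis v_u.

    Steinberg's theorem is proved with the Jacobian of the orbit sums of the
    fundamental weights: it is antisymmetric with leading term X^rho, hence a
    nonzero multiple of the Weyl denominator X^rho prod (1 - X^{-a}), which does
    not vanish at regular t. *)

(** The intertwiner is not an element of the Hecke algebra, because [1 - X^(-a_i)] is not invertible
    there, so it exists only on one weight space at a time. Its braid relations therefore cannot be
    computed in a localized algebra: they are extracted from those of the [T_i] on each weight
    vector, by separating weights. What makes the separation possible is Steinberg's theorem in the
    following form: an element [v] that fixes [t] and inverts no root of [Z(t)] is 1. It rests on
    [P] being the full weight lattice, through the fundamental weights in the Jacobian. As a
    consequence every weight in the orbit of [t] has exactly one label [w t] with [R(w)] disjoint
    from [Z(t)]. The same property of reduced words that a Coxeter presentation would give (any two
    are linked by braid moves) is obtained here from roots alone, by an induction on length that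
    peels off dihedral longest elements. The Hecke relations are never verified on the formulas for
    the target module: its structure is transported from [M], and the formulas are read off. *)

Section RootSystem.
Variables (R : realType) (V : vectType R) (n : nat) (D : rootSystem V n).
Local Notation "<< u , v >>" := (Defs.form D u v) (at level 0, u, v at level 99).
Local Notation a_ i := (sroot D i).
Local Notation s_ i := (srefl D i).
Local Notation om i := (fundw D i).
Local Notation cr a v := (pair_coroot (Defs.form D) a v).
Local Notation P := (weight_lattice D).
Implicit Types (a b : V) (v : V).

(** * Roots, weights and the Weyl group *)

Lemma formDl u v w : <<u + v, w>> = <<u, w>> + <<v, w>>.
Proof. by rewrite -{1}[u]scale1r form_linear mul1r. Qed.

Lemma form0l w : <<0, w>> = 0.
Proof. by apply: (addrI <<0, w>>); rewrite -formDl !addr0. Qed.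

Lemma formZl c v w : <<c *: v, w>> = c * <<v, w>>.
Proof. by rewrite -[c *: v]addr0 form_linear form0l addr0. Qed.

Lemma formNl v w : <<- v, w>> = - <<v, w>>.
Proof. by rewrite -scaleN1r formZl mulN1r. Qed.

Lemma formDr u v w : <<w, u + v>> = <<w, u>> + <<w, v>>.
Proof. by rewrite form_sym formDl !(form_sym _ w). Qed.

Lemma formZr c v w : <<w, c *: v>> = c * <<w, v>>.
Proof. by rewrite form_sym formZl form_sym. Qed.

Lemma formNr v w : <<w, - v>> = - <<w, v>>.
Proof. by rewrite form_sym formNl form_sym. Qed.

Lemma form_suml I (r : seq I) (Q : pred I) (F : I -> V) w :
  <<\sum_(i <- r | Q i) F i, w>> = \sum_(i <- r | Q i) <<F i, w>>.
Proof. exact: (big_morph (fun v => <<v, w>>) (fun u v => formDl u v w) (form0l w)). Qed.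

Lemma form_sumr I (r : seq I) (Q : pred I) (F : I -> V) w :
  <<w, \sum_(i <- r | Q i) F i>> = \sum_(i <- r | Q i) <<w, F i>>.
Proof. by rewrite form_sym form_suml; apply: eq_bigr => i _; rewrite form_sym. Qed.

Lemma form_ge0 v : 0 <= <<v, v>>.
Proof.
by case: (eqVneq v 0) => [->|/(form_pos D)/ltW //]; rewrite form0l.
Qed.

Lemma form_le0 v : <<v, v>> <= 0 -> v = 0.
Proof. by apply: contraTeq => /(form_pos D); rewrite ltNge. Qed.

Lemma root_neq0 a : a \in roots D -> a != 0.
Proof. by apply: contraTneq => ->; exact: roots_neq0. Qed.

Lemma sroot_root i : a_ i \in roots D.
Proof. exact: simple_roots. Qed.

Lemma sroot_neq0 i : a_ i != 0.
Proof. exact/root_neq0/sroot_root. Qed.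

Lemma sroot_form_gt0 i : 0 < <<a_ i, a_ i>>.
Proof. exact/form_pos/sroot_neq0. Qed.

Lemma formE a v : a != 0 -> <<v, a>> = cr a v * <<a, a>> / 2.
Proof.
move=> /(form_pos D) a0; rewrite /pair_coroot -!mulrA [_^-1 * _]mulrA mulVf ?gt_eqF //.
by rewrite mul1r mulrCA mulfV ?mulr1 // pnatr_eq0.
Qed.

Lemma simple_coord v : v = \sum_i coord (simple D) i v *: a_ i.
Proof.
rewrite {1}(coord_basis (simple_basis D) (memvf v)).
by apply: eq_bigr => i _; rewrite /sroot (tnth_nth 0).
Qed.

Lemma form_om_sroot i j : <<om i, a_ j>> = (i == j)%:R * <<a_ j, a_ j>> / 2.
Proof. by rewrite formE ?sroot_neq0 // /sroot fundwP. Qed.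

Lemma form_om_coord v i : <<v, om i>> = coord (simple D) i v * <<a_ i, a_ i>> / 2.
Proof.
rewrite {1}[v]simple_coord form_suml (bigD1 i) //= big1 ?addr0 => [|j ji];
  rewrite formZl form_sym form_om_sroot.
  by rewrite eqxx mul1r mulrA.
by rewrite eq_sym (negbTE ji) !mul0r mulr0.
Qed.

Lemma coordE v i : coord (simple D) i v = 2 * <<v, om i>> / <<a_ i, a_ i>>.
Proof.
have := sroot_form_gt0 i; rewrite form_om_coord => /lt0r_neq0 h.
by field.
Qed.

Lemma form_om_inj v : (forall i, <<v, om i>> = 0) -> v = 0.
Proof.
move=> h; rewrite [v]simple_coord big1 // => i _.
by rewrite coordE h mulr0 mul0r scale0r.
Qed.

Lemma form_sroot_inj v : (forall i, <<v, a_ i>> = 0) -> v = 0.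
Proof.
move=> h; apply: form_le0; rewrite {2}[v]simple_coord form_sumr big1 // => i _.
by rewrite formZr h mulr0.
Qed.

Lemma pair_corootN a v : cr a (- v) = - cr a v.
Proof. by rewrite -scaleN1r pair_corootZ mulN1r. Qed.

Lemma pair_coroot_self a : a != 0 -> cr a a = 2.
Proof. by move=> /(form_pos D)/lt0r_neq0 h; rewrite /pair_coroot mulfK. Qed.

Lemma weight_coord v : v = \sum_i cr (a_ i) v *: om i.
Proof.
apply/eqP; rewrite -subr_eq0; apply/eqP/form_sroot_inj => j.
rewrite formDl formNl form_suml (bigD1 j) //= big1 => [|i ij].
  by rewrite formZl form_om_sroot eqxx mul1r addr0 mulrA -formE ?sroot_neq0 // subrr.
by rewrite formZl form_om_sroot (negbTE ij) !mul0r mulr0.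
Qed.

Lemma reflK a v : a != 0 -> refl D a (refl D a v) = v.
Proof.
move=> a0; rewrite !reflE /reflection -scaleNr pair_corootD pair_corootZ pair_coroot_self //.
rewrite scaleNr -addrA -opprD -scalerDl.
have E (c : R) : c + (c + - c * 2) = 0 by ring.
by rewrite E scale0r subr0.
Qed.

Lemma refl_self a : a != 0 -> refl D a a = - a.
Proof.
move=> a0; rewrite reflE /reflection pair_coroot_self // -{1}[a]scale1r -scalerBl.
by rewrite -scaleN1r; congr (_ *: _); ring.
Qed.

Lemma refl_form a u v : a != 0 -> <<refl D a u, refl D a v>> = <<u, v>>.
Proof.
move=> /(form_pos D)/lt0r_neq0 h.
rewrite !reflE /reflection !formDl !formDr !formNl !formNr !formZl !formZr.
by rewrite /pair_coroot [<<a, v>>]form_sym; field.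
Qed.

Lemma weyl_form w u v : weyl D w -> <<w u, w v>> = <<u, v>>.
Proof.
move=> Ww; elim: Ww => [|a x aR _ IH]; first by rewrite !lfunE.
by rewrite !comp_lfunE refl_form ?root_neq0.
Qed.

(** The Weyl group preserves a positive definite form. Injectivity turns the linear inverse [w^-1]
    into a genuine inverse, which [torus_act] needs. *)
Lemma weyl_inj w : weyl D w -> injective w.
Proof.
move=> Ww u v E; apply/eqP; rewrite -subr_eq0; apply/eqP/form_le0.
by rewrite -(weyl_form _ _ Ww) linearB /= E subrr form0l.
Qed.

Lemma weyl_lker0 w : weyl D w -> lker w == 0%VS.
Proof. by move=> /weyl_inj h; apply/lker0P. Qed.

Lemma weylK w v : weyl D w -> (w^-1)%VF (w v) = v.
Proof. by move=> /weyl_lker0/lker0_lfunK. Qed.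

Lemma weylVK w v : weyl D w -> w ((w^-1)%VF v) = v.
Proof. by move=> /weyl_lker0/lker0_lfunVK. Qed.

Lemma weyl_comp u w : weyl D u -> weyl D w -> weyl D (u \o w)%VF.
Proof.
move=> Wu Ww; elim: Wu => [|a x aR _ IH]; first by rewrite comp_lfun1l.
by rewrite -comp_lfunA; apply: weylM.
Qed.

Lemma weyl_refl a : a \in roots D -> weyl D (refl D a).
Proof. by move=> aR; rewrite -[refl D a]comp_lfun1r; apply: weylM => //; apply: weyl1. Qed.

Lemma weyl_srefl i : weyl D (s_ i).
Proof. exact/weyl_refl/sroot_root. Qed.

Lemma weyl_invE (u w : 'End(V)) : weyl D w -> (forall v, w (u v) = v) -> u = (w^-1)%VF.
Proof.
by move=> Ww h; apply/lfunP => v; apply: (weyl_inj Ww); rewrite h weylVK.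
Qed.

Lemma weyl_inv w : weyl D w -> weyl D (w^-1)%VF.
Proof.
move=> Ww; elim: (Ww) => [|a x aR Wx IH].
  by rewrite -(@weyl_invE \1%VF \1%VF) => [|/=|v /=]; rewrite ?id_lfunE; try exact: weyl1.
rewrite -(weyl_invE (u := (x^-1 \o refl D a)%VF)); first exact/weyl_comp/weyl_refl.
  exact: weylM.
by move=> v; rewrite !comp_lfunE /= weylVK // reflK ?root_neq0.
Qed.

Lemma weyl_formV w u v : weyl D w -> <<w u, v>> = <<u, (w^-1)%VF v>>.
Proof. by move=> Ww; rewrite -(weyl_form _ ((w^-1)%VF v) Ww) weylVK. Qed.

Lemma weyl_compV u w : weyl D u -> weyl D w -> ((u \o w)^-1 = w^-1 \o u^-1)%VF.
Proof.
move=> Wu Ww; apply/esym/weyl_invE; first exact: weyl_comp.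
by move=> v; rewrite !comp_lfunE !weylVK.
Qed.

Lemma weyl_invK w : weyl D w -> ((w^-1)^-1 = w)%VF.
Proof.
by move=> Ww; apply/esym/weyl_invE; [exact: weyl_inv|move=> v; rewrite weylK].
Qed.

Lemma weyl_root_inv w a : weyl D w -> (w a \in roots D) = (a \in roots D).
Proof.
move=> Ww; apply/idP/idP => [h|]; last exact: weyl_root.
by rewrite -(weylK a Ww) weyl_root //; exact: weyl_inv.
Qed.

Lemma root_opp a : a \in roots D -> - a \in roots D.
Proof.
move=> aR; rewrite -refl_self ?root_neq0 //; exact: weyl_root (weyl_refl aR) aR.
Qed.

Lemma refl_conj w a v : weyl D w -> refl D (w a) (w v) = w (refl D a v).
Proof.
move=> Ww; rewrite !reflE /reflection linearB /= /pair_coroot.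
by rewrite !(weyl_form _ _ Ww) [X in _ = _ - X]linearZ.
Qed.

Lemma refl_opp a : refl D (- a) = refl D a.
Proof.
apply/lfunP => v; rewrite !reflE /reflection /pair_coroot !formNl !formNr opprK.
by rewrite mulrN mulNr scaleNr scalerN opprK.
Qed.

Lemma srefl_om i j : s_ i (om j) = om j - (j == i)%:R *: a_ i.
Proof. by rewrite reflE /reflection fundwP. Qed.

Lemma sreflK i v : s_ i (s_ i v) = v.
Proof. exact: reflK (sroot_neq0 i). Qed.

Lemma sreflV i : ((s_ i)^-1 = s_ i)%VF.
Proof. by apply/esym/weyl_invE; [exact: weyl_srefl|exact: sreflK]. Qed.

Definition rho : V := \sum_i om i.

Lemma pair_rho i : cr (a_ i) rho = 1.
Proof.
rewrite /rho (big_morph (fun v => cr (a_ i) v) (pair_corootD D (a_ i)) (id1 := 0)).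
  by rewrite (bigD1 i) //= big1 => [|j ji]; rewrite fundwP ?(negbTE ji) ?eqxx ?addr0.
by rewrite -(scale0r 0) pair_corootZ mul0r.
Qed.

Lemma form_sroot_rho i : <<a_ i, rho>> = <<a_ i, a_ i>> / 2.
Proof. by rewrite form_sym formE ?sroot_neq0 // pair_rho mul1r. Qed.

Lemma srefl_rho i : s_ i rho = rho - a_ i.
Proof. by rewrite reflE /reflection pair_rho scale1r. Qed.

(** A boolean test for positive roots. It works because [<a_i, rho> = <a_i, a_i> / 2] is positive
    for every [i]; see [pos_rootP]. *)
Definition pos (a : V) : bool := 0 < <<a, rho>>.

Lemma nat_comb_om a i : nat_comb (simple D) a -> 0 <= <<a, om i>>.
Proof.
case=> m ->; rewrite form_suml sumr_ge0 // => j _; rewrite formZl.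
rewrite -/(sroot D j) form_sym form_om_sroot !mulr_ge0 // ?invr_ge0 //.
exact: form_ge0.
Qed.

Lemma om_ge0_pos a : a != 0 -> (forall i, 0 <= <<a, om i>>) -> pos a.
Proof.
move=> a0 h; rewrite /pos form_sumr lt_neqAle sumr_ge0 // andbT eq_sym.
apply: contra a0; rewrite psumr_eq0 // => /allP h'.
by apply/eqP/form_om_inj => i; apply/eqP; apply: h'; rewrite mem_index_enum.
Qed.

Lemma posN a : pos a -> ~~ pos (- a).
Proof. by rewrite /pos formNl oppr_gt0 -leNgt => /ltW. Qed.

Lemma pos_rootP a : pos_root D a <-> a \in roots D /\ pos a.
Proof.
split=> [[aR h]|[aR h]]; split=> //.
  by apply: om_ge0_pos (root_neq0 aR) _ => i; apply: nat_comb_om.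
case: (roots_sign aR) => // h'; have : pos (- a).
  by apply: om_ge0_pos => [|i]; [rewrite oppr_eq0 root_neq0|exact: nat_comb_om].
by move/posN; rewrite opprK h.
Qed.

Lemma pos_om a : a \in roots D -> pos a -> forall i, 0 <= <<a, om i>>.
Proof. by move=> aR pa i; apply: nat_comb_om; have [] := (pos_rootP a).2 (conj aR pa). Qed.

Lemma pos_opp a : a \in roots D -> pos (- a) = ~~ pos a.
Proof.
move=> aR; apply/idP/idP => [/posN|na]; first by rewrite opprK.
case: (roots_sign aR) => h; first by case/negP: na; have [] := (pos_rootP a).1 (conj aR h).
by have [] := (pos_rootP (- a)).1 (conj (root_opp aR) h).
Qed.

Lemma neg_rootP a : neg_root D a <-> a \in roots D /\ ~~ pos a.
Proof.
split=> [/pos_rootP[aR h]|[aR h]].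
  by have aR' := root_opp aR; rewrite opprK in aR'; split; rewrite // -pos_opp.
by apply/pos_rootP; split; [exact: root_opp|rewrite pos_opp].
Qed.

Lemma inv_setP w a : weyl D w ->
  inv_set D w a <-> [/\ a \in roots D, pos a & ~~ pos (w a)].
Proof.
move=> Ww; split=> [[/pos_rootP[aR pa] /neg_rootP[_ nwa]]|[aR pa nwa]].
  by split.
by split; [apply/pos_rootP|apply/neg_rootP; rewrite weyl_root_inv].
Qed.

(** The coefficients of a root in the simple roots share one sign, so a single positive one
    decides. *)
Lemma om_gt0_pos a i : a \in roots D -> 0 < <<a, om i>> -> pos a.
Proof.
move=> aR h; rewrite -[a]opprK pos_opp ?root_opp //; apply/negP => /pos_om.
by move/(_ (root_opp aR) i); rewrite formNl oppr_ge0 leNgt h.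
Qed.

Lemma pos_sroot i : pos (a_ i).
Proof. by rewrite /pos form_sroot_rho divr_gt0 ?sroot_form_gt0. Qed.

(** [s_i] changes only the coefficient of [a_i], so all other coefficients of [a] must vanish;
    reducedness then leaves [a_i] as the only positive multiple. *)
Lemma srefl_neg i a : a \in roots D -> pos a -> ~~ pos (s_ i a) -> a = a_ i.
Proof.
move=> aR pa nsa.
have z j : j != i -> <<a, om j>> = 0.
  move=> ji; apply/eqP; rewrite eq_le pos_om // andbT leNgt.
  apply: contra nsa => h; apply: (@om_gt0_pos _ j).
    by rewrite weyl_root //; exact: weyl_srefl.
  rewrite reflE /reflection formDl formNl formZl [<<a_ i, _>>]form_sym form_om_sroot.
  by rewrite (negbTE ji) !mul0r mulr0 subr0.
have aE : a = coord (simple D) i a *: a_ i.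
  rewrite {1}[a]simple_coord (bigD1 i) //= big1 ?addr0 // => j ji.
  by rewrite coordE z // mulr0 mul0r scale0r.
rewrite aE in aR *; case: (roots_reduced (sroot_root i) aR) => [->|c1].
  by rewrite scale1r.
by move: pa; rewrite aE c1 scaleN1r pos_opp ?sroot_root // pos_sroot.
Qed.

Lemma pos_srefl i a : a \in roots D -> pos a -> a != a_ i -> pos (s_ i a).
Proof. by move=> aR pa; apply: contraNT => /(srefl_neg aR pa)->. Qed.

Fixpoint sprod (s : seq 'I_n) : 'End(V) :=
  if s is i :: s' then (s_ i \o sprod s')%VF else \1%VF.

Lemma sprod_cat s1 s2 : sprod (s1 ++ s2) = (sprod s1 \o sprod s2)%VF.
Proof. by elim: s1 => [|i s IH] /=; rewrite ?comp_lfun1l // IH comp_lfunA. Qed.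

Lemma weyl_sprod s : weyl D (sprod s).
Proof. by elim: s => [|i s IH] /=; [exact: weyl1|apply: weyl_comp; [exact: weyl_srefl|]]. Qed.

(** [weyl] is generated by all reflections, while later inductions use simple ones. Induction on
    height: for a positive root [b] that is not simple, conjugation by a suitable [s_i] reduces
    [refl b] to the reflection in the positive root [s_i b] of smaller height. *)
Lemma refl_sprod a : a \in roots D -> exists s, refl D a = sprod s.
Proof.
suff H (N : nat) b : \sum_i coord (simple D) i b < N%:R -> b \in roots D -> pos b ->
    exists s, refl D b = sprod s.
  move=> aR; have H' b : b \in roots D -> pos b -> exists s, refl D b = sprod s.
    by apply: (H (Num.truncn (\sum_i coord (simple D) i b)).+1); exact: truncnS_gt.
  have [pa|npa] := boolP (pos a); first exact: H'.
  by rewrite -refl_opp; apply: H'; rewrite ?root_opp ?pos_opp.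
elim: N b => [|N IH] b hb bR pb.
  suff: 0 <= \sum_i coord (simple D) i b by rewrite leNgt hb.
  rewrite sumr_ge0 // => i _; rewrite coordE divr_ge0 ?form_ge0 //.
  by rewrite mulr_ge0 ?pos_om.
have [/existsP[i /eqP->]|/existsPn ne] := boolP [exists i, b == a_ i].
  by exists [:: i]; rewrite /= comp_lfun1r.
(* If no simple root paired positively with [b], then [<b, b>] would be at most 0. *)
have [/existsP[i bi]|/existsPn h] := boolP [exists i, 0 < <<b, a_ i>>]; last first.
  have: 0 < <<b, b>> by apply/form_pos/root_neq0.
  rewrite {2}[b]simple_coord form_sumr ltNge sumr_le0 // => i _.
  rewrite formZr mulr_ge0_le0 //; last by rewrite leNgt.
  by rewrite coordE divr_ge0 ?form_ge0 // mulr_ge0 ?pos_om.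
have pc : 0 < cr (a_ i) b by rewrite divr_gt0 ?sroot_form_gt0 // mulr_gt0.
(* Integrality makes the height drop by at least 1, as the bound [N] requires. *)
have c1 : 1 <= cr (a_ i) b.
  have := roots_int (sroot_root i) bR; move: pc => /[swap] /intrP[k ->].
  by rewrite ltr0z ler1z -gtz0_ge1.
have [s Es] : exists s, refl D (s_ i b) = sprod s.
  apply: IH; last exact: pos_srefl.
    have -> : s_ i b = b - cr (a_ i) b *: a_ i by rewrite reflE.
    rewrite (eq_bigr (fun j => coord (simple D) j b -
       cr (a_ i) b * coord (simple D) j (a_ i))); last first.
      by move=> j _; rewrite linearB linearZ.
    rewrite sumrB -mulr_sumr.
    have -> : \sum_j coord (simple D) j (a_ i) = 1.
      rewrite (bigD1 i) //= /sroot (tnth_nth 0) coord_free ?(basis_free (simple_basis D)) //.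
      rewrite eqxx big1 ?addr0 // => j ji; rewrite coord_free ?(basis_free (simple_basis D)) //.
      by case: eqP => // E; case/eqP: ji; apply: val_inj; rewrite /= E.
    by move: hb; rewrite -natr1 mulr1; lra.
  by rewrite weyl_root //; exact: weyl_srefl.
exists ((i :: s) ++ [:: i]); rewrite sprod_cat /= -Es comp_lfun1r.
apply/lfunP => v; rewrite !comp_lfunE /= refl_conj ?sreflK //; exact: weyl_srefl.
Qed.

Lemma weylP w : weyl D w -> exists s, w = sprod s.
Proof.
elim=> [|a x aR _ [s ->]]; first by exists [::].
by have [s' ->] := refl_sprod aR; exists (s' ++ s); rewrite sprod_cat.
Qed.

Lemma weyl_ind_simple (Q : 'End(V) -> Prop) : Q \1%VF ->
  (forall i w, weyl D w -> Q w -> Q (s_ i \o w)%VF) -> forall w, weyl D w -> Q w.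
Proof.
move=> Q1 QM w /weylP[s ->]; elim: s => //= i s IH; apply: QM => //; exact: weyl_sprod.
Qed.

Lemma weightD u v : P u -> P v -> P (u + v).
Proof.
case=> c -> [d ->]; exists (fun i => c i + d i).
by rewrite -big_split; apply: eq_bigr => i _; rewrite /= -scalerDl rmorphD.
Qed.

Lemma weightN u : P u -> P (- u).
Proof.
case=> c ->; exists (fun i => - c i).
by rewrite -sumrN; apply: eq_bigr => i _; rewrite /= -scaleNr rmorphN.
Qed.

Lemma weight0 : P 0.
Proof. by exists (fun _ => 0); rewrite big1 // => i _; rewrite scale0r. Qed.

Lemma weightZ (k : int) u : P u -> P (k%:~R *: u).
Proof.
case=> c ->; exists (fun i => k * c i).
by rewrite scaler_sumr; apply: eq_bigr => i _; rewrite /= scalerA rmorphM.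
Qed.

Lemma weight_sum I (r : seq I) (F : I -> V) : (forall i, P (F i)) ->
  P (\sum_(i <- r) F i).
Proof. by move=> h; elim/big_rec: _ => [|i x _]; [exact: weight0|exact: weightD]. Qed.

Lemma weightP v : P v <-> forall i, cr (a_ i) v \is a Num.int.
Proof.
split=> [Pv i|h]; first exact: pair_coroot_weight.
rewrite [v]weight_coord; exists (fun i => Num.floor (cr (a_ i) v)).
by apply: eq_bigr => i _; congr (_ *: _); apply/esym/floorK.
Qed.

Lemma weight_om i : P (om i).
Proof. by apply/weightP => j; rewrite fundwP; case: eqP. Qed.

Lemma weight_root a : a \in roots D -> P a.
Proof. by move=> aR; apply/weightP => i; apply: roots_int (sroot_root i) aR. Qed.

Lemma weight_sroot i : P (a_ i).
Proof. exact/weight_root/sroot_root. Qed.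

Lemma weight_rho : P rho.
Proof. exact/weight_sum/weight_om. Qed.

Lemma weight_srefl i v : P v -> P (s_ i v).
Proof.
move=> Pv; rewrite reflE /reflection.
have /intrP[k ->] := pair_coroot_weight i Pv.
by apply: weightD => //; apply/weightN/weightZ/weight_sroot.
Qed.

Lemma weight_weyl w v : weyl D w -> P v -> P (w v).
Proof.
move=> Ww Pv; elim/weyl_ind_simple: w / Ww => [|i w _ IH]; first by rewrite lfunE.
by rewrite comp_lfunE; apply: weight_srefl.
Qed.

End RootSystem.

(** * Lengths and the exchange condition *)

Section WeylLength.
Variables (R : realType) (V : vectType R) (n : nat) (D : rootSystem V n).
Local Notation "<< u , v >>" := (Defs.form D u v) (at level 0, u, v at level 99).
Local Notation a_ i := (sroot D i).
Local Notation s_ i := (srefl D i).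
Local Notation om i := (fundw D i).
Local Notation pos := (pos D).
Implicit Types (a b : V) (v w : 'End(V)).

Definition inv_roots w : seq V := [seq a <- undup (roots D) | pos a && ~~ pos (w a)].

Definition weyl_len w : nat := size (inv_roots w).

Lemma mem_inv_roots w a : (a \in inv_roots w) = [&& a \in roots D, pos a & ~~ pos (w a)].
Proof. by rewrite mem_filter mem_undup andbC. Qed.

(** [s_i] changes the sign of [v a] only if [v a] is [a_i] or [- a_i], and the latter is impossible
    for positive [a], since [v^-1 a_i] is positive. *)
Lemma inv_roots_srefl i v : weyl D v -> pos ((v^-1)%VF (a_ i)) ->
  perm_eq (inv_roots (s_ i \o v)%VF) ((v^-1)%VF (a_ i) :: inv_roots v).
Proof.
move=> Wv pb; apply: uniq_perm; first by rewrite filter_uniq ?undup_uniq.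
  rewrite /= filter_uniq ?undup_uniq // andbT mem_inv_roots.
  by rewrite (weylVK _ Wv) pos_sroot !andbF.
move=> a; rewrite inE !mem_inv_roots comp_lfunE.
case: (eqVneq a ((v^-1)%VF (a_ i))) => [->|ne] /=.
  rewrite (weylVK _ Wv) refl_self ?sroot_neq0 // pos_opp ?sroot_root // pos_sroot.
  by rewrite pb (weyl_root (weyl_inv Wv)) ?sroot_root.
case: (boolP (a \in roots D)) => //= aR; case: (boolP (pos a)) => //= pa.
have vaR : v a \in roots D by rewrite weyl_root.
have ne' : v a != a_ i by apply: contra ne => /eqP <-; rewrite (weylK _ Wv).
have [pva|nva] := boolP (pos (v a)); first by rewrite pos_srefl.
apply/negP => ps.
have sR : s_ i (v a) \in roots D by rewrite weyl_root //; exact: weyl_srefl.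
have := srefl_neg (i := i) sR ps; rewrite sreflK => /(_ nva) E.
move: pb; have -> : a_ i = - v a.
  by rewrite -[v a](sreflK D i) E refl_self ?sroot_neq0 // opprK.
by rewrite linearN /= (weylK _ Wv) pos_opp // pa.
Qed.

Lemma weyl_spos i v : weyl D v -> weyl D (s_ i \o v)%VF.
Proof. exact/weyl_comp/weyl_srefl. Qed.

Lemma weyl_len_srefl i v : weyl D v -> pos ((v^-1)%VF (a_ i)) ->
  weyl_len (s_ i \o v)%VF = (weyl_len v).+1.
Proof. by move=> Wv pb; rewrite /weyl_len (perm_size (inv_roots_srefl Wv pb)). Qed.

Lemma srefl_compK i v : (s_ i \o (s_ i \o v))%VF = v.
Proof. by apply/lfunP => x; rewrite !comp_lfunE /= sreflK. Qed.

Lemma srefl_compV i v x : weyl D v -> ((s_ i \o v)^-1)%VF x = (v^-1)%VF (s_ i x).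
Proof. by move=> Wv; rewrite (weyl_compV (weyl_srefl D i) Wv) comp_lfunE sreflV. Qed.

Lemma srefl_compV_sroot i v : weyl D v ->
  ((s_ i \o v)^-1)%VF (a_ i) = - (v^-1)%VF (a_ i).
Proof. by move=> Wv; rewrite srefl_compV // refl_self ?sroot_neq0 // linearN. Qed.

Lemma weylV_sroot i v : weyl D v -> (v^-1)%VF (a_ i) \in roots D.
Proof. by move=> Wv; rewrite (weyl_root (weyl_inv Wv)) ?sroot_root. Qed.

Lemma pos_srefl_comp i v : weyl D v ->
  pos (((s_ i \o v)^-1)%VF (a_ i)) = ~~ pos ((v^-1)%VF (a_ i)).
Proof. by move=> Wv; rewrite srefl_compV_sroot // pos_opp // weylV_sroot. Qed.

Lemma weyl_len_desc i v : weyl D v -> ~~ pos ((v^-1)%VF (a_ i)) ->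
  weyl_len v = (weyl_len (s_ i \o v)%VF).+1.
Proof.
move=> Wv nb; rewrite -(weyl_len_srefl (i := i)) ?pos_srefl_comp ?srefl_compK //; exact: weyl_spos.
Qed.

(** The images of [a_i] under the final segments of the word start positive and end negative. The
    letter [j] at the change of sign meets exactly the root [a_j], and can be deleted at the cost of
    a factor [s_i] on the right. *)
Lemma sprod_exchange s i : ~~ pos (sprod D s (a_ i)) ->
  exists2 s', (size s' < size s)%N & sprod D s' = (sprod D s \o s_ i)%VF.
Proof.
elim: s => [|j s IH] /=; first by rewrite id_lfunE pos_sroot.
rewrite comp_lfunE => nb; have Ws := weyl_sprod D s.
have [pb|/IH[s' ss' E]] := boolP (pos (sprod D s (a_ i))); last first.
  by exists (j :: s'); rewrite //= E comp_lfunA.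
exists s => //; apply/lfunP => x.
have E := srefl_neg (weyl_root Ws (sroot_root D i)) pb nb.
by rewrite !comp_lfunE /= -(refl_conj _ _ Ws) E sreflK.
Qed.

(** If a word ending in [i] keeps [a_i] positive, then the word without its last letter makes [a_i]
    negative, and the exchange gives a shorter word for [w]. *)
Lemma weyl_simple_pos w : weyl D w -> (forall i, pos (w (a_ i))) -> w = \1%VF.
Proof.
move=> /weylP[s ->]; have [N] := ubnP (size s); elim: N s => // N IH s.
case/lastP: s => [//|s i]; rewrite size_rcons ltnS => sN h.
have E : sprod D (rcons s i) = (sprod D s \o s_ i)%VF.
  by rewrite -cats1 sprod_cat /= comp_lfun1r.
have nb : ~~ pos (sprod D s (a_ i)).
  have := h i; rewrite E comp_lfunE refl_self ?sroot_neq0 // linearN /=.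
  by rewrite pos_opp // weyl_root ?sroot_root //; exact: weyl_sprod.
have [s' ss' E'] := sprod_exchange nb.
have E2 : sprod D (rcons s i) = sprod D s' by rewrite E E'.
by rewrite E2 in h *; apply: IH => //; exact: leq_trans ss' (ltnW sN).
Qed.

Lemma weyl_nodesc w : weyl D w -> (forall i, pos ((w^-1)%VF (a_ i))) -> w = \1%VF.
Proof.
move=> Ww h; have E := weyl_simple_pos (weyl_inv Ww) h.
by apply/lfunP => x; rewrite -[RHS](weylVK _ Ww) E !id_lfunE.
Qed.

Lemma weyl_ind_len (Q : 'End(V) -> Prop) : Q \1%VF ->
  (forall i w, weyl D w -> pos ((w^-1)%VF (a_ i)) -> Q w -> Q (s_ i \o w)%VF) ->
  forall w, weyl D w -> Q w.
Proof.
move=> Q1 QM w; have [N] := ubnP (weyl_len w); elim: N w => // N IH w; rewrite ltnS => wN Ww.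
have [/existsP[i ni]|/existsPn h] := boolP [exists i, ~~ pos ((w^-1)%VF (a_ i))].
  rewrite -(srefl_compK i w); apply: QM; first exact: weyl_spos.
    by rewrite pos_srefl_comp.
  by apply: IH; [move: wN; rewrite (weyl_len_desc Ww ni)|exact: weyl_spos].
by rewrite (weyl_nodesc Ww) // => i; rewrite -[pos _]negbK.
Qed.

(** Each ascent [w -> s_k w] subtracts from [w om_i] the multiple [<om_i, w^-1 a_k>] of a positive
    vector along [a_k], which is nonnegative because [w^-1 a_k] is a positive root. *)
Lemma om_dominance w i j : weyl D w -> 0 <= <<om i - w (om i), om j>>.
Proof.
move=> Ww; elim/weyl_ind_len: w / Ww => [|k w Ww pk IH].
  by rewrite id_lfunE subrr form0l.
rewrite comp_lfunE reflE /reflection opprB addrCA addrC formDl addr_ge0 //.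
rewrite formZl mulr_ge0 //; last first.
  by rewrite form_sym form_om_sroot divr_ge0 // mulr_ge0 ?form_ge0.
rewrite /pair_coroot divr_ge0 ?form_ge0 // mulr_ge0 // (weyl_formV _ _ Ww) form_sym.
by apply: pos_om => //; exact: weylV_sroot.
Qed.

(** Singles out the terms of the Jacobian with exponent [rho]: the differences [om_i - f_i om_i]
    have nonnegative coefficients and sum to 0. *)
Lemma sum_om_weyl (f : 'I_n -> 'End(V)) : (forall i, weyl D (f i)) ->
  \sum_i f i (om i) = rho D -> forall i, f i (om i) = om i.
Proof.
move=> Wf E i; apply/esym/eqP; rewrite -subr_eq0; apply/eqP/form_om_inj => j.
have E0 : \sum_i <<om i - f i (om i), om j>> = 0.
  by rewrite -form_suml sumrB E subrr form0l.
by apply: (psumr_eq0P _ E0) => // k _; exact: om_dominance.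
Qed.

Definition weyl_seq : seq 'End(V) := enum_fset (fset_set (weyl D)).

Lemma mem_weyl_seq w : w \in weyl_seq <-> weyl D w.
Proof.
rewrite /weyl_seq; have := @in_fset_set _ _ (weyl_finite D) w.
by rewrite /= => ->; split => [/set_mem|/mem_set].
Qed.

Lemma sum_weyl_comp (A : nmodType) (F : 'End(V) -> A) v : weyl D v ->
  \sum_(w <- weyl_seq) F (v \o w)%VF = \sum_(w <- weyl_seq) F w.
Proof.
move=> Wv; rewrite -(big_map (fun w => v \o w)%VF xpredT F); apply: perm_big.
have inj : injective (fun w => v \o w)%VF.
  move=> x y /lfunP E; apply/lfunP => z; have := E z.
  by rewrite !comp_lfunE => /(weyl_inj Wv).
apply: uniq_perm; rewrite ?map_inj_uniq ?fset_uniq // => w.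
apply/mapP/idP => [[x /mem_weyl_seq Wx ->]|/mem_weyl_seq Ww].
  exact/mem_weyl_seq/weyl_comp.
exists (v^-1 \o w)%VF; first by apply/mem_weyl_seq/weyl_comp => //; exact: weyl_inv.
by apply/lfunP => x; rewrite !comp_lfunE /= (weylVK _ Wv).
Qed.

End WeylLength.

(** * Steinberg's theorem on stabilizers in the torus *)

Lemma seq_argmax (R : realType) (E : eqType) (f : E -> R) (s : seq E) :
  s != [::] -> exists2 x, x \in s & forall y, y \in s -> f y <= f x.
Proof.
elim: s => // x [|x' s] IH _.
  by exists x => [|y]; rewrite ?mem_head // mem_seq1 => /eqP->.
have [//|y ys hy] := IH.
have [h|h] := leP (f x) (f y).
  by exists y => [|z]; rewrite inE ?ys ?orbT // => /orP[/eqP->|/hy].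
exists x => [|z]; first exact: mem_head.
by rewrite inE => /orP[/eqP->//|/hy/le_trans]; apply; exact: ltW.
Qed.

Section Antisymmetric.
Variables (R : realType) (V : vectType R) (n : nat) (D : rootSystem V n).
Local Notation "<< u , v >>" := (Defs.form D u v) (at level 0, u, v at level 99).
Local Notation a_ i := (sroot D i).
Local Notation s_ i := (srefl D i).
Local Notation om i := (fundw D i).
Local Notation cr a v := (pair_coroot (Defs.form D) a v).
Local Notation P := (weight_lattice D).
Local Notation pos := (pos D).
Local Notation rho := (rho D).
Local Notation C := R[i].
Implicit Types (a b l : V) (v w : 'End(V)).

(* An [l] maximizing [<l, rho>] on the support of [F] is strictly dominant, and
   strictly dominant [l <= rho] forces [l = rho]. *)
Lemma antisym_unique (F : V -> R) (S : seq V) :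
  (forall l, F l != 0 -> l \in S) -> (forall l, F l != 0 -> P l) ->
  (forall i l, F (s_ i l) = - F l) ->
  (forall l, F l != 0 -> forall i, 0 <= <<rho - l, om i>>) ->
  F rho = 0 -> forall l, F l = 0.
Proof.
move=> FS FP Fs Fle F0 l; apply/eqP; apply: contraPT F0 => Fl.
have [|x] := @seq_argmax R V (fun l => <<l, rho>>) [seq l <- S | F l != 0].
  by apply/eqP => E; have : l \in [::] by rewrite -E mem_filter Fl FS.
rewrite mem_filter => /andP[Fx _] xmax.
have k1 i : 1 <= cr (a_ i) x.
  have Fsx : F (s_ i x) != 0 by rewrite Fs oppr_eq0.
  have := xmax (s_ i x); rewrite mem_filter Fsx FS // => /(_ isT).
  rewrite reflE /reflection formDl formNl formZl gerDl oppr_le0.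
  rewrite pmulr_lge0 ?form_sroot_rho ?divr_gt0 ?sroot_form_gt0 // => k0.
  have kn0 : cr (a_ i) x != 0.
    apply: contra Fx => /eqP k0'; have := Fs i x.
    rewrite reflE /reflection k0' scale0r subr0 => /eqP.
    by rewrite -addr_eq0 -mulr2n mulrn_eq0.
  have : 0 < cr (a_ i) x by rewrite lt_neqAle eq_sym kn0.
  have /intrP[k ->] := pair_coroot_weight i (FP x Fx).
  by rewrite ltr0z ler1z -gtz0_ge1.
suff E : rho - x = 0.
  by move/eqP: E; rewrite subr_eq0 => /eqP ->; apply/eqP.
apply: (@form_le0 R V n D); rewrite {2}[rho - x](weight_coord D) form_sumr sumr_le0 // => i _.
rewrite formZr mulr_le0_ge0 //; last exact: Fle.
by rewrite pair_corootD pair_corootN pair_rho subr_le0.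
Qed.

(* Elements of the group algebra are represented as unreduced formal sums. *)
Definition fcoef (L : seq (R * V)) l : R := \sum_(x <- L | x.2 == l) x.1.

Definition feval (t : V -> C) (L : seq (R * V)) : C := \sum_(x <- L) x.1%:C * t x.2.

Lemma fcoef_cat L1 L2 l : fcoef (L1 ++ L2) l = fcoef L1 l + fcoef L2 l.
Proof. by rewrite /fcoef big_cat. Qed.

Lemma feval_cat t L1 L2 : feval t (L1 ++ L2) = feval t L1 + feval t L2.
Proof. by rewrite /feval big_cat. Qed.

Lemma fcoef_mem L l : fcoef L l != 0 -> l \in map snd L.
Proof.
apply: contraNT => nl; rewrite /fcoef big_seq_cond big1 // => x /andP[xL /eqP xl].
by case/negP: nl; rewrite -xl map_f.
Qed.

(** Grouping terms by exponent turns identities of coefficients into identities of values. *)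
Lemma fcoef0_feval t L : (forall l, fcoef L l = 0) -> feval t L = 0.
Proof.
move=> h; rewrite /feval.
transitivity (\sum_(l <- undup (map snd L)) \sum_(x <- L | x.2 == l) x.1%:C * t x.2).
  rewrite (exchange_big_dep xpredT) //=; apply: eq_big_seq => x xL.
  rewrite big_mkcond (bigD1_seq x.2) ?undup_uniq ?mem_undup ?map_f //= eqxx.
  by rewrite big1 ?addr0 // => l; rewrite eq_sym => /negbTE ->.
rewrite big1 // => l _; transitivity ((fcoef L l)%:C * t l); last by rewrite h mul0r.
by rewrite /fcoef rmorph_sum mulr_suml; apply: eq_bigr => x /eqP ->.
Qed.

(** Multiplication by [1 - X^(-a)] in the group algebra. *)
Definition fmul1B a (L : seq (R * V)) := L ++ [seq (- x.1, x.2 - a) | x <- L].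

Lemma fcoef_mul1B a L l : fcoef (fmul1B a L) l = fcoef L l - fcoef L (l + a).
Proof.
rewrite fcoef_cat; congr (_ + _); rewrite /fcoef big_map /= -sumrN.
by apply: eq_bigl => x; rewrite subr_eq.
Qed.

Definition char_mul (t : V -> C) := forall l m, P l -> P m -> t (l + m) = t l * t m.

Lemma feval_mul1B t a L : char_mul t -> P a -> (forall x, x \in L -> P x.2) ->
  feval t (fmul1B a L) = (1 - t (- a)) * feval t L.
Proof.
move=> tM Pa PL; rewrite feval_cat mulrBl mul1r; congr (_ + _).
rewrite /feval big_map mulr_sumr -sumrN !big_seq; apply: eq_bigr => x xL /=.
rewrite rmorphN tM; [by ring|exact: PL|exact: weightN].
Qed.

(** The Weyl denominator when [L] lists the positive roots. A general list allows induction on the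
    factors and reordering. *)
Definition denom (L : seq V) : seq (R * V) := foldr fmul1B [:: (1, rho)] L.

Lemma denom_le L x : (forall a, a \in L -> a \in roots D /\ pos a) -> x \in denom L ->
  P x.2 /\ forall i, 0 <= <<rho - x.2, om i>>.
Proof.
elim: L x => [|a L IH] x h /=.
  rewrite mem_seq1 => /eqP -> /=; split; first exact: weight_rho.
  by move=> i; rewrite subrr form0l.
have hL : forall a, a \in L -> a \in roots D /\ pos a.
  by move=> b bL; apply: h; rewrite inE bL orbT.
have [aR pa] := h a (mem_head _ _).
rewrite mem_cat => /orP[/(IH _ hL)//|/mapP[y /(IH _ hL)[Py hy] ->]] /=; split.
  by apply: weightD => //; apply/weightN/weight_root.
by move=> i; rewrite opprB addrA addrAC formDl addr_ge0 // pos_om.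
Qed.

Lemma feval_denom t L : char_mul t -> (forall a, a \in L -> a \in roots D /\ pos a) ->
  feval t (denom L) = t rho * \prod_(a <- L) (1 - t (- a)).
Proof.
move=> tM; elim: L => [|a L IH] h /=.
  by rewrite big_nil /feval big_seq1 rmorph1 mul1r mulr1.
have hL : forall a, a \in L -> a \in roots D /\ pos a.
  by move=> b bL; apply: h; rewrite inE bL orbT.
rewrite feval_mul1B // ?IH // ?big_cons; first by ring.
  by apply: weight_root; case: (h a (mem_head _ _)).
by move=> x /denom_le[].
Qed.

Lemma fcoef_mul1BC a b L l :
  fcoef (fmul1B a (fmul1B b L)) l = fcoef (fmul1B b (fmul1B a L)) l.
Proof. by rewrite !fcoef_mul1B -!addrA [b + a]addrC; ring. Qed.

Lemma fcoef_denom_rem a L l : a \in L -> fcoef (denom L) l = fcoef (denom (a :: rem a L)) l.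
Proof.
elim: L l => // b L IH l; rewrite inE /=.
have [->|ne] /= := eqVneq a b; first by rewrite ?eqxx.
move=> aL; rewrite [RHS]fcoef_mul1BC fcoef_mul1B.
by rewrite [RHS]fcoef_mul1B !(IH _ aL).
Qed.

Lemma fcoef_denom_perm L1 L2 l : perm_eq L1 L2 -> fcoef (denom L1) l = fcoef (denom L2) l.
Proof.
elim: L1 L2 l => [|a L1 IH] L2 l.
  by rewrite perm_sym => /perm_nilP ->.
move=> E; have aL : a \in L2 by rewrite -(perm_mem E) mem_head.
rewrite (fcoef_denom_rem _ aL) /= !fcoef_mul1B.
have E' : perm_eq L1 (rem a L2).
  by rewrite -(perm_cons a); apply: (perm_trans E); exact: perm_to_rem.
by rewrite !(IH _ _ E').
Qed.

(** [s_i] moves the roots in the factors and turns [X^rho] into [X^(rho - a_i)], which accounts for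
    the shift. *)
Lemma fcoef_denom_srefl i L l :
  fcoef (denom L) (s_ i l) = fcoef (denom (map (s_ i) L)) (l + a_ i).
Proof.
elim: L l => [|a L IH] l /=; last first.
  rewrite !fcoef_mul1B.
  have -> : s_ i l + a = s_ i (l + s_ i a) by rewrite linearD /= sreflK.
  by rewrite !IH (addrAC l).
rewrite /fcoef !big_cons !big_nil /=; congr (if _ then _ else _).
apply/eqP/eqP => E; first by rewrite -[l](sreflK D i) -E srefl_rho subrK.
by apply/eqP; rewrite -[rho](subrK (a_ i)) -srefl_rho E linearD /= refl_self ?sroot_neq0 // subrK.
Qed.

Definition pos_roots : seq V := [seq a <- undup (roots D) | pos a].

Lemma mem_pos_roots a : a \in pos_roots -> a \in roots D /\ pos a.
Proof. by rewrite mem_filter mem_undup => /andP[]. Qed.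

(** [s_i] permutes the positive roots other than [a_i]; the factor [1 - X^(-a_i)] supplies the
    sign. *)
Lemma denom_antisym i l :
  fcoef (denom pos_roots) (s_ i l) = - fcoef (denom pos_roots) l.
Proof.
have iP : a_ i \in pos_roots by rewrite mem_filter mem_undup sroot_root pos_sroot.
set L := rem (a_ i) pos_roots.
have uL : uniq pos_roots by rewrite filter_uniq ?undup_uniq.
have memL a : (a \in L) = [&& a != a_ i, a \in roots D & pos a].
  by rewrite mem_rem_uniq // !inE mem_filter mem_undup [pos a && _]andbC.
have sL : perm_eq (map (s_ i) L) L.
  apply: uniq_perm; rewrite ?map_inj_uniq ?rem_uniq //.
    exact/weyl_inj/weyl_srefl.
  move=> a; have sR b : (s_ i b \in roots D) = (b \in roots D).
    by rewrite weyl_root_inv //; exact: weyl_srefl.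
  have sLL b : b \in L -> s_ i b \in L.
    rewrite !memL sR => /and3P[ne bR pb]; rewrite bR pos_srefl //= !andbT.
    apply: contraTneq pb => E; rewrite -[b](sreflK D i) E refl_self ?sroot_neq0 //.
    by rewrite pos_opp ?sroot_root // pos_sroot.
  apply/mapP/idP => [[b bL ->]|aL]; first exact: sLL.
  by exists (s_ i a); rewrite ?sLL ?sreflK.
rewrite !(fcoef_denom_rem _ iP) -/L /= !fcoef_mul1B.
have -> : s_ i l + a_ i = s_ i (l - a_ i).
  by rewrite linearB /= refl_self ?sroot_neq0 // opprK.
by rewrite !fcoef_denom_srefl !(fcoef_denom_perm _ sL) subrK opprB.
Qed.

(** Every term other than the leading one has exponent [rho] minus a nonzero sum of positive
    roots. *)
Lemma denom_rho : fcoef (denom pos_roots) rho = 1.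
Proof.
suff H L : (forall a, a \in L -> a \in roots D /\ pos a) -> fcoef (denom L) rho = 1.
  exact/H/mem_pos_roots.
elim: L => [|a L IH] h; first by rewrite /fcoef big_cons big_nil /= eqxx addr0.
have hL : forall a, a \in L -> a \in roots D /\ pos a.
  by move=> b bL; apply: h; rewrite inE bL orbT.
have [aR pa] := h a (mem_head _ _).
rewrite /= fcoef_mul1B IH //; have [->|] := eqVneq (fcoef (denom L) (rho + a)) 0.
  by rewrite subr0.
move=> /fcoef_mem/mapP[x xL E]; have [_ le] := denom_le hL xL.
suff: a = 0 by move/eqP; rewrite (negbTE (root_neq0 aR)).
apply/(@form_om_inj R V n D) => i; apply/eqP; rewrite eq_le pos_om // andbT.
by have := le i; rewrite -E opprD addrA subrr sub0r formNl oppr_ge0.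
Qed.

End Antisymmetric.

(** * The Jacobian of the orbit sums and the regular case of Steinberg's theorem *)

Section Jacobian.
Variables (R : realType) (V : vectType R) (n : nat) (D : rootSystem V n).
Local Notation "<< u , v >>" := (Defs.form D u v) (at level 0, u, v at level 99).
Local Notation a_ i := (sroot D i).
Local Notation s_ i := (srefl D i).
Local Notation om i := (fundw D i).
Local Notation cr a v := (pair_coroot (Defs.form D) a v).
Local Notation P := (weight_lattice D).
Local Notation pos := (pos D).
Local Notation rho := (rho D).
Local Notation C := R[i].
Implicit Types (a b l : V) (v w : 'End(V)).

Local Notation K := (fset_set (weyl D)).

Lemma weylK_mem (x : K) : weyl D (fsval x).
Proof. exact/mem_weyl_seq/(fsvalP x). Qed.

Lemma srefl_K_subproof i (x : K) : (s_ i \o fsval x)%VF \in K.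
Proof. exact/mem_weyl_seq/weyl_spos/weylK_mem. Qed.

Definition srefl_K i (x : K) : K := [` srefl_K_subproof i x]%fset.

Lemma weyl_1K_subproof : \1%VF \in K.
Proof. exact/mem_weyl_seq/weyl1. Qed.

Definition weyl_1K : K := [` weyl_1K_subproof]%fset.

Lemma det_sum_rows (S : comNzRingType) (T : finType) m (G : T -> 'I_m -> 'I_m -> S) :
  \det (\matrix_(i, j) \sum_x G x i j) =
  \sum_(f : {ffun 'I_m -> T}) \det (\matrix_(i, j) G (f i) i j).
Proof.
rewrite /determinant exchange_big /=; apply: eq_bigr => s _.
rewrite -mulr_sumr; congr (_ * _).
rewrite (eq_bigr (fun i => \sum_x G x i (s i))) => [|i _]; last by rewrite mxE.
by rewrite bigA_distr_bigA; apply: eq_bigr => f _; apply: eq_bigr => i _; rewrite mxE.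
Qed.

(** The scalars in the term [f] of the expanded Jacobian: with [x_j = X^(om_j)], the operator
    [x_j d/dx_j] multiplies [X^l] by [<l, a_j^vee>]. *)
Definition pair_mx (f : {ffun 'I_n -> K}) : 'M[R]_n :=
  \matrix_(i, j) cr (a_ j) (fsval (f i) (om i)).

(** Applying [s_k] to all rows is right multiplication by [E], the matrix of [s_k] in the basis of
    fundamental weights, whose determinant is -1. *)
Lemma det_pair_mx_srefl k (f : {ffun 'I_n -> K}) :
  \det (pair_mx [ffun i => srefl_K k (f i)]) = - \det (pair_mx f).
Proof.
pose E : 'M[R]_n := \matrix_(i, j) ((i == j)%:R - (i == k)%:R * cr (a_ j) (a_ k)).
have -> : pair_mx [ffun i => srefl_K k (f i)] = pair_mx f *m E.
  apply/matrixP => i j; rewrite !mxE ffunE /= comp_lfunE reflE /reflection.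
  rewrite pair_corootD pair_corootN pair_corootZ.
  under eq_bigr do rewrite !mxE mulrBr.
  rewrite sumrB (bigD1 j) //= eqxx mulr1 big1 => [|i' /negbTE->]; last by rewrite mulr0.
  rewrite (bigD1 k) //= eqxx mul1r big1 => [|i' /negbTE->]; last by rewrite mul0r mulr0.
  by rewrite !addr0.
rewrite det_mulmx; suff -> : \det E = -1 by rewrite mulrN1.
rewrite /determinant (bigD1 1%g) //= odd_perm1 expr0 mul1r [X in _ + X]big1 ?addr0.
  rewrite (bigD1 k) //= perm1 mxE !eqxx mul1r pair_coroot_self ?sroot_neq0 //.
  rewrite big1 ?mulr1 => [|i ik]; last by rewrite perm1 mxE eqxx (negbTE ik) mul0r subr0.
  by rewrite [true%:R]mulr1n; ring.
(* A nontrivial permutation moves some index other than [k], and row [i] of [E] has no off-diagonal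
   entry there. *)
move=> s s1; have [i ik si] : exists2 i, i != k & s i != i.
  apply/exists_inP; apply: contraR s1 => /exists_inPn h.
  have h' i : i != k -> s i = i by move/h; rewrite negbK => /eqP.
  apply/eqP/permP => i; rewrite perm1; have [->|/h'//] := eqVneq i k.
  apply/eqP; have [//|sk] := eqVneq (s k) k.
  by have /perm_inj/eqP := h' _ sk; rewrite (negbTE sk).
by rewrite (bigD1 i) //= mxE eq_sym (negbTE si) (negbTE ik) mul0r subr0 mul0r mulr0.
Qed.

Definition om_sum (f : {ffun 'I_n -> K}) : V := \sum_i fsval (f i) (om i).

Definition jac_sum : seq (R * V) :=
  [seq (\det (pair_mx f), om_sum f) | f <- index_enum {ffun 'I_n -> K}].

Lemma fcoef_jac l :
  fcoef jac_sum l = \sum_(f : {ffun 'I_n -> K} | om_sum f == l) \det (pair_mx f).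
Proof. by rewrite /fcoef big_map. Qed.

Lemma jac_antisym i l : fcoef jac_sum (s_ i l) = - fcoef jac_sum l.
Proof.
pose h (f : {ffun 'I_n -> K}) := [ffun k => srefl_K i (f k)].
have hK : involutive h.
  by move=> f; apply/ffunP => k; rewrite !ffunE; apply/val_inj; exact: srefl_compK.
rewrite !fcoef_jac (reindex_inj (inv_inj hK)) -sumrN /=; apply: eq_big => f; last first.
  by move=> _; exact: det_pair_mx_srefl.
have -> : om_sum (h f) = s_ i (om_sum f).
  rewrite /om_sum linear_sum; apply: eq_bigr => k _.
  by rewrite ffunE /= comp_lfunE.
by rewrite (inj_eq (weyl_inj (weyl_srefl D i))).
Qed.

(** In a term of exponent [rho] every [om_i] is fixed, so its matrix is the identity and it
    contributes 1. The constant family 1 is such a term. *)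
Lemma jac_rho : fcoef jac_sum rho != 0.
Proof.
have E f : om_sum f = rho -> \det (pair_mx f) = 1.
  move=> /(sum_om_weyl (fun i => weylK_mem (f i))) E.
  rewrite -(det1 R n); congr (\det _); apply/matrixP => i j.
  by rewrite !mxE E fundwP.
rewrite fcoef_jac (bigD1 [ffun=> weyl_1K]) /=; last first.
  by apply/eqP/eq_bigr => i _; rewrite ffunE /= id_lfunE.
rewrite E; last by apply: eq_bigr => i _; rewrite ffunE /= id_lfunE.
rewrite gt_eqF // ltr_pwDl // sumr_ge0 // => f /andP[/eqP/E -> _].
exact: ler01.
Qed.

Lemma mem_jac_sum x : x \in jac_sum -> P x.2 /\ forall i, 0 <= <<rho - x.2, om i>>.
Proof.
case/mapP => f _ -> /=; split.
  by apply: weight_sum => i; apply: weight_weyl (weylK_mem _) (weight_om D i).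
move=> j; rewrite -sumrB form_suml sumr_ge0 // => i _.
exact: om_dominance (weylK_mem _).
Qed.

Lemma torusD t l m : torus D t -> P l -> P m -> t (l + m) = t l * t m.
Proof. by case=> _ _ h; exact: h. Qed.

Lemma torus_neq0 t l : torus D t -> P l -> t l != 0.
Proof. by case=> h _ _; exact: h. Qed.

Lemma torusN t l : torus D t -> P l -> t (- l) = (t l)^-1.
Proof.
move=> Tt Pl; apply: (mulfI (torus_neq0 Tt Pl)).
rewrite -(torusD Tt) ?subrr //; last exact: weightN.
by case: (Tt) => _ -> _; rewrite mulfV // torus_neq0.
Qed.

Lemma torusB t l m : torus D t -> P l -> P m -> t (l - m) = t l / t m.
Proof. by move=> Tt Pl Pm; rewrite (torusD Tt) ?(torusN Tt) //; exact: weightN. Qed.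

Lemma torus_torus_act t w : weyl D w -> torus D t -> torus D (torus_act w t).
Proof.
move=> Ww [t0 t1 tM]; have PV l : P l -> P ((w^-1)%VF l).
  by move=> Pl; apply: weight_weyl => //; exact: weyl_inv.
split=> [l /PV/t0//| |l m /PV Pl /PV Pm]; first by rewrite /torus_act linear0.
by rewrite /torus_act linearD tM.
Qed.

Lemma torus_sum t (f : 'I_n -> V) : torus D t -> (forall i, P (f i)) ->
  t (\sum_i f i) = \prod_i t (f i).
Proof.
move=> Tt Pf; suff [] : P (\sum_i f i) /\ t (\sum_i f i) = \prod_i t (f i) by [].
elim/big_ind2: _ => [|x x' y y' [Px <-] [Py <-]|i _] //; last first.
  by split; [exact: weightD|rewrite (torusD Tt)].
by split; [exact: weight0|case: Tt].
Qed.

(** Subtracting [c] times the denominator cancels [X^rho] and keeps antisymmetry, so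
    [antisym_unique] leaves nothing. *)
Lemma feval_jac t : torus D t ->
  feval t jac_sum = (fcoef jac_sum rho)%:C * (t rho * \prod_(a <- pos_roots D) (1 - t (- a))).
Proof.
move=> Tt; set c := fcoef jac_sum rho.
have tM : char_mul D t by move=> *; exact: torusD.
rewrite -feval_denom //; last exact: mem_pos_roots.
pose N := [seq (- c * x.1, x.2) | x <- denom D (pos_roots D)].
have coefN l : fcoef N l = - c * fcoef (denom D (pos_roots D)) l.
  by rewrite /fcoef big_map mulr_sumr.
have supp l : fcoef (jac_sum ++ N) l != 0 ->
    exists2 x, x \in jac_sum ++ denom D (pos_roots D) & l = x.2.
  rewrite fcoef_cat coefN; have [->|/fcoef_mem/mapP[x xj ->] _] := eqVneq (fcoef jac_sum l) 0.
    rewrite add0r mulf_eq0 negb_or => /andP[_ /fcoef_mem/mapP[x xj ->]].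
    by exists x; rewrite // mem_cat xj orbT.
  by exists x; rewrite // mem_cat xj.
have le x : x \in jac_sum ++ denom D (pos_roots D) ->
    P x.2 /\ forall i, 0 <= <<rho - x.2, om i>>.
  rewrite mem_cat => /orP[/mem_jac_sum//|]; apply: denom_le; exact: mem_pos_roots.
have Z l : fcoef (jac_sum ++ N) l = 0.
  apply: (@antisym_unique R V n D _ (map snd (jac_sum ++ denom D (pos_roots D)))).
  - by move=> {}l /supp[x xj ->]; exact: map_f.
  - by move=> {}l /supp[x /le[]] ? ? ->.
  - by move=> i {}l; rewrite !fcoef_cat !coefN jac_antisym denom_antisym; ring.
  - by move=> {}l /supp[x /le[]] ? ? ->.
  by rewrite fcoef_cat coefN denom_rho mulr1 subrr.
have := fcoef0_feval t Z; rewrite feval_cat => /eqP; rewrite addr_eq0 => /eqP ->.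
rewrite /feval big_map mulr_sumr -sumrN; apply: eq_bigr => x _ /=.
by rewrite rmorphM rmorphN; ring.
Qed.

(** The entry is [x_j d/dx_j] of the orbit sum of [om i], evaluated at [t], with
    [x_j = X^(om_j)]. *)
Definition jacobian t : 'M[C]_n :=
  \matrix_(i, j) \sum_(x : K) t (fsval x (om i)) * (cr (a_ j) (fsval x (om i)))%:C.

Lemma det_jacobian t : torus D t -> \det (jacobian t) = feval t jac_sum.
Proof.
move=> Tt; rewrite det_sum_rows /feval big_map; apply: eq_bigr => f _ /=.
rewrite /om_sum (torus_sum Tt); last first.
  by move=> i; apply: weight_weyl (weylK_mem _) (weight_om D i).
rewrite -det_map_mx /determinant mulr_suml; apply: eq_bigr => s _.
rewrite -mulrA; congr (_ * _); rewrite -big_split; apply: eq_bigr => i _.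
by rewrite !mxE mulrC.
Qed.

(* If [v t = t], then [v] fixes the vectors [sum_w t(w om_i) w om_i], which are
   the rows of the Jacobian and hence form a basis when [t] is regular. *)
Lemma regular_fix t v : torus D t -> weyl D v ->
  (forall a, a \in roots D -> pos a -> t a != 1) ->
  (forall l, P l -> torus_act v t l = t l) -> v = \1%VF.
Proof.
move=> Tt Wv reg fix_t.
have dn : \det (jacobian t) != 0.
  rewrite det_jacobian // feval_jac // mulf_neq0 //.
    by rewrite fmorph_eq0 jac_rho.
  rewrite mulf_neq0 ?torus_neq0 //; first exact: weight_rho.
  rewrite prodf_seq_neq0; apply/allP => a /mem_pos_roots[aR pa].
  rewrite /= subr_eq0 eq_sym torusN //; last exact: weight_root.
  by rewrite invr_eq1 reg.
have vom j k : <<v (om j) - om j, om k>> = 0.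
  pose g (x : V) : R := <<v x - x, om k>>.
  have gE x : g x = \sum_j cr (a_ j) x * g (om j).
    rewrite /g {1 2}[x](weight_coord D) linear_sum -sumrB form_suml.
    by apply: eq_bigr => i _; rewrite linearZ /= -scalerBr formZl.
  (* Reindex by [w -> v w] and use [t (v (w om_i)) = t (w om_i)]. *)
  have S0 i : \sum_(x : K) t (fsval x (om i)) * (g (fsval x (om i)))%:C = 0.
    pose h w : C := t (w (om i)) * (<<w (om i), om k>>)%:C.
    have E : \sum_(w <- weyl_seq D) h w =
        \sum_(w <- weyl_seq D) t (w (om i)) * (<<v (w (om i)), om k>>)%:C.
      rewrite -(sum_weyl_comp _ Wv); apply: eq_big_seq => w /mem_weyl_seq Ww.
      rewrite /h comp_lfunE -fix_t; last first.
        by apply: weight_weyl => //; apply: weight_weyl => //; exact: weight_om.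
      by rewrite /torus_act (weylK _ Wv).
    move: E; rewrite /weyl_seq !big_seq_fsetE /= => /eqP; rewrite eq_sym -subr_eq0 -sumrB => /eqP.
    move=> E; rewrite -[RHS]E; apply: eq_bigr => x _.
    by rewrite /g formDl formNl rmorphD rmorphN mulrDr mulrN.
  (* As [g] is linear, [S0] says that the Jacobian annihilates the column of the values
     [g (om j)]. *)
  pose c : 'cV[C]_n := \col_j (g (om j))%:C.
  have Ac : jacobian t *m c = 0.
    apply/matrixP => i j'; rewrite !mxE -[RHS](S0 i).
    under eq_bigr do rewrite !mxE mulr_suml.
    rewrite exchange_big; apply: eq_bigr => x _ /=.
    rewrite gE rmorph_sum mulr_sumr; apply: eq_bigr => j'' _.
    by rewrite -mulrA -rmorphM.
  have c0 : c = 0.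
    rewrite -[c]mul1mx -(@mulVmx _ _ (jacobian t)) ?unitmxE ?unitfE //.
    by rewrite -mulmxA Ac mulmx0.
  have /matrixP/(_ j 0) := c0; rewrite !mxE => /eqP.
  by rewrite fmorph_eq0 => /eqP.
apply/lfunP => x; rewrite id_lfunE [x](weight_coord D) linear_sum.
apply: eq_bigr => i _; rewrite linearZ /=; congr (_ *: _).
by apply/eqP; rewrite -subr_eq0; apply/eqP/(@form_om_inj R V n D).
Qed.

End Jacobian.

(** Chooses the twist in [admissible_stab], where each positive root excludes at most one exponent
    [k]. *)
Lemma eventually_none (E : eqType) (L : seq E) (bad : E -> nat -> Prop) :
  (forall x k k', x \in L -> bad x k -> bad x k' -> k = k') ->
  exists k, forall x, x \in L -> ~ bad x k.
Proof.
move=> h; suff [k hk] : exists K, forall k x, (K <= k)%N -> x \in L -> ~ bad x k.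
  by exists k => x; apply: hk.
elim: L h => [|x L IH] h; first by exists 0%N.
have [|K hK] := IH; first by move=> y k k' yL; apply: h; rewrite inE yL orbT.
have [[k0 b0]|nb] := pselect (exists k, bad x k).
  exists (maxn K k0.+1) => k y; rewrite geq_max => /andP[Kk k0k]; rewrite inE.
  case/orP => [/eqP ->|yL]; last exact: hK.
  by move=> b; move: k0k; rewrite (h x k0 k (mem_head _ _) b0 b) ltnn.
exists K => k y Kk; rewrite inE => /orP[/eqP->|yL]; last exact: hK.
by move=> b; apply: nb; exists k.
Qed.

(** * Stabilizers in the torus and unique labels for the weights of an orbit *)

Section Stabilizers.
Variables (R : realType) (V : vectType R) (n : nat) (D : rootSystem V n).
Local Notation "<< u , v >>" := (Defs.form D u v) (at level 0, u, v at level 99).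
Local Notation a_ i := (sroot D i).
Local Notation s_ i := (srefl D i).
Local Notation P := (weight_lattice D).
Local Notation pos := (pos D).
Local Notation rho := (rho D).
Local Notation C := R[i].
Implicit Types (a b l : V) (u v w : 'End(V)).

(** Characters are functions on [V] whose values outside [P] carry no meaning. *)
Definition eqchar (s t : V -> C) := forall l, P l -> s l = t l.

Lemma eqchar_sym s t : eqchar s t -> eqchar t s.
Proof. by move=> h l Pl; rewrite h. Qed.

Lemma eqchar_trans s t r : eqchar s t -> eqchar t r -> eqchar s r.
Proof. by move=> h h' l Pl; rewrite h // h'. Qed.

Lemma eqchar_act u s t : weyl D u -> eqchar s t -> eqchar (torus_act u s) (torus_act u t).
Proof. by move=> Wu h l Pl; apply: h; apply: weight_weyl => //; exact: weyl_inv. Qed.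

Lemma torus_act_comp u v (t : V -> C) : weyl D u -> weyl D v ->
  torus_act (u \o v)%VF t = torus_act u (torus_act v t).
Proof.
by move=> Wu Wv; apply/funext => l; rewrite /torus_act (weyl_compV Wu Wv) comp_lfunE.
Qed.

Lemma torus_act1 (t : V -> C) : torus_act \1%VF t = t.
Proof.
apply/funext => l; rewrite /torus_act -{1}[l](id_lfunE) (weylK _ (weyl1 D)) //.
Qed.

(* [w] satisfies [R(w) cap Z(t) = 0]. *)
Definition admissible (t : V -> C) w :=
  weyl D w /\ forall a, a \in roots D -> pos a -> t a = 1 -> pos (w a).

Lemma admissibleP t w : weyl D w ->
  admissible t w <-> inv_set D w `&` Zset D t = set0.
Proof.
move=> Ww; split=> [[_ h]|h].
  apply/seteqP; split=> // a [/(inv_setP _ Ww)[aR pa na] [_ ta]].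
  by case/negP: na; exact: h.
split=> // a aR pa ta; apply/negPn/negP => na.
have : (inv_set D w `&` Zset D t) a.
  by split; [apply/inv_setP|split => //; apply/pos_rootP].
by rewrite h.
Qed.

Lemma torus_root_opp t a : torus D t -> a \in roots D -> t (- a) = 1 -> t a = 1.
Proof.
move=> Tt aR; rewrite (torusN Tt) => [/eqP|]; last exact: weight_root.
by rewrite invr_eq1 => /eqP.
Qed.

Lemma admissible_root t w a : torus D t -> admissible t w -> a \in roots D ->
  t a = 1 -> pos (w a) = pos a.
Proof.
move=> Tt [Ww hw] aR ta; have [pa|na] := boolP (pos a); first exact: hw.
apply/negbTE; rewrite -pos_opp ?weyl_root // -linearN; apply: hw.
- exact: root_opp.
- by rewrite pos_opp.
by apply: (torus_root_opp Tt); rewrite ?root_opp // opprK.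
Qed.

(* Steinberg's theorem on stabilizers. The vector [z] is fixed by [v] and positive
   on [Z(t)], so twisting [t] by [exp(k <., z>)] reduces to the regular case. *)
Lemma admissible_stab t v : torus D t -> admissible t v ->
  eqchar (torus_act v t) t -> v = \1%VF.
Proof.
move=> Tt Av; have [Wv _] := Av => fv.
(* [G] consists of the elements of the stabilizer of [t] that preserve positivity on [Z(t)]. It is
   stable under left multiplication by [v], so the sum of the [w rho] over [G] is fixed by [v]. *)
pose G w := admissible t w /\ eqchar (torus_act w t) t.
have tfix w a : G w -> a \in roots D -> t a = 1 -> t (w a) = 1.
  move=> [[Ww _] fw] aR <-; rewrite -(fw (w a)).
    by rewrite /torus_act (weylK _ Ww).
  by apply/weight_root; rewrite weyl_root.
have Gv w : weyl D w -> G (v \o w)%VF <-> G w.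
  move=> Ww; split=> [[[_ hw] fw]|Gw].
    have fw' : eqchar (torus_act w t) t.
      move=> l Pl; have Pvl : P (v l) by apply: weight_weyl.
      have Ev : torus_act v t (v l) = t (v l) by apply: fv.
      have := fw (v l) Pvl; rewrite torus_act_comp // -Ev /torus_act !(weylK _ Wv).
      by [].
    split=> //; split=> // a aR pa ta; have := hw a aR pa ta; rewrite comp_lfunE.
    rewrite (admissible_root Tt Av) // ?weyl_root //.
    rewrite -ta -(fw' (w a)); first by rewrite /torus_act (weylK _ Ww).
    by apply/weight_root; rewrite weyl_root.
  have [[_ hw] fw] := Gw; split; last first.
    rewrite torus_act_comp //; apply: eqchar_trans fv; exact: eqchar_act.
  split=> [|a aR pa ta]; first exact: weyl_comp.
  by rewrite comp_lfunE (admissible_root Tt Av) ?hw ?weyl_root ?(tfix w).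
pose z := \sum_(w <- weyl_seq D | `[< G w >]) w rho.
have vz : v z = z.
  rewrite /z [in RHS]big_mkcond -(sum_weyl_comp _ Wv) -big_mkcond linear_sum.
  rewrite big_seq_cond [in RHS]big_mkcond /= [in LHS]big_mkcond.
  apply: eq_big_seq => w /[dup] wK /mem_weyl_seq Ww /=; rewrite wK /=.
  rewrite comp_lfunE; congr (if _ then _ else _).
  by apply/asboolP/asboolP => /Gv; apply.
have zpos a : a \in roots D -> pos a -> t a = 1 -> 0 < <<a, z>>.
  move=> aR pa ta; have W1 : \1%VF \in weyl_seq D by apply/mem_weyl_seq/weyl1.
  have G1 : G \1%VF.
    split; last by rewrite torus_act1.
    by split; [exact: weyl1|move=> *; rewrite id_lfunE].
  have term w : weyl D w -> G w -> 0 < <<a, w rho>>.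
    move=> Ww Gw; rewrite form_sym (weyl_formV _ _ Ww) form_sym.
    rewrite -/(pos _) -(admissible_root Tt Gw.1) ?(weylVK _ Ww) //.
      by rewrite (weyl_root (weyl_inv Ww)).
    by rewrite -[RHS]ta -(Gw.2 a) //; exact: weight_root.
  rewrite form_sumr big_mkcond (bigD1_seq \1%VF) ?fset_uniq //= (asboolT G1).
  rewrite ltr_pwDl //; first exact/term/G1/weyl1.
  rewrite big_seq_cond sumr_ge0 // => w /andP[/mem_weyl_seq Ww _].
  by case: asboolP => // Gw; exact/ltW/term.
pose t' (k : nat) l := t l * (expR (k%:R * <<l, z>>))%:C.
have Tt' k : torus D (t' k).
  have [t0 t1 tM] := Tt; split=> [l Pl||l m Pl Pm].
  - by rewrite mulf_neq0 ?t0 // fmorph_eq0 gt_eqF // expR_gt0.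
  - by rewrite /t' form0l mulr0 expR0 t1 mulr1.
  by rewrite /t' tM // formDl mulrDr expRD rmorphM mulrACA.
(* Two bad exponents for the same root [a] would force [<a, z> = 0], hence [t a = 1], against the
   positivity of [z] on [Z(t)]. *)
have [k hk] : exists k, forall a, a \in pos_roots D -> ~ (t' k a = 1).
  apply: eventually_none => a k k' /mem_pos_roots[aR pa] E E'.
  have ta0 : t a != 0 by exact: (torus_neq0 Tt (weight_root aR)).
  have : expR (k%:R * <<a, z>>) = expR (k'%:R * <<a, z>>).
    apply: (fmorph_inj (real_complex R)); apply: (mulfI ta0).
    by rewrite -[LHS]/(t' k a) -[RHS]/(t' k' a) E E'.
  move/expR_inj/eqP; rewrite -subr_eq0 -mulrBl mulf_eq0 subr_eq0 eqr_nat.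
  case/orP => [/eqP //|/eqP az0]; move: E; rewrite /t' az0 mulr0 expR0 mulr1 => ta.
  by have := zpos a aR pa ta; rewrite az0 ltxx.
apply: (regular_fix (Tt' k) Wv) => [a aR pa|l Pl].
  by apply/eqP/hk; rewrite mem_filter mem_undup pa aR.
rewrite /torus_act /t'; congr (_ * (expR (_ * _))%:C); first exact: fv.
by rewrite -(weyl_form _ _ Wv) (weylVK _ Wv) vz.
Qed.

(** [u^-1 u'] fixes [t] and is admissible, since [u] and [u'] both preserve the sign of the roots
    with value 1. *)
Lemma admissible_inj t u u' : torus D t -> admissible t u -> admissible t u' ->
  eqchar (torus_act u t) (torus_act u' t) -> u = u'.
Proof.
move=> Tt Au Au' E; have [Wu _] := Au; have [Wu' _] := Au'.
have WV := weyl_inv Wu; have Wx := weyl_comp WV Wu'.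
have fx : eqchar (torus_act (u^-1 \o u')%VF t) t.
  move=> l Pl; rewrite torus_act_comp // /torus_act (weyl_invK Wu).
  by have := E (u l) (weight_weyl Wu Pl); rewrite /torus_act (weylK _ Wu).
have tx a : a \in roots D -> t a = 1 -> t ((u^-1)%VF (u' a)) = 1.
  move=> aR <-; rewrite -(fx _ (weight_root _)).
    by rewrite /torus_act -[(u^-1)%VF (u' a)]comp_lfunE (weylK _ Wx).
  by rewrite (weyl_root WV) ?weyl_root.
have E1 : (u^-1 \o u')%VF = \1%VF.
  apply: (admissible_stab Tt) => //; split=> // a aR pa ta; rewrite comp_lfunE.
  rewrite -(admissible_root Tt Au) ?tx ?(weyl_root WV) ?weyl_root //.
  by rewrite (weylVK _ Wu) (admissible_root Tt Au').
apply/lfunP => l; have /lfunP/(_ l) := E1; rewrite comp_lfunE id_lfunE => E2.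
by rewrite -{1}E2 (weylVK _ Wu).
Qed.

(** [s_i] makes a positive [u a] negative only when [u a = a_i], and there [t a] is not 1. *)
Lemma admissible_srefl t u i : torus D t -> admissible t u ->
  torus_act u t (a_ i) != 1 -> admissible t (s_ i \o u)%VF.
Proof.
move=> Tt Au; have [Wu hu] := Au => ne; split=> [|a aR pa ta]; first exact: weyl_spos.
rewrite comp_lfunE; apply: pos_srefl; rewrite ?weyl_root ?hu //.
by apply: contra ne => /eqP <-; rewrite /torus_act (weylK _ Wu) ta.
Qed.

Lemma torus_act_srefl t i : torus D t -> t (a_ i) = 1 -> eqchar (torus_act (s_ i) t) t.
Proof.
move=> Tt ti l Pl; rewrite /torus_act sreflV reflE /reflection.
have /intrP[k ->] := pair_coroot_weight i Pl.
have tk (m : nat) : t (m%:R *: a_ i) = 1.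
  elim: m => [|m IH]; first by rewrite scale0r; case: Tt.
  rewrite -natr1 scalerDl scale1r (torusD Tt) ?IH ?ti ?mulr1 //.
    by rewrite -[m%:R]/((Posz m)%:~R); exact/weightZ/weight_sroot.
  exact: weight_sroot.
have Pm (m : nat) : P (m%:R *: a_ i).
  by rewrite -[m%:R]/((Posz m)%:~R); exact/weightZ/weight_sroot.
rewrite (torusB Tt) //; last exact/weightZ/weight_sroot.
case: k => m; first by rewrite tk divr1.
by rewrite NegzE rmorphN scaleNr (torusN Tt (Pm m.+1)) (tk m.+1) invr1 divr1.
Qed.

(** Letter by letter: if the current weight is 1 on [a_i], then [s_i] fixes it and the label is
    kept; otherwise the label is multiplied by [s_i] and stays admissible. *)
Lemma admissible_exists t w : torus D t -> weyl D w ->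
  exists2 u, admissible t u & eqchar (torus_act u t) (torus_act w t).
Proof.
move=> Tt Ww; elim/weyl_ind_simple: w / Ww => [|i w Ww [u Au E]].
  by exists \1%VF; [split; [exact: weyl1|move=> *; rewrite id_lfunE]|].
have [Wu _] := Au; have Ws := weyl_srefl D i.
have Eu : eqchar (torus_act (s_ i) (torus_act u t)) (torus_act (s_ i \o w)%VF t).
  by rewrite (torus_act_comp _ Ws Ww); exact: eqchar_act.
have [u1|un1] := eqVneq (torus_act u t (a_ i)) 1; last first.
  exists (s_ i \o u)%VF; first exact: admissible_srefl.
  by rewrite (torus_act_comp _ Ws Wu).
exists u => //; apply: eqchar_trans Eu; apply: eqchar_sym.
by apply: torus_act_srefl => //; exact: torus_torus_act.
Qed.

End Stabilizers.

(** * Dihedral subgroups *)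

Section Dihedral.
Variables (R : realType) (V : vectType R) (n : nat) (D : rootSystem V n).
Local Notation "<< u , v >>" := (Defs.form D u v) (at level 0, u, v at level 99).
Local Notation a_ i := (sroot D i).
Local Notation s_ i := (srefl D i).
Local Notation om i := (fundw D i).
Local Notation pos := (pos D).
Implicit Types (u v w : 'End(V)) (a b c : 'I_n).

Fixpoint alt_refl k a b : 'End(V) := if k is k'.+1 then (s_ a \o alt_refl k' b a)%VF else \1%VF.

(** The letter that continues the alternating word of length [k] starting with [a]. *)
Definition alt_next k a b := if odd k then b else a.

Lemma alt_nextS k a b : alt_next k.+1 a b = alt_next k b a.
Proof. by rewrite /alt_next /=; case: odd. Qed.

Lemma weyl_alt_refl k a b : weyl D (alt_refl k a b).
Proof. by elim: k a b => [|k IH] a b; [exact: weyl1|exact: weyl_spos]. Qed.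

Lemma alt_refl_add k l a b :
  alt_refl (k + l) a b = (alt_refl k a b \o alt_refl l (alt_next k a b) (alt_next k b a))%VF.
Proof.
elim: k a b => [|k IH] a b; first by rewrite comp_lfun1l.
by rewrite addSn /= IH !alt_nextS comp_lfunA.
Qed.

Lemma alt_refl_rcons k a b : alt_refl k.+1 a b = (alt_refl k a b \o s_ (alt_next k a b))%VF.
Proof. by rewrite -addn1 alt_refl_add /= comp_lfun1r. Qed.

Lemma alt_refl_inv k a b :
  ((alt_refl k a b)^-1)%VF = if odd k then alt_refl k a b else alt_refl k b a.
Proof.
elim: k a b => [|k IH] a b.
  by apply/lfunP => x; rewrite -{1}[x]id_lfunE (weylK _ (weyl1 D)) id_lfunE.
rewrite /= (weyl_compV (weyl_srefl D a) (weyl_alt_refl k b a)) IH sreflV.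
have := alt_refl_rcons k b a; have := alt_refl_rcons k a b; rewrite /alt_next /=.
by case: odd => /= h1 h2; rewrite ?h1 ?h2.
Qed.

Lemma alt_reflK k a b :
  (alt_refl k a b \o (if odd k then alt_refl k a b else alt_refl k b a))%VF = \1%VF.
Proof.
rewrite -alt_refl_inv; apply/lfunP => x.
by rewrite comp_lfunE (weylVK _ (weyl_alt_refl k a b)) id_lfunE.
Qed.

Lemma iter_alt_refl m a b (x : V) : iter m (fun u : V => s_ a (s_ b u)) x = alt_refl m.*2 a b x.
Proof. by elim: m => [|m IH]; rewrite ?id_lfunE //= IH !comp_lfunE. Qed.

(* [s_a s_b] has order [m]. *)
Definition dih m a b := [/\ (0 < m)%N, alt_refl m.*2 a b = \1%VF &
  forall k, (0 < k < m)%N -> alt_refl k.*2 a b <> \1%VF].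

Lemma dih_order m a b : dih m a b <-> is_order_ss D a b m.
Proof.
split=> [[m0 h1 h2]|[m0 h1 h2]]; split=> //.
- by move=> v; rewrite iter_alt_refl h1 id_lfunE.
- move=> k /h2 h.
  have [//|ne] := pselect (exists v : V, iter k (fun u : V => s_ a (s_ b u)) v <> v).
  case: h; apply/lfunP => x; rewrite id_lfunE -iter_alt_refl.
  by have [//|nx] := pselect (iter k (fun u : V => s_ a (s_ b u)) x = x); case: ne; exists x.
- by apply/lfunP => x; rewrite -iter_alt_refl h1 id_lfunE.
by move=> k /h2[x hx] E; apply: hx; rewrite iter_alt_refl E id_lfunE.
Qed.

Lemma alt_refl_double k a b : alt_refl k.*2 a b = (alt_refl k a b \o
  (if odd k then alt_refl k b a else alt_refl k a b))%VF.
Proof. by rewrite -addnn alt_refl_add /alt_next; case: odd. Qed.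

Lemma alt_refl_doubleC k a b : alt_refl k.*2 b a = ((alt_refl k.*2 a b)^-1)%VF.
Proof. by rewrite alt_refl_inv odd_double. Qed.

Lemma inv_id : ((\1%VF : 'End(V))^-1)%VF = \1%VF.
Proof. by apply/lfunP => x; rewrite -{1}[x]id_lfunE (weylK _ (weyl1 D)) id_lfunE. Qed.

Lemma dih_sym m a b : dih m a b -> dih m b a.
Proof.
case=> m0 h1 h2; split=> //; first by rewrite alt_refl_doubleC h1 inv_id.
move=> k /h2 h; rewrite alt_refl_doubleC => E; apply: h.
by rewrite alt_refl_doubleC alt_refl_doubleC E inv_id.
Qed.

(** The Weyl group is finite, so two powers of [s_a s_b] coincide. *)
Lemma dih_exists a b : exists m, dih m a b.
Proof.
suff h0 : exists m, (0 < m)%N && `[< alt_refl m.*2 a b = \1%VF >].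
  case: (ex_minnP h0) => m /andP[m_gt0 /asboolP h1] hmin.
  exists m; split=> // k /andP[k0 km] E.
  by have := hmin k; rewrite k0 (asboolT E) => /(_ isT); rewrite leqNgt km.
pose W := weyl_seq D; pose f k := alt_refl k.*2 a b.
have /uniqPn : ~~ uniq (mkseq f (size W).+1).
  apply/negP => /uniq_leq_size/(_ (_ : {subset _ <= W})).
  rewrite size_mkseq ltnn => h; suff: false by []; apply: h => w /mapP[k _ ->].
  exact/mem_weyl_seq/weyl_alt_refl.
move=> /(_ \1%VF)[k [l [kl]]]; rewrite size_mkseq => lW.
rewrite !nth_mkseq // ?(ltn_trans kl) // => E.
exists (l - k)%N; rewrite subn_gt0 kl /=; apply/asboolP.
have : f l = (f k \o f (l - k)%N)%VF.
  by rewrite /f -{1}(subnKC (ltnW kl)) doubleD alt_refl_add /alt_next odd_double.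
rewrite -E => {}E; apply/lfunP => x; apply: (weyl_inj (weyl_alt_refl k.*2 a b)).
by have /lfunP/(_ x) := E; rewrite comp_lfunE id_lfunE => <-.
Qed.

Lemma dih_alt_refl m a b : dih m a b -> alt_refl m a b = alt_refl m b a.
Proof.
case=> _ + _; rewrite alt_refl_double => h; apply/lfunP => x.
have [odm|em] := boolP (odd m).
  rewrite odm in h; have /lfunP/(_ (alt_refl m b a x)) := h; rewrite comp_lfunE id_lfunE.
  have := alt_reflK m b a; rewrite odm => /lfunP/(_ x); rewrite comp_lfunE id_lfunE => E1.
  by rewrite !E1.
rewrite (negbTE em) in h; have /lfunP/(_ (alt_refl m b a x)) := h; rewrite comp_lfunE id_lfunE.
have := alt_reflK m a b; rewrite (negbTE em) => /lfunP/(_ x); rewrite comp_lfunE id_lfunE => E1.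
by rewrite E1.
Qed.

Lemma alt_refl_om k a b i (x : V) : i != a -> i != b -> <<alt_refl k a b x, om i>> = <<x, om i>>.
Proof.
elim: k a b => [|k IH] a b ia ib /=; first by rewrite id_lfunE.
rewrite comp_lfunE reflE /reflection formDl formNl formZl (form_sym D (a_ a)).
by rewrite form_om_sroot (negbTE ia) !mul0r mulr0 subr0 IH.
Qed.

(** Alternating words of length at most [m] are reduced. A sign change at an earlier letter would
    make the two alternating words of length [k.+1] equal, and [s_a s_b] would have order below
    [m]. *)
Lemma dih_pos m a b k : dih m a b -> (k < m)%N -> pos (alt_refl k a b (a_ (alt_next k a b))).
Proof.
elim: k a b => [|k IH] a b hd km; first by rewrite id_lfunE pos_sroot.
rewrite /= comp_lfunE alt_nextS; set c := alt_next k b a.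
have pc : pos (alt_refl k b a (a_ c)) by apply: IH (dih_sym hd) (ltnW km).
have Wx := weyl_alt_refl k b a.
apply/negPn/negP => ns; have E := srefl_neg (weyl_root Wx (sroot_root D c)) pc ns.
have E1 : alt_refl k.+1 a b = alt_refl k.+1 b a.
  rewrite (alt_refl_rcons k b a) -/c; apply/lfunP => x.
  by rewrite /= !comp_lfunE -(refl_conj _ _ Wx) E.
have [_ _ /(_ k.+1)] := hd; rewrite km => /(_ isT); case.
rewrite alt_refl_double; case: ifP => ok.
  by rewrite -E1 -[RHS](alt_reflK k.+1 a b) ok.
by rewrite -[RHS](alt_reflK k.+1 a b) ok -E1.
Qed.

Lemma dih_neg m a b : dih m a b -> ~~ pos (alt_refl m a b (a_ a)) /\ ~~ pos (alt_refl m a b (a_ b)).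
Proof.
move=> hd; have hs := dih_sym hd; have E := dih_alt_refl hd.
case: m hd hs E => [|m] hd hs E; first by case: hd.
have key x y : dih m.+1 x y -> ~~ pos (alt_refl m.+1 x y (a_ (alt_next m x y))).
  move=> h; rewrite alt_refl_rcons comp_lfunE refl_self ?sroot_neq0 // linearN /=.
  rewrite pos_opp; first by rewrite negbK (dih_pos h).
  by rewrite weyl_root ?sroot_root //; exact: weyl_alt_refl.
have := key _ _ hd; have := key _ _ hs; rewrite -E /alt_next.
by case: odd => h1 h2; split.
Qed.

Lemma dih_alt_refl_neq m a b k x y : dih m a b -> (k < m)%N ->
  (x = a /\ y = b) \/ (x = b /\ y = a) -> alt_refl k x y <> alt_refl m a b.
Proof.
move=> hd km h E; have hxy : dih m x y by case: h => -[-> ->] //; exact: dih_sym.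
have := dih_pos hxy km; rewrite E.
have [na nb] := dih_neg hd.
by rewrite /alt_next; case: h => -[-> ->]; case: odd; rewrite ?(negbTE na) ?(negbTE nb).
Qed.

Lemma span2_coord a b (g : V) : a != b -> (forall i, i != a -> i != b -> <<g, om i>> = 0) ->
  g = coord (simple D) a g *: a_ a + coord (simple D) b g *: a_ b.
Proof.
move=> ab h; rewrite {1}[g](simple_coord D) (bigD1 a) //= (bigD1 b) 1?eq_sym //=.
rewrite big1 ?addr0 // => i /andP[ia ib].
by rewrite coordE h // mulr0 mul0r scale0r.
Qed.

Lemma pos_span2 u a b (g : V) : weyl D u -> a != b ->
  (forall i, i != a -> i != b -> <<g, om i>> = 0) -> g \in roots D -> pos g ->
  pos (u (a_ a)) -> pos (u (a_ b)) -> pos (u g).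
Proof.
move=> Wu ab h gR pg pa pb; apply/negPn; rewrite -pos_opp ?weyl_root //.
rewrite /pos formNl oppr_gt0 -leNgt [g](span2_coord ab h) linearD !linearZ /=.
have c0 i : 0 <= coord (simple D) i g.
  by rewrite coordE divr_ge0 ?form_ge0 // mulr_ge0 ?pos_om.
by rewrite formDl !formZl addr_ge0 // mulr_ge0 // ltW.
Qed.

Lemma neg_span2 u a b (g : V) : weyl D u -> a != b ->
  (forall i, i != a -> i != b -> <<g, om i>> = 0) -> g \in roots D -> pos g ->
  ~~ pos (u (a_ a)) -> ~~ pos (u (a_ b)) -> ~~ pos (u g).
Proof.
move=> Wu ab h gR pg pa pb; rewrite /pos -leNgt [g](span2_coord ab h) linearD !linearZ /=.
have c0 i : 0 <= coord (simple D) i g.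
  by rewrite coordE divr_ge0 ?form_ge0 // mulr_ge0 ?pos_om.
by rewrite formDl !formZl -oppr_ge0 opprD -!mulrN addr_ge0 // mulr_ge0 // oppr_ge0 leNgt.
Qed.

Lemma alt_refl_sroot_span k a b c i : c = a \/ c = b -> i != a -> i != b ->
  <<alt_refl k a b (a_ c), om i>> = 0.
Proof.
move=> h ia ib; rewrite alt_refl_om // form_sym form_om_sroot.
by case: h => ->; rewrite ?(negbTE ia) ?(negbTE ib) !mul0r.
Qed.

(** With two left descents [a] and [b], [v^-1] is negative on all positive roots of their plane, so
    the longest dihedral element splits off on the left. *)
Lemma dih_min m a b v : a != b -> dih m a b -> weyl D v ->
  ~~ pos ((v^-1)%VF (a_ a)) -> ~~ pos ((v^-1)%VF (a_ b)) ->
  exists v', [/\ weyl D v', v = (alt_refl m a b \o v')%VF,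
    pos ((v'^-1)%VF (a_ a)) & pos ((v'^-1)%VF (a_ b))].
Proof.
move=> ab hd Wv na nb; have W0 := weyl_alt_refl m a b; have WV := weyl_inv Wv.
have [ga gb] := dih_neg hd.
exists ((alt_refl m a b)^-1 \o v)%VF; split.
- exact: weyl_comp (weyl_inv W0) Wv.
- by apply/lfunP => x; rewrite !comp_lfunE (weylVK _ W0).
- rewrite (weyl_compV (weyl_inv W0) Wv) comp_lfunE (weyl_invK W0) -[alt_refl m a b _]opprK linearN.
  have wR : alt_refl m a b (a_ a) \in roots D by rewrite weyl_root ?sroot_root.
  rewrite pos_opp; last by rewrite (weyl_root WV) // root_opp.
  apply: (neg_span2 WV ab) => //; rewrite ?root_opp ?pos_opp // => i ia ib.
  by rewrite formNl alt_refl_sroot_span ?oppr0 //; left.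
rewrite (weyl_compV (weyl_inv W0) Wv) comp_lfunE (weyl_invK W0) -[alt_refl m a b _]opprK linearN.
have wR : alt_refl m a b (a_ b) \in roots D by rewrite weyl_root ?sroot_root.
rewrite pos_opp; last by rewrite (weyl_root WV) // root_opp.
apply: (neg_span2 WV ab) => //; rewrite ?root_opp ?pos_opp // => i ia ib.
by rewrite formNl alt_refl_sroot_span ?oppr0 //; right.
Qed.

(** For [v] without left descent in the plane, prepending the letters of an alternating word of
    length at most [m] raises the length each time. *)
Lemma dih_ascent m a b k v : a != b -> dih m a b -> (k < m)%N -> weyl D v ->
  pos ((v^-1)%VF (a_ a)) -> pos ((v^-1)%VF (a_ b)) ->
  pos (((alt_refl k b a \o v)^-1)%VF (a_ a)).
Proof.
move=> ab hd km Wv pa pb; have Wx := weyl_alt_refl k b a; have WV := weyl_inv Wv.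
rewrite (weyl_compV Wx Wv) comp_lfunE.
have xR : ((alt_refl k b a)^-1)%VF (a_ a) \in roots D.
  by rewrite (weyl_root (weyl_inv Wx)) ?sroot_root.
apply: (pos_span2 WV ab) => //.
  move=> i ia ib; rewrite alt_refl_inv; case: odd; last by rewrite alt_refl_sroot_span //; left.
  by rewrite alt_refl_sroot_span //; right.
rewrite alt_refl_inv; case: ifP => ok; [have := dih_pos (dih_sym hd) km|have := dih_pos hd km];
  by rewrite /alt_next ok.
Qed.

(** A positive root outside the plane of [a_a] and [a_b] has another positive coefficient, and [u]
    leaves that coefficient unchanged. *)
Lemma inv_span2 (g : V) u a b : weyl D u ->
  (forall i (x : V), i != a -> i != b -> <<u x, om i>> = <<x, om i>>) ->
  g \in roots D -> pos g -> ~~ pos (u g) ->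
  forall i, i != a -> i != b -> <<g, om i>> = 0.
Proof.
move=> Wu h gR pg ng i ia ib; apply/eqP; rewrite eq_le pos_om // andbT leNgt.
apply: contra ng => gi; apply: (@om_gt0_pos _ _ _ _ _ i); first by rewrite weyl_root.
by rewrite h.
Qed.

End Dihedral.

(** * Intertwiners of calibrated modules *)

(** Applying [A l - chi i l] removes [x i] and multiplies [y] by a nonzero scalar; the [chi i] may
    repeat among themselves. The operators are abstract because the lemma serves both for the module
    and for functions on [V]. *)
Lemma weight_sep (V : Type) (K : fieldType) (E : lmodType K) (Q : set V) (A : V -> E -> E)
    (s : V -> K) (I : eqType) (L : seq I) (chi : I -> V -> K) (x : I -> E) (y : E) :
  (forall l, Q l -> linear (A l)) ->
  (forall l, Q l -> A l y = s l *: y) ->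
  (forall i, i \in L -> forall l, Q l -> A l (x i) = chi i l *: x i) ->
  (forall i, i \in L -> exists2 l, Q l & chi i l != s l) ->
  y + \sum_(i <- L) x i = 0 -> y = 0.
Proof.
move=> Alin; elim: L y x => [|i L IH] y x Ay Ax sep; first by rewrite big_nil addr0.
have iL j : j \in L -> j \in i :: L by rewrite inE => ->; rewrite orbT.
rewrite big_cons => S0; have [l Ql ne] := sep i (mem_head _ _).
have A0 m : Q m -> A m 0 = 0.
  move=> Qm; have := Alin m Qm 1 0 0; rewrite scaler0 addr0 scale1r.
  by move/(congr1 (fun z => z - A m 0)); rewrite subrr addrK.
have AZ m (c : K) u : Q m -> A m (c *: u) = c *: A m u.
  by move=> Qm; rewrite -[c *: u]addr0 Alin // A0 // addr0.
have AD m u v : Q m -> A m (u + v) = A m u + A m v.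
  by move=> Qm; rewrite -{1}[u]scale1r Alin // scale1r.
have Asum : A l (y + (x i + \sum_(j <- L) x j)) =
    s l *: y + (chi i l *: x i + \sum_(j <- L) chi j l *: x j).
  rewrite !AD // Ay // Ax ?mem_head //; congr (_ + (_ + _)).
  rewrite (big_morph (A l) (fun u v => AD l u v Ql) (A0 l Ql)).
  by apply: eq_big_seq => j jL; rewrite Ax ?iL.
suff /eqP : (s l - chi i l) *: y = 0.
  by rewrite scaler_eq0 subr_eq0 eq_sym (negbTE ne) => /eqP.
apply: (IH _ (fun j => (chi j l - chi i l) *: x j)).
- by move=> m Qm; rewrite AZ // Ay // !scalerA mulrC.
- by move=> j jL m Qm; rewrite AZ // Ax ?iL // !scalerA mulrC.
- by move=> j jL; exact/sep/iL.
transitivity (A l (y + (x i + \sum_(j <- L) x j)) - chi i l *: (y + (x i + \sum_(j <- L) x j))).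
  rewrite Asum !scalerDr !opprD addrACA -scalerBl; congr (_ + _).
  rewrite addrACA subrr add0r scaler_sumr -sumrB.
  by apply: eq_bigr => j _; rewrite scalerBl.
by rewrite S0 A0 // scaler0 subr0.
Qed.

Lemma span_mapP (K : fieldType) (E : vectType K) (I : eqType) (F : I -> E) (L : seq I) x :
  uniq L -> x \in span [seq F i | i <- L] ->
  exists c : I -> K, x = \sum_(i <- L) c i *: F i.
Proof.
elim: L x => [|i L IH] x /=.
  by move=> _; rewrite span_nil memv0 => /eqP ->; exists (fun _ => 0); rewrite big_nil.
case/andP => iL uL; rewrite span_cons => /memv_addP[y /vlineP[k ->] [z /(IH _ uL)[c ->] ->]].
exists (fun j => if j == i then k else c j); rewrite big_cons eqxx; congr (_ + _).
apply: eq_big_seq => j jL; case: eqP => // ji; by rewrite -ji jL in iL.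
Qed.

Lemma eigen_in (R : realType) (M : vectType R[i]) (U : {vspace M})
    (f : {linear M -> M}) : U != 0%VS ->
  (forall m, m \in U -> f m \in U) ->
  exists c, exists2 u, u != 0 & u \in U /\ f u = c *: u.
Proof.
move=> U0 fU; have d0 : (0 < \dim U)%N by rewrite lt0n dimv_eq0.
pose A : 'M[R[i]]_(\dim U) := \matrix_(i, j) coord (vbasis U) j (f (vbasis U)`_i).
have [c /eigenvalueP[v vA v0]] := eigenvalue_closed A d0.
pose u := \sum_i v 0 i *: (vbasis U)`_i.
have bU i : (vbasis U)`_(i : 'I_(\dim U)) \in U.
  by apply/vbasis_mem/mem_nth; rewrite size_tuple.
exists c, u.
  apply: contra v0 => /eqP u0; apply/eqP/rowP => i; rewrite mxE.
  by have /freeP/(_ (fun i => v 0 i) u0 i) := basis_free (vbasisP U).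
split; first by rewrite rpred_sum // => i _; rewrite rpredZ.
rewrite /u linear_sum scaler_sumr.
rewrite (eq_bigr (fun i => \sum_j (v 0 i * A i j) *: (vbasis U)`_j)) => [|i _]; last first.
  rewrite linearZ /= (coord_vbasis (fU _ (bU i))) scaler_sumr; apply: eq_bigr => j _.
  by rewrite scalerA mxE.
rewrite exchange_big; apply: eq_bigr => j _ /=; rewrite -scaler_suml scalerA; congr (_ *: _).
by have /rowP/(_ j) := vA; rewrite !mxE.
Qed.

(** * Weight vectors, intertwiners and their braid relations *)

Section HeckeModule.
Variables (R : realType) (V : vectType R) (n : nat) (D : rootSystem V n).
Local Notation "<< u , v >>" := (Defs.form D u v) (at level 0, u, v at level 99).
Local Notation a_ i := (sroot D i).
Local Notation s_ i := (srefl D i).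
Local Notation om i := (fundw D i).
Local Notation P := (weight_lattice D).
Local Notation pos := (pos D).
Local Notation C := R[i].
Variables (q : C) (q_neq0 : q != 0) (q2_neq1 : q ^+ 2 != 1).
Variables (H : algType C) (T : 'I_n -> H) (X : V -> H).
Hypothesis HR : hecke_relations D q T X.
Variables (M : vectType C) (rep : H -> M -> M).
Hypothesis M_module : is_module setT rep.
Hypothesis M_cal : calibrated D X rep.
Implicit Types (s t : V -> C) (m x : M) (i j a b : 'I_n) (l : V) (u v w : 'End(V)).

Lemma repD h m x : rep h (m + x) = rep h m + rep h x.
Proof. by have := module_lin M_module (I : setT h) 1 m x; rewrite !scale1r. Qed.

Lemma rep0 h : rep h 0 = 0.
Proof. by apply: (addrI (rep h 0)); rewrite -repD !addr0. Qed.

Lemma repZ h (c : C) m : rep h (c *: m) = c *: rep h m.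
Proof. by have := module_lin M_module (I : setT h) c m 0; rewrite rep0 !addr0. Qed.

Lemma repN h m : rep h (- m) = - rep h m.
Proof. by rewrite -scaleN1r repZ scaleN1r. Qed.

Lemma rep_add h k m : rep (h + k) m = rep h m + rep k m.
Proof. by have := module_linl M_module 1 m (I : setT h) (I : setT k); rewrite !scale1r. Qed.

Lemma rep_0 m : rep 0 m = 0.
Proof. by apply: (addrI (rep 0 m)); rewrite -rep_add !addr0. Qed.

Lemma rep_scale (c : C) h m : rep (c *: h) m = c *: rep h m.
Proof. by have := module_linl M_module c m (I : setT h) (I : setT 0); rewrite rep_0 !addr0. Qed.

Lemma rep_1 m : rep 1 m = m.
Proof. exact: (module_1 M_module). Qed.

Lemma rep_mul h k m : rep (h * k) m = rep h (rep k m).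
Proof. exact: (module_M M_module). Qed.

Local Notation t_ i := (rep (T i)).
Local Notation x_ l := (rep (X l)).
Local Notation wt_space s m := (weight_space D X rep s m).
Local Notation act i s := (torus_act (srefl D i) s).

Lemma T_quad i m : t_ i (t_ i m) = (q - q^-1) *: t_ i m + m.
Proof. by rewrite -rep_mul -expr2 (hecke_quad HR) rep_add rep_scale rep_1. Qed.

Lemma X_add l k m : P l -> P k -> x_ (l + k) m = x_ l (x_ k m).
Proof. by move=> Pl Pk; rewrite -rep_mul (hecke_XD HR). Qed.

Lemma X_0 m : x_ 0 m = m.
Proof. by rewrite (hecke_X0 HR) rep_1. Qed.

(** Since [<om_j, a_i^vee>] is 0 or 1, the quotient in the commutation relation is 0 or
    [X^(om_j)]. *)
Lemma X_om_T j i m : x_ (om j) (t_ i m) =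
  t_ i (x_ (om j - (j == i)%:R *: a_ i) m) + (q - q^-1) *: ((j == i)%:R *: x_ (om j) m).
Proof.
rewrite -!rep_mul (hecke_XT HR i (weight_om D j)) rep_add rep_scale srefl_om.
congr (_ + _ *: _); rewrite /divdiff fundwP; case: eqP => ji /=.
  rewrite truncn1 (truncn_le0 (x := - _)) ?oppr_le0 // big_nat1 scale0r subr0.
  by rewrite big_geq // subr0 scale1r.
by rewrite oppr0 truncn0 !big_geq // subr0 rep_0 scale0r.
Qed.

Lemma wt_spaceZ s (c : C) m : wt_space s m -> wt_space s (c *: m).
Proof. by move=> hm l Pl; rewrite repZ hm // !scalerA mulrC. Qed.

Lemma wt_space0 s : wt_space s 0.
Proof. by move=> l _; rewrite rep0 scaler0. Qed.

Lemma wt_space_eqchar s t m : eqchar D s t -> wt_space s m -> wt_space t m.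
Proof. by move=> E h l Pl; rewrite h // E. Qed.

Lemma weight_ind (Q : V -> Prop) : Q 0 -> (forall i, Q (om i)) ->
  (forall l, P l -> Q l -> Q (- l)) ->
  (forall l k, P l -> P k -> Q l -> Q k -> Q (l + k)) -> forall l, P l -> Q l.
Proof.
move=> Q0 Qom QN QD l [c ->].
have Qn i (k : nat) : Q (k%:R *: om i) /\ P (k%:R *: om i).
  elim: k => [|k [IH Pk]]; first by rewrite scale0r; split; [|exact: weight0].
  by rewrite -natr1 scalerDl scale1r; split; [apply: QD|apply: weightD];
     rewrite //; exact: weight_om.
have Qz i (k : int) : Q (k%:~R *: om i) /\ P (k%:~R *: om i).
  split; last exact/weightZ/weight_om.
  case: k => k; first exact: (Qn i k).1.
  by rewrite NegzE rmorphN scaleNr; apply: QN; [exact: (Qn i k.+1).2|exact: (Qn i k.+1).1].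
suff [] : Q (\sum_(i < n) (c i)%:~R *: om i) /\ P (\sum_(i < n) (c i)%:~R *: om i) by [].
elim/big_ind: _ => [|x y [Qx Px] [Qy Py]|i _] //; first by split; [|exact: weight0].
by split; [exact: QD|exact: weightD].
Qed.

Lemma wt_space_om s m : torus D s -> (forall j, x_ (om j) m = s (om j) *: m) -> wt_space s m.
Proof.
move=> Ts h; apply: weight_ind => [|//|l Pl E|l k Pl Pk El Ek].
- by rewrite X_0; case: Ts => _ -> _; rewrite scale1r.
- have s0 := torus_neq0 Ts Pl; apply: (scalerI s0); rewrite (torusN Ts) //.
  rewrite scalerA mulfV // scale1r -repZ -E -X_add //; last exact: weightN.
  by rewrite addrC subrr X_0.
by rewrite X_add // Ek repZ El scalerA mulrC (torusD Ts).
Qed.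

Lemma qq_neq0 : q - q^-1 != 0.
Proof.
apply: contra q2_neq1; rewrite subr_eq0 => /eqP E.
by rewrite expr2 {2}E mulfV.
Qed.

(** If [s (a_i) = 1], then [T_i m] is a generalized weight vector, but [X^(om_i) - s (om_i)] sends
    it to [(q - q^-1) s (om_i) m], which is not 0. *)
Lemma calibrated_neq1 s i m : torus D s -> wt_space s m -> m != 0 -> s (a_ i) != 1.
Proof.
move=> Ts hm m0; apply/negP => /eqP s1.
have xT j : x_ (om j) (t_ i m) =
    s (om j) *: t_ i m + ((q - q^-1) * ((j == i)%:R * s (om j))) *: m.
  rewrite X_om_T; have Pk : P (om j - (j == i)%:R *: a_ i).
    by rewrite -srefl_om; exact/weight_srefl/weight_om.
  rewrite hm // (hm (om j)) ?repZ ?scalerA; last exact: weight_om.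
  rewrite mulrA; congr (_ *: _ + _); case: (j == i); last by rewrite scale0r subr0.
  rewrite scale1r (torusB Ts) ?s1 ?divr1 //; [exact: weight_om|exact: weight_sroot].
have xTl l : P l -> exists c, x_ l (t_ i m) = s l *: t_ i m + c *: m.
  move: l; apply: weight_ind => [|j|l Pl [c E]|l k Pl Pk [c El] [d Ek]].
  - by exists 0; rewrite X_0 scale0r addr0; case: Ts => _ -> _; rewrite scale1r.
  - by exists ((q - q^-1) * ((j == i)%:R * s (om j))).
  - have s0 := torus_neq0 Ts Pl; exists (- c * s l ^-2).
    have PN := weightN Pl; apply: (scalerI s0).
    rewrite -[LHS]repZ; have -> : s l *: t_ i m = x_ l (t_ i m) - c *: m.
      by rewrite E addrK.
    rewrite repD repN -X_add // addNr X_0 repZ (hm _ PN) (torusN Ts) //.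
    rewrite scalerDr !scalerA mulfV // scale1r; congr (_ + _).
    by rewrite -scaleNr; congr (_ *: _); field.
  exists (d * s l + s k * c); rewrite X_add // Ek repD !repZ El hm // (torusD Ts) //.
  by rewrite scalerDr !scalerA -addrA -scalerDl [s k * s l]mulrC [X in _ + X *: _]addrC.
(* Exponent 2 suffices: [X^l - s l] maps [T_i m] into the line of [m] and then kills [m]. *)
have gw : gen_weight_space D X rep s (t_ i m).
  move=> l Pl; exists 2%N; split => //=; have [c ->] := xTl l Pl.
  by rewrite addrAC subrr add0r repZ (hm _ Pl) !scalerA mulrC subrr.
have : weight_space D X rep s (t_ i m) by rewrite -M_cal.
move=> /(_ _ (weight_om D i)); rewrite xT eqxx mul1r => /eqP.
rewrite -subr_eq0 addrAC subrr add0r scaler_eq0 (negbTE m0) orbF mulf_eq0.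
by rewrite (negbTE qq_neq0) /= (negbTE (torus_neq0 Ts (weight_om D i))).
Qed.

Definition T_coef i s := (q - q^-1) / (1 - s (- a_ i)).

(** [s] is the weight on which [1 - X^(-a_i)] is inverted. Where [s (a_i) = 1] the quotient takes
    the default value 0, which is harmless: by [calibrated_neq1] the weight space is zero there. *)
Definition tau i s m := t_ i m - T_coef i s *: m.

(** The coefficient of [v_(s_i u)] in the action of [T_i]; it also factors the square of the
    intertwiner in [tau_tau]. *)
Definition tau_coef i s := q^-1 + T_coef i s.

Lemma tau0 i s : tau i s 0 = 0.
Proof. by rewrite /tau rep0 scaler0 subr0. Qed.

Lemma tauZ i s (c : C) m : tau i s (c *: m) = c *: tau i s m.
Proof. by rewrite /tau repZ scalerBr !scalerA mulrC. Qed.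

Lemma T_tau i s m : t_ i m = T_coef i s *: m + tau i s m.
Proof. by rewrite /tau addrC subrK. Qed.

Lemma sN_neq1 i s : torus D s -> s (a_ i) != 1 -> 1 - s (- a_ i) != 0.
Proof.
move=> Ts; apply: contra; rewrite subr_eq0 eq_sym (torusN Ts); last exact: weight_sroot.
by rewrite invr_eq1.
Qed.

(** Among the fundamental weights only [om i] sees the extra term of the commutation relation, and
    [T_coef] is the scalar that cancels it. *)
Lemma tau_wt_space i s m : torus D s -> s (a_ i) != 1 -> wt_space s m ->
  wt_space (act i s) (tau i s m).
Proof.
move=> Ts s1 hm; apply: wt_space_om => [|j].
  exact: torus_torus_act (weyl_srefl D i) Ts.
have y1 := sN_neq1 Ts s1.
have Pk : P (om j - (j == i)%:R *: a_ i).
  by rewrite -srefl_om; exact/weight_srefl/weight_om.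
rewrite /tau repD repN repZ X_om_T !hm //; try exact: weight_om.
rewrite repZ /torus_act sreflV srefl_om; case: eqP => [->|_].
  rewrite !scale1r (torusD Ts (weight_om D i) (weightN (weight_sroot D i))).
  rewrite scalerBr -addrA; congr (_ + _); rewrite !scalerA -scalerBl -scaleNr.
  by congr (_ *: _); rewrite /T_coef; field; rewrite y1 q_neq0.
by rewrite !scale0r subr0 scaler0 addr0 scalerBr !scalerA mulrC.
Qed.

Lemma act_sroot i s : act i s (a_ i) = s (- a_ i).
Proof. by rewrite /torus_act sreflV refl_self ?sroot_neq0. Qed.

Lemma act_srootN i s : act i s (- a_ i) = s (a_ i).
Proof. by rewrite /torus_act sreflV linearN /= refl_self ?sroot_neq0 // opprK. Qed.

Lemma tau_tau i s m : torus D s -> s (a_ i) != 1 ->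
  tau i (act i s) (tau i s m) = (tau_coef i s * tau_coef i (act i s)) *: m.
Proof.
move=> Ts s1; have y1 := sN_neq1 Ts s1; have Pa := weight_sroot D i.
have y0 := torus_neq0 Ts Pa.
rewrite /tau repD repN repZ T_quad scalerBr opprB.
rewrite /tau_coef /T_coef act_srootN (torusN Ts Pa) in y1 *.
have s1' : 1 - s (a_ i) != 0 by rewrite subr_eq0 eq_sym.
rewrite scalerA.
set y := s (a_ i) in y0 y1 s1' *.
have ys : y - 1 != 0 by rewrite -oppr_eq0 opprB.
transitivity (((q - q^-1) - (q - q^-1) / (1 - y^-1) - (q - q^-1) / (1 - y)) *: t_ i m
   + (1 + (q - q^-1) / (1 - y) * ((q - q^-1) / (1 - y^-1))) *: m).
  rewrite !scalerDl !scaleNr scale1r.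
  by rewrite [LHS](AC (4*2) ((1*2*4*6)*(3*5))).
rewrite [X in X *: t_ i m](_ : _ = 0) ?scale0r ?add0r; last by field; rewrite q_neq0 y0 s1' ys.
by congr (_ *: _); field; rewrite q_neq0 y0 s1' ys.
Qed.

Fixpoint alt_tau k a b s m : M :=
  if k is k'.+1 then tau a (torus_act (alt_refl D k' b a) s) (alt_tau k' b a s m) else m.

Lemma act_comp u v s : weyl D u -> weyl D v ->
  torus_act (u \o v)%VF s = torus_act u (torus_act v s).
Proof. exact: torus_act_comp. Qed.

Lemma tau_wt_space0 i s m : torus D s -> wt_space s m -> wt_space (act i s) (tau i s m).
Proof.
move=> Ts hm; have [->|m0] := eqVneq m 0; first by rewrite tau0; exact: wt_space0.
by apply: tau_wt_space => //; exact: calibrated_neq1 hm m0.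
Qed.

Lemma torus_alt_refl k a b s : torus D s -> torus D (torus_act (alt_refl D k a b) s).
Proof. exact/torus_torus_act/weyl_alt_refl. Qed.

Lemma alt_tau_wt_space k a b s m : torus D s -> wt_space s m ->
  wt_space (torus_act (alt_refl D k a b) s) (alt_tau k a b s m).
Proof.
move=> Ts hm; elim: k a b => [|k IH] a b /=; first by rewrite (torus_act1 D).
rewrite act_comp //; [|exact: weyl_srefl|exact: weyl_alt_refl].
by apply: tau_wt_space0; [exact: torus_alt_refl|].
Qed.

(* Somewhere along the path the root [g] becomes simple, and there the weight
   takes the value 1 on a simple root, which no calibrated weight does. *)
Lemma alt_tau_singular k a b s m (g : V) : torus D s -> wt_space s m -> g \in roots D ->
  pos g -> s g = 1 -> ~~ pos (alt_refl D k a b g) -> alt_tau k a b s m = 0.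
Proof.
move=> Ts hm gR pg sg; elim: k a b => [|k IH] a b /=; first by rewrite id_lfunE pg.
rewrite comp_lfunE => ng; have Wx := weyl_alt_refl D k b a.
have [px|nx] := boolP (pos (alt_refl D k b a g)); last by rewrite IH // tau0.
have E := srefl_neg (weyl_root Wx gR) px ng.
have hw := alt_tau_wt_space k b a Ts hm.
have [->|ne] := eqVneq (alt_tau k b a s m) 0; first by rewrite tau0.
have := calibrated_neq1 a (torus_alt_refl k b a Ts) hw ne.
by rewrite -E /torus_act (weylK _ Wx) sg eqxx.
Qed.

(** A list of labelled vectors, since different [w] may give the same weight. *)
Definition weight_comb s (L : set 'End(V)) m := exists r : seq ('End(V) * M),
  (forall p, p \in r -> L p.1 /\ wt_space (torus_act p.1 s) p.2) /\ m = \sum_(p <- r) p.2.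

Lemma weight_comb0 s L : weight_comb s L 0.
Proof. by exists [::]; rewrite big_nil. Qed.

Lemma weight_combD s L m x : weight_comb s L m -> weight_comb s L x -> weight_comb s L (m + x).
Proof.
move=> [r [hr ->]] [r' [hr' ->]]; exists (r ++ r'); rewrite big_cat; split=> // p.
by rewrite mem_cat => /orP[/hr|/hr'].
Qed.

Lemma weight_comb1 s (L : set 'End(V)) w m : L w -> wt_space (torus_act w s) m -> weight_comb s L m.
Proof.
move=> Lw hm; exists [:: (w, m)]; rewrite big_seq1; split=> // p.
by rewrite mem_seq1 => /eqP ->.
Qed.

Definition shorter k a b : set 'End(V) := [set w | exists2 k', (k' < k)%N &
  w = alt_refl D k' a b \/ w = alt_refl D k' b a].

Lemma shorterC k a b w : shorter k a b w -> shorter k b a w.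
Proof. by case=> k' kk [->|->]; exists k' => //; [right|left]. Qed.

Lemma shorterW k a b w : shorter k a b w -> shorter k.+1 a b w.
Proof. by case=> k' kk h; exists k' => //; exact: ltnW. Qed.

Lemma shorter_srefl k a b w : shorter k a b w -> shorter k.+1 a b (s_ a \o w)%VF.
Proof.
case=> k' kk [->|->]; last by exists k'.+1 => //; left.
case: k' kk => [|k'] kk; first by exists 1%N; [exact: kk|left].
by exists k'; [exact: leqW (ltnW kk)|right; rewrite /= srefl_compK].
Qed.

Lemma weight_comb_T k a b s m : torus D s -> weight_comb s (shorter k a b) m ->
  weight_comb s (shorter k.+1 a b) (t_ a m).
Proof.
move=> Ts [r [hr ->]]; elim: r hr => [|p r IH] hr.
  by rewrite big_nil rep0; exact: weight_comb0.
rewrite big_cons repD; apply: weight_combD; last first.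
  by apply: IH => p' p'r; apply: hr; rewrite inE p'r orbT.
have [Lp hp] := hr p (mem_head _ _); have Wp : weyl D p.1.
  by case: Lp => k' _ [->|->]; exact: weyl_alt_refl.
have Tp := torus_torus_act Wp Ts.
rewrite (T_tau _ (torus_act p.1 s)); apply: weight_combD.
  by apply: (weight_comb1 (w := p.1)); [exact: shorterW|exact: wt_spaceZ].
apply: (weight_comb1 (w := (s_ a \o p.1)%VF)); first exact: shorter_srefl.
by rewrite act_comp //; [exact: tau_wt_space0|exact: weyl_srefl].
Qed.

(** Expand each [T_i] into [tau_i] plus a scalar: choosing the scalar anywhere shortens the word. *)
Lemma alt_prod_at k a b s m : torus D s -> wt_space s m ->
  weight_comb s (shorter k a b) (rep (alt_prod k (T a) (T b)) m - alt_tau k a b s m).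
Proof.
move=> Ts hm; elim: k a b => [|k IH] a b.
  by rewrite /= rep_1 subrr; exact: weight_comb0.
rewrite /= rep_mul; set z := rep _ m; set y := alt_tau k b a s m.
have -> : t_ a z - tau a (torus_act (alt_refl D k b a) s) y =
    t_ a (z - y) + T_coef a (torus_act (alt_refl D k b a) s) *: y.
  by rewrite repD repN /tau opprB [RHS]addrAC addrA.
apply: weight_combD.
  apply: weight_comb_T => //; have [r [hr ->]] := IH b a; exists r; split=> // p /hr[? ?].
  by split=> //; exact: shorterC.
apply: (weight_comb1 (w := alt_refl D k b a)); first by exists k => //; right.
by apply: wt_spaceZ; exact: alt_tau_wt_space.
Qed.

Lemma inv_mul_fix (x y : 'End(V)) s : torus D s -> weyl D x -> weyl D y ->
  eqchar D (torus_act x s) (torus_act y s) ->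
  eqchar D (torus_act (x^-1 \o y)%VF s) s.
Proof.
move=> Ts Wx Wy E l Pl; rewrite act_comp //; last exact: weyl_inv.
rewrite {1}/torus_act (weyl_invK Wx) -E; last exact: weight_weyl.
by rewrite /torus_act (weylK _ Wx).
Qed.

(* The braid relation of the [T i] gives that of the intertwiners up to terms of
   weights [v s], [v] shorter than the longest dihedral element [w0]; for [s]
   regular in the plane these weights differ from [w0 s]. *)
Lemma alt_tau_braid k a b s m : a != b -> dih D k a b -> torus D s -> wt_space s m ->
  alt_tau k a b s m = alt_tau k b a s m.
Proof.
move=> ab hd Ts hm; have [na nb] := dih_neg hd; have E := dih_alt_refl hd.
have W0 := weyl_alt_refl D k a b.
have [[g [gR pg gs sg]]|reg] := pselect (exists g, [/\ g \in roots D, pos g,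
    forall i, i != a -> i != b -> <<g, om i>> = 0 & s g = 1]).
  (* The longest element inverts [g], so both alternating products vanish. *)
  have ng := neg_span2 W0 ab gs gR pg na nb.
  rewrite (alt_tau_singular Ts hm gR pg sg ng).
  by rewrite (alt_tau_singular Ts hm gR pg sg) // -E.
have [r [hr Er]] : weight_comb s (shorter k a b) (alt_tau k b a s m - alt_tau k a b s m).
  have [r1 [h1 E1]] := alt_prod_at k a b Ts hm.
  have [r2 [h2 E2]] := alt_prod_at k b a Ts hm.
  have B : alt_prod k (T a) (T b) = alt_prod k (T b) (T a).
    by apply: (hecke_braid HR) => //; exact/dih_order.
  exists (r1 ++ [seq (p.1, - p.2) | p <- r2]); split.
    move=> p; rewrite mem_cat => /orP[/h1//|/mapP[p' /h2[Lp hp] ->]].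
    by split; [exact: shorterC|rewrite -scaleN1r; exact: wt_spaceZ].
  by rewrite big_cat big_map sumrN -E1 -E2 B opprB [RHS]addrC addrA subrK.
apply/esym/eqP; rewrite -subr_eq0; apply/eqP.
apply: (@weight_sep _ _ _ P (fun l => x_ l) (torus_act (alt_refl D k a b) s) _ r
  (fun p => torus_act p.1 s) (fun p => - p.2)).
- by move=> l _ c u v; rewrite repD repZ.
- move=> l Pl; have h1 := alt_tau_wt_space k a b Ts hm; have h2 := alt_tau_wt_space k b a Ts hm.
  rewrite -E in h2; rewrite repD repN h1 // h2 //.
  by rewrite scalerBr.
- by move=> p /hr[_ hp] l Pl; rewrite repN hp // scalerN.
- move=> p /hr[[k' kk hk'] _].
  have [//|nex] := pselect (exists2 l, P l & torus_act p.1 s l != torus_act (alt_refl D k a b) s l).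
  have Wp : weyl D p.1 by case: hk' => ->; exact: weyl_alt_refl.
  have Ep : eqchar D (torus_act p.1 s) (torus_act (alt_refl D k a b) s).
    move=> l Pl; apply/eqP; apply: contrapT => ne; apply: nex; exists l => //.
    exact/negP.
  have WV := weyl_inv Wp; have Wv := weyl_comp WV W0.
  (* This element inverts only roots of the plane, where [s] is never 1, so it is admissible for
     [s]; as it fixes [s], it is 1. *)
  have E1 : (p.1^-1 \o alt_refl D k a b)%VF = \1%VF.
    apply: (admissible_stab Ts); last exact: inv_mul_fix.
    split=> // g gR pg sg; apply/negPn/negP => ng; apply: reg; exists g; split=> //.
    apply: (inv_span2 Wv) => // i x ia ib; rewrite comp_lfunE.
    by case: hk' => ->; rewrite alt_refl_inv; case: odd; rewrite !alt_refl_om.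
  have E2 : p.1 = alt_refl D k a b.
    by apply/lfunP => x; have /lfunP/(_ x) := E1; rewrite comp_lfunE id_lfunE => Ex;
      rewrite -{1}Ex (weylVK _ Wp).
  exfalso; case: hk' => E3; [apply: (dih_alt_refl_neq hd kk (x := a) (y := b))|
    apply: (dih_alt_refl_neq hd kk (x := b) (y := a))]; rewrite -?E3 //; first by left.
  by right.
by rewrite sumrN -Er subrr.
Qed.

(** * Intertwiners for all Weyl group elements *)

Fixpoint Phi_rec k s m v : M :=
  if k is k'.+1 then
    if [pick i | ~~ pos ((v^-1)%VF (a_ i))] is Some i
    then tau i (torus_act (s_ i \o v)%VF s) (Phi_rec k' s m (s_ i \o v)%VF) else m
  else m.

(* The product of intertwiners [tau] along a reduced word of [v]. *)
Definition Phi s m v := Phi_rec (weyl_len D v) s m v.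

Lemma weyl_len1 : weyl_len D \1%VF = 0%N.
Proof.
apply/eqP; rewrite size_eq0; apply/eqP; apply: size0nil; apply/eqP.
rewrite -leqn0 leqNgt -has_predT; apply/hasPn => a.
by rewrite mem_inv_roots id_lfunE andbN andbF.
Qed.

Lemma Phi1 s m : Phi s m \1%VF = m.
Proof. by rewrite /Phi weyl_len1. Qed.

Lemma Phi_pick s m v : weyl D v -> v <> \1%VF -> exists2 i, ~~ pos ((v^-1)%VF (a_ i)) &
  Phi s m v = tau i (torus_act (s_ i \o v)%VF s) (Phi s m (s_ i \o v)%VF).
Proof.
move=> Wv v1; have [i ni] : exists i, ~~ pos ((v^-1)%VF (a_ i)).
  apply: contrapT => h; apply: v1; apply: (weyl_nodesc Wv) => i.
  by apply/negPn/negP => ni; apply: h; exists i.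
rewrite /Phi (weyl_len_desc Wv ni) /=; case: pickP => [j nj|/(_ i)]; last by rewrite ni.
exists j => //; congr (tau _ _ (Phi_rec _ _ _ _)); apply: succn_inj.
by rewrite -(weyl_len_desc Wv ni) -(weyl_len_desc Wv nj).
Qed.

Lemma Phi_wt_space s m v : torus D s -> wt_space s m -> weyl D v ->
  wt_space (torus_act v s) (Phi s m v).
Proof.
move=> Ts hm; have [N] := ubnP (weyl_len D v); elim: N v => // N IH v; rewrite ltnS => vN Wv.
have [->|v1] := pselect (v = \1%VF); first by rewrite Phi1 (torus_act1 D).
have [i ni ->] := Phi_pick s m Wv v1; have Ws := weyl_spos i Wv.
rewrite -{1}(srefl_compK D i v) act_comp //; last exact: weyl_srefl.
apply: tau_wt_space0; first exact: torus_torus_act.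
by apply: IH => //; rewrite -(weyl_len_desc Wv ni).
Qed.

(** Independence of the descent chosen in [Phi_rec]. The chosen descent [j] and the given [i] split
    [v] as a longest dihedral element times [v']; by induction on length both choices are
    alternating products applied to [Phi s m v'], and these agree by the braid relation. *)
Lemma Phi_desc s m v i : torus D s -> wt_space s m -> weyl D v -> ~~ pos ((v^-1)%VF (a_ i)) ->
  Phi s m v = tau i (torus_act (s_ i \o v)%VF s) (Phi s m (s_ i \o v)%VF).
Proof.
move=> Ts hm; have [N] := ubnP (weyl_len D v); elim: N v i => // N IH v i; rewrite ltnS => vN Wv ni.
have v1 : v <> \1%VF.
  move=> E; move: ni; rewrite E; have -> : ((\1 : 'End(V))^-1)%VF = \1%VF by exact: inv_id D.
  by rewrite id_lfunE pos_sroot.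
have [j nj Ej] := Phi_pick s m Wv v1; have [<-//|ij] := eqVneq j i.
have [k hd] := dih_exists D j i.
have [v' [Wv' Ev pj pi]] := dih_min ij hd Wv nj ni.
have lenaw (l : nat) (x y : 'I_n) : (x = j /\ y = i) \/ (x = i /\ y = j) -> (l <= k)%N ->
    weyl_len D (alt_refl D l x y \o v')%VF = (l + weyl_len D v')%N.
  move=> hxy; have [xy hxd px py] : [/\ x != y, dih D k x y,
      pos ((v'^-1)%VF (a_ x)) & pos ((v'^-1)%VF (a_ y))].
    by case: hxy => -[-> ->]; split=> //; [rewrite eq_sym|exact: dih_sym].
  elim: l x y xy hxd px py {hxy} => [|l IHl] x y xy hxd px py lk; first by rewrite comp_lfun1l.
  rewrite /= -comp_lfunA weyl_len_srefl.
  - by rewrite IHl ?(ltnW lk) // 1?eq_sym //; exact: dih_sym.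
  - exact: weyl_comp (weyl_alt_refl _ _ _ _) Wv'.
  exact: dih_ascent hxd lk Wv' px py.
have lenv : weyl_len D v = (k + weyl_len D v')%N by rewrite {1}Ev lenaw //; left.
have Ts' := torus_torus_act Wv' Ts; have hm' := Phi_wt_space Ts hm Wv'.
(* Only words strictly shorter than [v] are treated, so the induction hypothesis applies. *)
have chain (l : nat) (x y : 'I_n) : (x = j /\ y = i) \/ (x = i /\ y = j) -> (l < k)%N ->
    Phi s m (alt_refl D l x y \o v')%VF = alt_tau l x y (torus_act v' s) (Phi s m v').
  move=> hxy; have [xy hxd px py] : [/\ x != y, dih D k x y,
      pos ((v'^-1)%VF (a_ x)) & pos ((v'^-1)%VF (a_ y))].
    by case: hxy => -[-> ->]; split=> //; [rewrite eq_sym|exact: dih_sym].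
  elim: l x y hxy xy hxd px py => [|l IHl] x y hxy xy hxd px py lk; first by rewrite comp_lfun1l.
  have hyx : (y = j /\ x = i) \/ (y = i /\ x = j) by case: hxy => -[-> ->]; [right|left].
  have Wx : weyl D (alt_refl D l y x \o v')%VF by exact: weyl_comp (weyl_alt_refl _ _ _ _) Wv'.
  have px' := dih_ascent xy hxd (ltnW lk) Wv' px py.
  rewrite /= -comp_lfunA (IH _ x).
  - rewrite srefl_compK IHl 1?eq_sym ?(ltnW lk) //; last exact: dih_sym.
    by rewrite act_comp //; exact: weyl_alt_refl.
  - apply: leq_trans vN; rewrite lenv weyl_len_srefl // lenaw ?(ltnW (ltnW lk)) //.
    by rewrite -addSn ltn_add2r.
  - exact: weyl_spos.
  by rewrite pos_srefl_comp // negbK.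
have step (x y : 'I_n) : (x = j /\ y = i) \/ (x = i /\ y = j) -> v = (alt_refl D k x y \o v')%VF ->
    tau x (torus_act (s_ x \o v)%VF s) (Phi s m (s_ x \o v)%VF) =
    alt_tau k x y (torus_act v' s) (Phi s m v').
  case: (k) hd chain => [[]//|k'] hd' chain' hxy ->.
  rewrite /= -comp_lfunA srefl_compK chain' //; last by case: hxy => -[-> ->]; [right|left].
  by rewrite act_comp //; exact: weyl_alt_refl.
have Ev' : v = (alt_refl D k i j \o v')%VF by rewrite Ev (dih_alt_refl hd).
rewrite Ej (step j i) //; last by left.
rewrite (step i j) //; last by right.
exact: alt_tau_braid.
Qed.

Lemma Phi_asc s m v i : torus D s -> wt_space s m -> weyl D v -> pos ((v^-1)%VF (a_ i)) ->
  Phi s m (s_ i \o v)%VF = tau i (torus_act v s) (Phi s m v).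
Proof.
move=> Ts hm Wv pi; rewrite (Phi_desc (i := i) Ts hm); last by rewrite pos_srefl_comp // negbK.
  by rewrite srefl_compK.
exact: weyl_spos.
Qed.

Lemma tau_Phi_desc s m v i : torus D s -> wt_space s m -> weyl D v ->
  ~~ pos ((v^-1)%VF (a_ i)) ->
  tau i (torus_act v s) (Phi s m v) =
  (tau_coef i (torus_act (s_ i \o v)%VF s) * tau_coef i (torus_act v s)) *: Phi s m (s_ i \o v)%VF.
Proof.
move=> Ts hm Wv ni; rewrite (Phi_desc Ts hm Wv ni); set v' := (s_ i \o v)%VF.
have Wv' : weyl D v' := weyl_spos i Wv; have Ts' := torus_torus_act Wv' Ts.
have hv' := Phi_wt_space Ts hm Wv'; have [->|ne] := eqVneq (Phi s m v') 0.
  by rewrite !tau0 scaler0.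
have -> : torus_act v s = act i (torus_act v' s).
  by rewrite -act_comp ?srefl_compK //; exact: weyl_srefl.
by rewrite tau_tau //; exact: calibrated_neq1 hv' ne.
Qed.

(** * Irreducibility: a spanning set of weight vectors *)

Hypothesis H_gen : gen_subalg (range T `|` X @` P) = setT.
Hypothesis M_irr : irreducible_module rep.

Lemma vspace_stable (U : {vspace M}) : (forall i m, m \in U -> t_ i m \in U) ->
  (forall l m, P l -> m \in U -> x_ l m \in U) -> forall h m, m \in U -> rep h m \in U.
Proof.
move=> hT hX h; have : gen_subalg (range T `|` X @` P) h by rewrite H_gen.
apply: (@smallest_sub _ _ _ (fun h => forall m, m \in U -> rep h m \in U)) => [|g].
  split=> [m|c g k hg hk m mU|g k hg hk m mU] /=; first by rewrite rep_1.
    by rewrite rep_add rep_scale rpredD ?rpredZ ?hg ?hk.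
  by rewrite rep_mul; exact/hg/hk.
by case=> [[i _ <-]|[l Pl <-]] m mU; [exact: hT|exact: hX].
Qed.

(** The span is stable: [tau_i] sends [Phi v] to [Phi (s_i v)] at an ascent and to a multiple of it
    at a descent. *)
Lemma Phi_span s m x : torus D s -> wt_space s m -> m != 0 ->
  exists c : 'End(V) -> C, x = \sum_(v <- weyl_seq D) c v *: Phi s m v.
Proof.
move=> Ts hm m0; pose U := span [seq Phi s m v | v <- weyl_seq D].
have PhiU v : weyl D v -> Phi s m v \in U.
  by move=> Wv; apply/memv_span/map_f/mem_weyl_seq.
have spanE y : y \in U -> exists c : 'End(V) -> C, y = \sum_(v <- weyl_seq D) c v *: Phi s m v.
  exact/span_mapP/fset_uniq.
have stable (f : M -> M) : (forall y z, f (y + z) = f y + f z) ->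
    (forall (c : C) y, f (c *: y) = c *: f y) ->
    (forall v, weyl D v -> f (Phi s m v) \in U) -> forall y, y \in U -> f y \in U.
  move=> fD fZ fPhi y /spanE[c ->].
  have f0 : f 0 = 0 by apply: (addrI (f 0)); rewrite -fD !addr0.
  rewrite (big_morph f fD f0) big_seq rpred_sum // => v /mem_weyl_seq Wv.
  by rewrite fZ rpredZ // fPhi.
have [] := M_irr.2 U.
- apply: vspace_stable => [i|l y Pl].
    apply: stable => [||v Wv]; [exact: repD|exact: repZ|].
    rewrite (T_tau i (torus_act v s)) rpredD ?rpredZ ?PhiU //.
    have [pi|ni] := boolP (pos ((v^-1)%VF (a_ i))).
      by rewrite -Phi_asc // PhiU //; exact: weyl_spos.
    by rewrite tau_Phi_desc // rpredZ ?PhiU //; exact: weyl_spos.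
  move: y; apply: stable => [||v Wv]; [exact: repD|exact: repZ|].
  by rewrite (Phi_wt_space Ts hm Wv) // rpredZ ?PhiU.
- move=> U0; have := PhiU _ (weyl1 D); rewrite U0 memv0 Phi1 => /eqP mz.
  by rewrite mz eqxx in m0.
by move=> UF; apply: spanE; rewrite UF memvf.
Qed.

(** * One-dimensional weight spaces and the nonvanishing of [Phi] *)

Section CentralCharacter.
Variables (t : V -> C) (Tt : torus D t).

Lemma Phi_admissible w0 m v : admissible D t w0 -> wt_space (torus_act w0 t) m ->
  weyl D v -> Phi (torus_act w0 t) m v != 0 -> admissible D t (v \o w0)%VF.
Proof.
move=> A0 hm; have [W0 _] := A0; have Ts := torus_torus_act W0 Tt.
move=> Wv; elim/weyl_ind_len: v / Wv => [_|i v Wv pi IH]; first by rewrite comp_lfun1l.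
rewrite (Phi_asc Ts hm Wv pi) => ne.
have ne' : Phi (torus_act w0 t) m v != 0.
  by apply: contra ne => /eqP ->; rewrite tau0.
rewrite -comp_lfunA; apply: (admissible_srefl Tt (IH ne')).
rewrite act_comp //; apply: calibrated_neq1 (Phi_wt_space Ts hm Wv) ne'.
exact: torus_torus_act.
Qed.

(** Expand [x] in the spanning set. The nonzero [Phi v] have admissible labels, hence distinct
    weights, so only the one of weight [u t] survives. *)
Lemma onedim w0 m u x : admissible D t w0 -> wt_space (torus_act w0 t) m -> m != 0 ->
  admissible D t u -> wt_space (torus_act u t) x ->
  exists c, x = c *: Phi (torus_act w0 t) m (u \o w0^-1)%VF.
Proof.
move=> A0 hm m0 Au hx; have [W0 _] := A0; have [Wu _] := Au.
have Ts := torus_torus_act W0 Tt; set s := torus_act w0 t in hm Ts *.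
have WV := weyl_inv W0; pose v0 := (u \o w0^-1)%VF.
have Wv0 : weyl D v0 := weyl_comp Wu WV.
have Ev0 : (v0 \o w0)%VF = u.
  by apply/lfunP => y; rewrite !comp_lfunE (weylK _ W0).
have hv0 : wt_space (torus_act u t) (Phi s m v0).
  by rewrite -Ev0 act_comp //; exact: Phi_wt_space.
have [c Ex] := Phi_span x Ts hm m0; exists (c v0); apply/eqP; rewrite -subr_eq0; apply/eqP.
pose L := [seq v <- weyl_seq D | (v != v0) && (Phi s m v != 0)].
have memL v : v \in L -> [/\ weyl D v, v != v0 & Phi s m v != 0].
  by rewrite mem_filter => /andP[/andP[? ?] /mem_weyl_seq].
apply: (@weight_sep _ _ _ P (fun l => x_ l) (torus_act u t) _ L
  (fun v => torus_act v s) (fun v => - (c v *: Phi s m v))).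
- by move=> l _ k y z; rewrite repD repZ.
- by move=> l Pl; rewrite repD repN repZ hx // hv0 // scalerBr !scalerA mulrC.
- move=> v /memL[Wv _ _] l Pl; rewrite repN repZ (Phi_wt_space Ts hm Wv) //.
  by rewrite scalerN !scalerA mulrC.
- move=> v /memL[Wv nv0 ne]; have Avw := Phi_admissible A0 hm Wv ne.
  apply: contrapT => nex; case/eqP: nv0.
  have Euv : (v \o w0)%VF = u.
    apply: (admissible_inj Tt Avw Au) => l Pl; apply/eqP; apply: contrapT => /negP h.
    by apply: nex; exists l => //; rewrite -act_comp.
  by rewrite -Ev0 in Euv; apply/lfunP => y; have /lfunP/(_ ((w0^-1)%VF y)) := Euv;
    rewrite !comp_lfunE (weylVK _ W0).
rewrite sumrN {1}Ex (bigD1_seq v0) ?fset_uniq //=; last exact/mem_weyl_seq.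
rewrite [c v0 *: _ + _]addrC addrK /L big_filter; apply/eqP; rewrite subr_eq0; apply/eqP.
rewrite [LHS]big_mkcond [RHS]big_mkcond; apply: eq_bigr => v _.
by case: (v != v0) => //=; case: eqP => // ->; rewrite scaler0.
Qed.

(* Otherwise [tau i m] generates the module, so [m] is a multiple of
   [tau i (tau i m) = 0]. *)
Lemma tau_critical u i m : admissible D t u -> wt_space (torus_act u t) m ->
  tau_coef i (torus_act u t) * tau_coef i (act i (torus_act u t)) = 0 ->
  tau i (torus_act u t) m = 0.
Proof.
move=> Au hm g0; have [Wu _] := Au; have Ts := torus_torus_act Wu Tt.
set s := torus_act u t in hm g0 Ts *; apply/eqP; apply: contraTT isT => ne.
have m0 : m != 0 by apply: contra ne => /eqP ->; rewrite tau0.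
have s1 := calibrated_neq1 i Ts hm m0.
have Asu := admissible_srefl Tt Au s1; have Ws := weyl_srefl D i.
have hm' := tau_wt_space Ts s1 hm.
have Es : act i s = torus_act (s_ i \o u)%VF t by rewrite /s act_comp.
rewrite Es in hm'; have [c Em] := onedim Asu hm' ne Au hm.
have Ev : (u \o (s_ i \o u)^-1)%VF = s_ i.
  apply/lfunP => y; rewrite comp_lfunE srefl_compV //.
  by rewrite (weylVK _ Wu).
have Tsu : torus D (torus_act (s_ i \o u)%VF t) by rewrite -Es; exact: torus_torus_act.
(* The intertwiner back along [s_i] gives the square of [tau_i] on [m], which is 0 by [g0]. *)
have E0 : Phi (torus_act (s_ i \o u)%VF t) (tau i s m) (s_ i) = 0.
  have := @Phi_asc _ (tau i s m) \1%VF i Tsu hm' (weyl1 D).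
  rewrite comp_lfun1r (inv_id D) id_lfunE pos_sroot => /(_ isT) ->.
  by rewrite Phi1 (torus_act1 D) -Es tau_tau // g0 scale0r.
by move: ne; rewrite Em Ev E0 scaler0 tau0 eqxx.
Qed.

(** The value condition of [Pset] without positivity of the root; being stable under inversion, it
    suits roots of either sign. *)
Definition critical (z : C) := z = q ^+ 2 \/ z = q ^- 2.

Lemma criticalV z : critical z -> critical z^-1.
Proof. by case=> ->; [right|left; rewrite invrK]. Qed.

Lemma critical_root s (a : V) : torus D s -> a \in roots D ->
  critical (s (- a)) <-> critical (s a).
Proof.
move=> Ts aR; have Pa := weight_root aR; rewrite (torusN Ts) //; split=> /criticalV //.
by rewrite invrK.
Qed.

Lemma tau_coef_eq0 i s : torus D s -> s (a_ i) != 1 -> tau_coef i s = 0 <-> s (- a_ i) = q ^+ 2.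
Proof.
move=> Ts s1; have y1 := sN_neq1 Ts s1.
have -> : tau_coef i s = q^-1 * (q ^+ 2 - s (- a_ i)) / (1 - s (- a_ i)).
  by rewrite /tau_coef /T_coef; field; rewrite y1 q_neq0.
split=> [/eqP|->]; last by rewrite subrr mulr0 mul0r.
by rewrite !mulf_eq0 !invr_eq0 (negbTE q_neq0) (negbTE y1) orbF subr_eq0 eq_sym => /eqP.
Qed.

Lemma tau_coef_critical i s : torus D s -> s (a_ i) != 1 ->
  tau_coef i s * tau_coef i (act i s) = 0 <-> critical (s (a_ i)).
Proof.
move=> Ts s1; have Ta := torus_torus_act (weyl_srefl D i) Ts.
have Pa := weight_sroot D i.
have a1 : act i s (a_ i) != 1 by rewrite act_sroot (torusN Ts) // invr_eq1.
have h1 := tau_coef_eq0 Ts s1; have h2 := tau_coef_eq0 Ta a1.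
rewrite act_srootN in h2; rewrite (torusN Ts) // in h1.
split=> [/eqP|[E|E]].
- rewrite mulf_eq0 => /orP[/eqP/h1 E|/eqP/h2 E]; [right|by left].
  by rewrite -E invrK.
- by rewrite (h2.2 E) mulr0.
by rewrite h1.2 ?mul0r // E invrK.
Qed.

(* [u] and [w0] invert the same roots of [P(t)]. *)
Definition same_critical w0 u := forall a : V, a \in roots D -> critical (t a) ->
  pos (u a) = pos (w0 a).

Lemma pos_srefl_root i (b : V) : b \in roots D -> b <> a_ i -> b <> - a_ i ->
  pos (s_ i b) = pos b.
Proof.
move=> bR b1 b2; have [pb|nb] := boolP (pos b); first by rewrite pos_srefl //; exact/eqP.
apply/negbTE; rewrite -pos_opp ?weyl_root //; last exact: weyl_srefl.
rewrite -linearN pos_srefl ?root_opp ?pos_opp //.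
by apply/eqP => E; apply: b2; rewrite -E opprK.
Qed.

Lemma same_critical_srefl w0 u i : weyl D u -> ~ critical (torus_act u t (a_ i)) ->
  same_critical w0 u -> same_critical w0 (s_ i \o u)%VF.
Proof.
move=> Wu nc h a aR ca; rewrite -h // comp_lfunE; apply: pos_srefl_root.
- by rewrite weyl_root.
- by move=> E; apply: nc; rewrite -E /torus_act (weylK _ Wu).
move=> E; apply: nc; have aE : a_ i = u (- a) by rewrite linearN /= E opprK.
by rewrite aE /torus_act (weylK _ Wu) critical_root.
Qed.

Definition in_region w0 u := admissible D t u /\ same_critical w0 u.

(** Along a reduced word both sides change together: [tau_i] vanishes exactly at a critical value of
    the next root, and otherwise its square is a nonzero scalar. *)
Lemma Phi_in_region w0 m v : admissible D t w0 -> wt_space (torus_act w0 t) m -> m != 0 ->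
  weyl D v -> Phi (torus_act w0 t) m v != 0 <-> in_region w0 (v \o w0)%VF.
Proof.
move=> A0 hm m0; have [W0 _] := A0; have Ts := torus_torus_act W0 Tt.
move=> Wv; elim/weyl_ind_len: v / Wv => [|i v Wv pi IH].
  by rewrite Phi1 comp_lfun1l; split.
have Ws := weyl_srefl D i; have Wvw := weyl_comp Wv W0; have Tv := torus_torus_act Wvw Tt.
rewrite (Phi_asc Ts hm Wv pi) -comp_lfunA; split=> [ne|[Au cu]].
  have ne' : Phi (torus_act w0 t) m v != 0.
    by apply: contra ne => /eqP ->; rewrite tau0.
  have [Av cv] := IH.1 ne'; have hv := Phi_wt_space Ts hm Wv; rewrite -act_comp // in hv ne.
  have s1 := calibrated_neq1 i Tv hv ne'.
  split; first exact: admissible_srefl.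
  apply: same_critical_srefl => // /(tau_coef_critical Tv s1) g0; case/eqP: ne.
  exact: tau_critical.
(* On [b] the signs under [w0] and under [s_i v w0] differ, so [t b] is neither 1 nor critical;
   hence [v w0] lies in the region too and [tau_i] is injective there. *)
pose b := ((v \o w0)^-1)%VF (a_ i).
have bR : b \in roots D by exact: weylV_sroot.
have Eb : (s_ i \o (v \o w0))%VF b = - a_ i.
  by rewrite comp_lfunE (weylVK _ Wvw) refl_self ?sroot_neq0.
have nb : ~~ pos ((s_ i \o (v \o w0))%VF b).
  by rewrite Eb pos_opp ?sroot_root // pos_sroot.
have pb : pos (w0 b).
  by rewrite /b (weyl_compV Wv W0) comp_lfunE (weylVK _ W0).
have b1 : t b != 1.
  apply/eqP => tb; move: nb; rewrite (admissible_root Tt Au bR tb).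
  by rewrite -(admissible_root Tt A0 bR tb) pb.
have nc : ~ critical (t b) by move=> cb; move: nb; rewrite cu // pb.
have Wsv := weyl_spos i Wvw; have Tsv := torus_torus_act Wsv Tt.
have Ev : (s_ i \o (s_ i \o (v \o w0)))%VF = (v \o w0)%VF by exact: srefl_compK.
have Esu : torus_act (s_ i \o (v \o w0))%VF t (a_ i) = t (- b).
  by rewrite /torus_act srefl_compV_sroot.
have gv : in_region w0 (v \o w0)%VF.
  rewrite -Ev; split.
    by apply: admissible_srefl => //; rewrite Esu (torusN Tt) ?invr_eq1 //; exact: weight_root.
  by apply: same_critical_srefl => //; rewrite Esu critical_root.
have ne := IH.2 gv; have hv := Phi_wt_space Ts hm Wv; rewrite -act_comp // in hv *.
have s1 : torus_act (v \o w0)%VF t (a_ i) != 1 by [].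
apply/eqP => E; have := tau_tau (i := i) (Phi (torus_act w0 t) m v) Tv s1.
rewrite E tau0 => /esym/eqP; rewrite scaler_eq0 (negbTE ne) orbF => /eqP.
by move/(tau_coef_critical Tv s1).
Qed.

(** Along a reduced word the factors are indexed by the roots of [R(v)]; as a product over that set
    it depends on no word. *)
Definition tau_coef_prod s v : C := \prod_(b <- inv_roots D v) (q^-1 + (q - q^-1) / (1 - s (- b))).

Lemma tau_coef_prod_asc s v i : weyl D v -> pos ((v^-1)%VF (a_ i)) ->
  tau_coef_prod s (s_ i \o v)%VF = tau_coef i (torus_act v s) * tau_coef_prod s v.
Proof.
move=> Wv pi; rewrite /tau_coef_prod (perm_big _ (inv_roots_srefl Wv pi)) big_cons; congr (_ * _).
by rewrite /tau_coef /T_coef /torus_act linearN.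
Qed.

(** * The normalized basis and the isomorphism *)

Section Basis.
Variables (w0 : 'End(V)) (m : M).
Hypotheses (A0 : admissible D t w0) (hm : wt_space (torus_act w0 t) m) (m0 : m != 0).
Let W0 : weyl D w0 := A0.1.
Let s := torus_act w0 t.
Let Ts : torus D s := torus_torus_act W0 Tt.

(** A zero scalar makes the square of [tau_i] zero, and then [tau_critical] makes [tau_i] itself
    vanish. *)
Lemma tau_coef_neq0 v i : weyl D v -> tau i (torus_act v s) (Phi s m v) != 0 ->
  tau_coef i (torus_act v s) != 0.
Proof.
move=> Wv ne; have ne' : Phi s m v != 0 by apply: contra ne => /eqP ->; rewrite tau0.
have Av := Phi_admissible A0 hm Wv ne'; have := Phi_wt_space Ts hm Wv.
rewrite /s -act_comp // in ne * => hv; apply: contra ne => /eqP g0; apply/eqP.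
by apply: tau_critical => //; rewrite g0 mul0r.
Qed.

Lemma tau_coef_prod_neq0 v : weyl D v -> Phi s m v != 0 -> tau_coef_prod s v != 0.
Proof.
move=> Wv; elim/weyl_ind_len: v / Wv => [_|i v Wv pi IH].
  by rewrite /tau_coef_prod (size0nil (weyl_len1)) big_nil oner_eq0.
rewrite (Phi_asc Ts hm Wv pi) tau_coef_prod_asc // => ne; rewrite mulf_neq0 ?tau_coef_neq0 // IH //.
by apply: contra ne => /eqP ->; rewrite tau0.
Qed.

Definition nPhi v := (tau_coef_prod s v)^-1 *: Phi s m v.

Lemma nPhi_wt_space v : weyl D v -> wt_space (torus_act v s) (nPhi v).
Proof. by move=> Wv; apply: wt_spaceZ; exact: Phi_wt_space. Qed.

Lemma nPhi_neq0 v : weyl D v -> Phi s m v != 0 -> nPhi v != 0.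
Proof. by move=> Wv ne; rewrite scaler_eq0 negb_or ne invr_eq0 tau_coef_prod_neq0. Qed.

(** The normalization makes ascents and descents alike: an ascent introduces one new factor, and at
    a descent one of the two scalars of the square cancels against it. *)
Lemma tau_nPhi v i : weyl D v -> Phi s m v != 0 ->
  tau i (torus_act v s) (nPhi v) = tau_coef i (torus_act v s) *: nPhi (s_ i \o v)%VF.
Proof.
move=> Wv ne; have gv := tau_coef_prod_neq0 Wv ne; rewrite /nPhi tauZ.
have [pi|ni] := boolP (pos ((v^-1)%VF (a_ i))).
  rewrite (Phi_asc Ts hm Wv pi) tau_coef_prod_asc //.
  have [->|ne'] := eqVneq (tau i (torus_act v s) (Phi s m v)) 0; first by rewrite !scaler0.
  by rewrite scalerA invfM mulrA mulfV ?mul1r // tau_coef_neq0.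
rewrite (tau_Phi_desc Ts hm Wv ni) !scalerA; set v' := (s_ i \o v)%VF.
have Wv' : weyl D v' := weyl_spos i Wv.
have Ev : tau_coef_prod s v = tau_coef i (torus_act v' s) * tau_coef_prod s v'.
  by rewrite -tau_coef_prod_asc ?srefl_compK // pos_srefl_comp.
rewrite Ev in gv *; congr (_ *: _); move: gv; rewrite mulf_eq0 negb_or => /andP[g1 g2].
by field; rewrite g1 g2.
Qed.

Definition Jset : set V := inv_set D w0 `&` Pset D q t.

Lemma inv_set_not (u : 'End(V)) (b : V) : weyl D u -> pos_root D b ->
  inv_set D u b <-> ~~ pos (u b).
Proof.
move=> Wu /[dup] hb /pos_rootP[bR pb].
by split=> [/(inv_setP _ Wu)[]|nb] //; apply/(inv_setP _ Wu).
Qed.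

(** The region is defined by positive roots and [same_critical] by all roots; negating a root keeps
    it critical and reverses both signs. *)
Lemma Fset_in_region u : Fset D q t Jset u <-> in_region w0 u.
Proof.
split=> [[Wu Zu Pu]|[[Wu Au] cu]].
  split; first exact/admissibleP.
  have key (b : V) : b \in roots D -> pos b -> critical (t b) -> pos (u b) = pos (w0 b).
    move=> bR pb cb; have hb : pos_root D b by apply/pos_rootP.
    have Pb : Pset D q t b by split.
    apply: negb_inj; apply/idP/idP => nb.
      have : (inv_set D u `&` Pset D q t) b by split=> //; apply/inv_set_not.
      by rewrite Pu => -[/(inv_set_not W0 hb)].
    have : Jset b by split=> //; apply/inv_set_not.
    by rewrite -Pu => -[/(inv_set_not Wu hb)].
  move=> b bR cb; have [pb|nb] := boolP (pos b); first exact: key.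
  have := key (- b); rewrite root_opp // pos_opp // !linearN !pos_opp ?weyl_root //.
  by move=> /(_ isT nb)/= h; apply: negb_inj; apply: h; exact/critical_root.
split=> //; first exact/admissibleP.
apply/seteqP; split=> b [hb [hp cb]]; have [bR pb] := (pos_rootP D b).1 hp.
  split=> //; apply/inv_set_not => //; rewrite -cu //; exact/(inv_set_not Wu hp).
by split=> //; apply/inv_set_not => //; rewrite cu //; exact/(inv_set_not W0 hp).
Qed.

Local Notation F := (fset_set (Fset D q t Jset)).

Lemma mem_F u : u \in F <-> in_region w0 u.
Proof.
have fin : finite_set (Fset D q t Jset).
  by apply: sub_finite_set (weyl_finite D) => w [].
rewrite -Fset_in_region; have := @in_fset_set _ _ fin u.
by rewrite /= => ->; split => [/set_mem|/mem_set].
Qed.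

Lemma weyl_F (x : F) : weyl D (fsval x).
Proof. by have [[]] := (mem_F _).1 (fsvalP x). Qed.

Lemma compVK u : weyl D u -> ((u \o w0^-1) \o w0)%VF = u.
Proof. by move=> _; apply/lfunP => y; rewrite !comp_lfunE (weylK _ W0). Qed.

Lemma weyl_compV0 u : weyl D u -> weyl D (u \o w0^-1)%VF.
Proof. by move=> Wu; apply: weyl_comp => //; exact: weyl_inv. Qed.

Lemma Phi_F u : weyl D u -> Phi s m (u \o w0^-1)%VF != 0 <-> u \in F.
Proof.
move=> Wu; have := Phi_in_region A0 hm m0 (weyl_compV0 Wu); rewrite compVK // => ->.
by split=> /mem_F.
Qed.

Lemma nPhi_act u : weyl D u -> wt_space (torus_act u t) (nPhi (u \o w0^-1)%VF).
Proof.
move=> Wu; have := nPhi_wt_space (weyl_compV0 Wu); rewrite /s -act_comp ?compVK //.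
exact: weyl_compV0.
Qed.

Definition tJ_map (f : tJ_space D q t Jset) : M :=
  \sum_(x : F) (f x : C) *: nPhi (fsval x \o w0^-1)%VF.

Lemma tJ_map_linear : linear tJ_map.
Proof.
move=> c f g; rewrite /tJ_map scaler_sumr -big_split; apply: eq_bigr => x _ /=.
have -> : (c *: f + g) x = c * f x + g x.
  pose f' : {ffun F -> C^o} := f; pose g' : {ffun F -> C^o} := g.
  by rewrite -[LHS]/((c *: f' + g') x) !ffunE.
by rewrite scalerDl; congr (_ + _); exact/esym/scalerA.
Qed.

(** This includes [u] outside the region, where both sides are 0; thus the convention for
    [v_(s_i u)] comes out by itself. *)
Lemma tJ_map_vec u : weyl D u -> tJ_map (tJ_vec D q t Jset u) = nPhi (u \o w0^-1)%VF.
Proof.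
move=> Wu; have [uF|uF] := boolP (u \in F).
  rewrite /tJ_map (bigD1 [` uF]%fset) //= ffunE eqxx scale1r big1 ?addr0 // => x xu.
  rewrite ffunE; case: eqP => [E|_]; last by rewrite scale0r.
  by case/eqP: xu; apply/val_inj.
rewrite /tJ_map big1 => [|x _].
  apply/esym; rewrite /nPhi; have [->|/(Phi_F Wu)] := eqVneq (Phi s m (u \o w0^-1)%VF) 0.
    by rewrite scaler0.
  by rewrite (negbTE uF).
rewrite ffunE; case: eqP => [E|_]; last by rewrite scale0r.
by move: uF; rewrite -E fsvalP.
Qed.

(** The basis vectors are nonzero and, by [admissible_inj], have distinct weights. *)
Lemma tJ_map_inj f : tJ_map f = 0 -> f = 0.
Proof.
move=> f0; apply/ffunP => x; rewrite ffunE.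
have Wx := weyl_F x; have Ax : admissible D t (fsval x) by have [] := (mem_F _).1 (fsvalP x).
suff /eqP : f x *: nPhi (fsval x \o w0^-1)%VF = 0.
  rewrite scaler_eq0 (negbTE (nPhi_neq0 (weyl_compV0 Wx) _)); first by rewrite orbF => /eqP.
  exact/(Phi_F Wx)/fsvalP.
apply: (@weight_sep _ _ _ P (fun l => x_ l) (torus_act (fsval x) t) _
  [seq y <- index_enum F | y != x] (fun y => torus_act (fsval y) t)
  (fun y => f y *: nPhi (fsval y \o w0^-1)%VF)).
- by move=> l _ c y z; rewrite repD repZ.
- exact/wt_spaceZ/nPhi_act.
- by move=> y _; exact/wt_spaceZ/nPhi_act/weyl_F.
- move=> y; rewrite mem_filter => /andP[yx _].
  have Ay : admissible D t (fsval y) by have [] := (mem_F _).1 (fsvalP y).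
  apply: contrapT => nex; case/eqP: yx; apply/val_inj.
  apply: (admissible_inj Tt Ay Ax) => l Pl; apply/eqP; apply: contrapT => /negP h.
  by apply: nex; exists l.
by rewrite big_filter; apply: etrans f0; rewrite /tJ_map [RHS](bigD1 x).
Qed.

Definition tJ_lfun : 'Hom(tJ_space D q t Jset, M) :=
  linfun (HB.pack_for {linear tJ_space D q t Jset -> M} tJ_map
    (GRing.isLinear.Build C _ _ *:%R tJ_map tJ_map_linear)).

Lemma tJ_lfunE f : tJ_lfun f = tJ_map f.
Proof. by rewrite lfunE. Qed.

Lemma tJ_lker0 : lker tJ_lfun == 0%VS.
Proof.
apply/eqP/vspaceP => f; rewrite memv_ker memv0 tJ_lfunE.
by apply/eqP/eqP => [/tJ_map_inj|->] //; rewrite -tJ_lfunE linear0.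
Qed.

Lemma tJ_limg : limg tJ_lfun = fullv.
Proof.
apply/vspaceP => y; rewrite memvf; have [c ->] := Phi_span y Ts hm m0.
rewrite big_seq rpred_sum // => v /mem_weyl_seq Wv; apply: rpredZ.
have [->|ne] := eqVneq (Phi s m v) 0; first exact: rpred0.
have Ev : ((v \o w0) \o w0^-1)%VF = v.
  by apply/lfunP => z; rewrite !comp_lfunE (weylVK _ W0).
have -> : Phi s m v = tau_coef_prod s v *: tJ_lfun (tJ_vec D q t Jset (v \o w0)%VF).
  rewrite tJ_lfunE tJ_map_vec ?Ev; last exact: weyl_comp.
  by rewrite scalerA mulfV ?scale1r // tau_coef_prod_neq0.
by apply/rpredZ/memv_img/memvf.
Qed.

Lemma tJ_lfunK : cancel tJ_lfun (tJ_lfun^-1)%VF.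
Proof. by move=> f; rewrite lker0_lfunK // tJ_lker0. Qed.

Lemma tJ_lfunVK : cancel (tJ_lfun^-1)%VF tJ_lfun.
Proof. by move=> y; rewrite limg_lfunVK // tJ_limg memvf. Qed.

(** The action of [M] carried through the bijection, so that the module axioms are inherited. *)
Definition tJ_rep (h : H) (f : tJ_space D q t Jset) : tJ_space D q t Jset :=
  (tJ_lfun^-1)%VF (rep h (tJ_lfun f)).

Lemma tJ_repM : is_tJ_module T X tJ_rep.
Proof.
split.
- split=> [h _ c f g|c h k f _ _|f|h k f _ _]; rewrite /tJ_rep.
  + by rewrite linearP repD repZ linearP.
  + by rewrite rep_add rep_scale linearP.
  + by rewrite rep_1 tJ_lfunK.
  by rewrite tJ_lfunVK rep_mul.
- move=> u l [Wu _ _] Pl; rewrite /tJ_rep tJ_lfunE tJ_map_vec // (nPhi_act Wu Pl).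
  by rewrite linearZ /= -tJ_map_vec // -tJ_lfunE tJ_lfunK.
move=> u i Fu; have Wu : weyl D u by case: Fu.
have Wsu := weyl_spos i Wu; have Wx := weyl_compV0 Wu.
rewrite /tJ_rep tJ_lfunE tJ_map_vec //.
have Eu : torus_act (u \o w0^-1)%VF s = torus_act u t by rewrite /s -act_comp // compVK.
have ne : Phi s m (u \o w0^-1)%VF != 0 by apply/(Phi_F Wu)/mem_F/Fset_in_region.
rewrite (T_tau i (torus_act u t)) -[X in tau i X _]Eu tau_nPhi // Eu.
rewrite comp_lfunA -!tJ_map_vec // -!tJ_lfunE -!linearZ -linearD /= tJ_lfunK.
by [].
Qed.

Lemma tJ_rep_iso : module_iso rep tJ_rep.
Proof.
exists (fun_of_lfun (tJ_lfun^-1)%VF : {linear _ -> _}); split.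
  by exists tJ_lfun; [exact: tJ_lfunVK|exact: tJ_lfunK].
by move=> h x; rewrite /tJ_rep tJ_lfunVK.
Qed.

(** [M] itself, restricted to the rank two subalgebra, is the required calibrated module. *)
Lemma in_region_calibratable u : in_region w0 u -> calibratable D T X (torus_act u t).
Proof.
move=> gu; have [[Wu _] _] := gu; split; first exact: torus_torus_act.
move=> i j ij; exists M, rep; split=> //.
- split=> [h _|c h k x _ _|x|h k x _ _].
  + exact: (module_lin M_module).
  + exact: (module_linl M_module).
  + exact: rep_1.
  exact: rep_mul.
split; first exact: torus_torus_act.
rewrite M_cal; last exact: torus_torus_act.
move=> E; have : weight_space D X rep (torus_act u t) (nPhi (u \o w0^-1)%VF).
  exact: nPhi_act.
rewrite E /=; apply/eqP/nPhi_neq0; first exact: weyl_compV0.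
by apply/(Phi_F Wu)/mem_F.
Qed.

Lemma in_region_self : in_region w0 w0.
Proof. by split. Qed.

End Basis.

End CentralCharacter.

(** * Existence of a weight in the orbit of the central character *)

Lemma X_comm l k m : P l -> P k -> x_ l (x_ k m) = x_ k (x_ l m).
Proof. by move=> Pl Pk; rewrite -!X_add // addrC. Qed.

Lemma rep_linear h : linear (rep h).
Proof. by move=> c x y; rewrite repD repZ. Qed.

(** On a nonzero [X]-stable subspace of least dimension every [X^l] is a scalar, because its
    eigenspaces are again stable. *)
Lemma weight_exists : exists s m, [/\ torus D s, m != 0 & wt_space s m].
Proof.
pose stable (U : {vspace M}) := forall l m, P l -> m \in U -> x_ l m \in U.
pose Q k := `[< exists U : {vspace M}, [/\ \dim U = k, U != 0%VS & stable U] >].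
have exQ : exists k, Q k.
  exists (\dim {:M}); apply/asboolP; exists fullv; split=> //; last by move=> *; exact: memvf.
  have [[m m0] _] := M_irr; apply: contra m0 => /eqP E.
  by rewrite -memv0 -E memvf.
have [k /asboolP[U [dU U0 stU]] kmin] := ex_minnP exQ.
have scal l : P l -> exists c : C, forall y, y \in U -> x_ l y = c *: y.
  move=> Pl; pose f : {linear M -> M} := HB.pack_for {linear M -> M} (x_ l)
    (GRing.isLinear.Build C M M *:%R (x_ l) (rep_linear (X l))).
  have [c [u u0 [uU fu]]] := eigen_in (f := f) U0 (fun m => stU l m Pl).
  pose g := (linfun f - c *: \1)%VF; pose U' := (U :&: lker g)%VS.
  have mem_g y : (y \in lker g) = (x_ l y == c *: y).
    by rewrite memv_ker add_lfunE opp_lfunE scale_lfunE lfunE id_lfunE subr_eq0.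
  have U'0 : U' != 0%VS.
    apply/eqP => E; have : u \in U' by rewrite memv_cap uU mem_g; apply/eqP.
    by rewrite E memv0 (negbTE u0).
  have dU' : (k <= \dim U')%N.
    apply: kmin; apply/asboolP; exists U'; split=> // l' y Pl'.
    rewrite !memv_cap !mem_g => /andP[yU /eqP yg]; rewrite stU //=.
    by rewrite X_comm // yg repZ.
  have E : U' = U by apply/eqP; rewrite eqEdim capvSl dU.
  by exists c => y; rewrite -E memv_cap mem_g => /andP[_ /eqP].
pose m := vpick U; have m0 : m != 0 by rewrite vpick0.
have /(@choice _ _) [s hs] : forall l, exists c : C, P l -> x_ l m = c *: m.
  move=> l; have [Pl|nPl] := pselect (P l); last by exists 0.
  by have [c hc] := scal l Pl; exists c => _; apply: hc; exact: memv_pick.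
have inj c d : c *: m = d *: m -> c = d.
  by move/eqP; rewrite -subr_eq0 -scalerBl scaler_eq0 (negbTE m0) orbF subr_eq0 => /eqP.
have sM l l' : P l -> P l' -> s (l + l') = s l * s l'.
  move=> Pl Pl'; apply: inj; rewrite -hs ?X_add //; last exact: weightD.
  by rewrite hs // repZ hs // scalerA mulrC.
have s0 : s 0 = 1 by apply: inj; rewrite -hs ?X_0 ?scale1r //; exact: weight0.
exists s, m; split=> //; split=> // l Pl; apply/eqP => sl.
have := sM _ _ Pl (weightN Pl); rewrite subrr s0 sl mul0r => /eqP.
by rewrite oner_eq0.
Qed.

Lemma orbit_sum_key : unit. Proof. exact: tt. Qed.

(** The sum of [X^(w l)] over all [w], with multiplicities, so that its evaluations are plain sums
    over the group. *)
Definition orbit_sum l : {fsfun V -> C with 0} :=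
  [fsfun[orbit_sum_key] k in seq_fset orbit_sum_key [seq (w : 'End(V)) l | w <- weyl_seq D] =>
    \sum_(w <- weyl_seq D) (w l == k)%:R].

Lemma orbit_sumE l k : orbit_sum l k = \sum_(w <- weyl_seq D) (w l == k)%:R.
Proof.
rewrite fsfunE; case: ifP => // /negbT nk; rewrite big_seq big1 // => w wW.
by case: eqP => // E; case/negP: nk; rewrite seq_fsetE; apply/mapP; exists w.
Qed.

Lemma eval_orbit_sum (A : lmodType C) (x : V -> A) l :
  eval_X x (orbit_sum l) = \sum_(w <- weyl_seq D) x (w l).
Proof.
rewrite /eval_X.
rewrite (@big_fset_incl _ _ _ _ (finsupp (orbit_sum l))
  (seq_fset orbit_sum_key [seq (w : 'End(V)) l | w <- weyl_seq D])); first last.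
- by move=> k _; rewrite mem_finsupp negbK => /eqP ->; rewrite scale0r.
- apply/fsubsetP => k; rewrite mem_finsupp fsfunE; case: ifP => //.
  by rewrite eqxx.
rewrite (eq_bigr (fun k => \sum_(w <- weyl_seq D) (w l == k)%:R *: x k)) => [|k _]; last first.
  by rewrite orbit_sumE scaler_suml.
rewrite exchange_big; apply: eq_big_seq => w wW /=.
rewrite (bigD1_seq (w l)) ?fset_uniq //=; last by rewrite seq_fsetE; apply/mapP; exists w.
rewrite eqxx scale1r big1 ?addr0 // => k; rewrite eq_sym => /negbTE ->.
by rewrite scale0r.
Qed.

Lemma orbit_sum_group l : P l -> group_alg D (orbit_sum l).
Proof.
move=> Pl k; rewrite mem_finsupp fsfunE seq_fsetE.
case: ifP => [/mapP[w /mem_weyl_seq Ww ->] _|].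
  exact: weight_weyl.
by rewrite eqxx.
Qed.

Lemma orbit_sum_inv l : weyl_invariant D (orbit_sum l).
Proof.
move=> w k Ww; rewrite !orbit_sumE -(sum_weyl_comp _ Ww); apply: eq_bigr => v _.
by rewrite comp_lfunE (inj_eq (weyl_inj Ww)).
Qed.

Lemma central_orbit s t m l : central_character D X rep t -> torus D s -> m != 0 -> wt_space s m ->
  P l -> \sum_(w <- weyl_seq D) t (w l) = \sum_(w <- weyl_seq D) s (w l).
Proof.
move=> [Tt cen] Ts m0 hm Pl.
have := cen _ (orbit_sum_group Pl) (@orbit_sum_inv l) m.
rewrite !eval_orbit_sum (big_morph (fun h => rep h m) (fun h k => rep_add h k m) (rep_0 m)).
rewrite (eq_big_seq (fun w : 'End(V) => s (w l) *: m)) => [|w /mem_weyl_seq Ww]; last first.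
  by rewrite hm //; exact: weight_weyl.
rewrite -scaler_suml => /eqP; rewrite -subr_eq0 -scalerBl scaler_eq0 (negbTE m0) orbF.
by rewrite subr_eq0 => /eqP ->.
Qed.

(* Linear independence of characters: the symmetrizations of [s] and [t] agree,
   so [s] occurs among the [t \o w]. *)
Lemma central_conj s t : torus D s -> torus D t ->
  (forall l, P l -> \sum_(w <- weyl_seq D) t (w l) = \sum_(w <- weyl_seq D) s (w l)) ->
  exists2 w, weyl D w & eqchar D (torus_act w t) s.
Proof.
move=> Ts Tt E; apply: contrapT => nex.
(* Extended by 0 outside [P], a character becomes an eigenvector of the translations [A l], so
   [weight_sep] applies. *)
pose e (chi : V -> C) : V -> C^o := fun l => if `[< P l >] then chi l else 0.
pose A (l : V) (f : V -> C^o) : V -> C^o := fun k => f (k + l).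
have PD k l : P l -> `[< P (k + l) >] = `[< P k >].
  move=> Pl; apply/asboolP/asboolP => h; last exact: weightD.
  by rewrite -(addrK l k); apply: weightD => //; exact: weightN.
have Ae chi l : torus D chi -> P l -> A l (e chi) = chi l *: (e chi).
  move=> Tc Pl; apply/funext => k.
  rewrite -[RHS]/(chi l * (if `[< P k >] then chi k else 0)) /A /e PD //.
  by case: asboolP => Pk; rewrite ?mulr0 // (torusD Tc) // mulrC.
have Tw chi w : torus D chi -> weyl D w -> torus D (fun l => chi (w l)).
  move=> Tc Ww; have [c0 c1 cM] := Tc; split=> [l Pl||l k Pl Pk].
  - by apply: c0; exact: weight_weyl.
  - by rewrite linear0.
  by rewrite linearD cM //; exact: weight_weyl.
pose fix_s w := `[< eqchar D (fun l => s (w l)) s >].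
(* The [k] terms [s w] equal to [s] are collected into [k s]. The other [s w], with sign +1, and all
   [t w], with sign -1, make up [L]; if no [t w] were [s], then [k s = 0], although [k] is at least
   1. *)
pose k := count fix_s (weyl_seq D).
pose L : seq (bool * 'End(V)) := [seq (true, w) | w <- weyl_seq D] ++
   [seq (false, w) | w <- weyl_seq D & ~~ fix_s w].
pose chi (p : bool * 'End(V)) : V -> C := fun l => if p.1 then t (p.2 l) else s (p.2 l).
have TL p : p \in L -> weyl D p.2 /\ torus D (chi p).
  rewrite mem_cat => /orP[/mapP[w /mem_weyl_seq Ww ->]|/mapP[w]]; first by split => //; exact: Tw.
  by rewrite mem_filter => /andP[_ /mem_weyl_seq Ww] ->; split => //; exact: Tw.
have sumE : \sum_(w <- weyl_seq D) e (fun l => t (w l)) =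
    \sum_(w <- weyl_seq D) e (fun l => s (w l)).
  apply/funext => l; rewrite !fct_sumE /e; case: asboolP => Pl; last by rewrite !big1.
  exact: E.
have y0 : (k%:R : C) *: e s = 0.
  apply: (@weight_sep _ _ _ P A s _ L chi (fun p => (-1) ^+ p.1 *: e (chi p))).
  - by move=> l _ c f g; apply/funext.
  - by move=> l Pl; rewrite -[LHS]/(k%:R *: A l (e s)) Ae // !scalerA mulrC.
  - move=> p /TL[_ Tp] l Pl.
    by rewrite -[LHS]/((-1) ^+ p.1 *: A l (e (chi p))) Ae // !scalerA mulrC.
  - move=> p; rewrite mem_cat => /orP[/mapP[w /mem_weyl_seq Ww ->]|/mapP[w]].
      apply: contrapT => h; apply: nex; exists (w^-1)%VF; first exact: weyl_inv.
      move=> l Pl; rewrite /torus_act (weyl_invK Ww); apply/eqP; apply: contrapT => /negP ne.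
      by apply: h; exists l.
    rewrite mem_filter => /andP[/asboolP nf _] ->; apply: contrapT => h; apply: nf => l Pl.
    by apply/eqP; apply: contrapT => /negP ne; apply: h; exists l.
  rewrite big_cat !big_map big_filter /chi /=.
  rewrite (eq_bigr (fun w : 'End(V) => - e (fun l => t (w l)))); last first.
    by move=> w _; rewrite expr1 scaleN1r.
  rewrite [X in _ + (_ + X)](eq_bigr (fun w : 'End(V) => e (fun l => s (w l)))); last first.
    by move=> w _; rewrite expr0 scale1r.
  rewrite sumrN sumE (bigID fix_s) /= opprD addrA addrA.
  rewrite (eq_bigr (fun _ => e s)) => [|w /asboolP fw]; last first.
    by apply/funext => l; rewrite /e; case: asboolP => // Pl; exact: fw.
  by rewrite big_const_seq iter_addr addr0 scaler_nat subrr add0r addNr.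
have k0 : (0 < k)%N.
  rewrite -has_count; apply/hasP; exists \1%VF; first exact/mem_weyl_seq/weyl1.
  by apply/asboolP => l _; rewrite id_lfunE.
have := congr1 (fun f => f 0) y0; rewrite -[LHS]/(k%:R * e s 0) /e asboolT; last exact: weight0.
have [_ -> _] := Ts; rewrite mulr1 => /eqP; rewrite -[0 0]/(0 : C) pnatr_eq0.
by rewrite -leqn0 leqNgt k0.
Qed.

End HeckeModule.

Theorem theorem3p6 (R : realType) (V : vectType R) (n : nat)
    (D : rootSystem V n) (q : R[i]) (q_neq0 : q != 0)
    (q2_neq1 : q ^+ 2 != 1) (q2_neqN1 : q ^+ 2 != -1)
    (H : algType R[i]) (T : 'I_n -> H) (X : V -> H)
    (HH : affine_hecke D q T X)
    (M : vectType R[i]) (rho : H -> M -> M)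
    (M_module : is_module setT rho)
    (M_irr : irreducible_module rho)
    (M_cal : calibrated D X rho)
    (t : V -> R[i]) (t_central : central_character D X rho t) :
  (exists w, [/\ weyl D w, inv_set D w `&` Zset D t = set0 &
                 weight_space D X rho (torus_act w t) <> [set 0]]) /\
  (forall w, weyl D w -> inv_set D w `&` Zset D t = set0 ->
     weight_space D X rho (torus_act w t) <> [set 0] ->
     let J := inv_set D w `&` Pset D q t in
     skew_local_region D q T X t J /\
     exists sigma : H -> tJ_space D q t J -> tJ_space D q t J,
       is_tJ_module T X sigma /\ module_iso rho sigma).
Proof.
have [HR Hgen _] := HH; have [Tt _] := t_central; split.
  have [s [m [Ts m0 hm]]] := weight_exists HR M_module M_irr.
  have [w Ww E] := central_conj Ts Tt (fun l => central_orbit M_module t_central Ts m0 hm (l := l)).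
  (* The conjugating [w] may invert roots of [Z(t)]; an admissible element gives the same weight. *)
  have [u Au Eu] := admissible_exists Tt Ww; have [Wu _] := Au.
  exists u; split=> //; first exact/admissibleP.
  move=> E0; have : weight_space D X rho (torus_act u t) m.
    by apply: wt_space_eqchar hm; apply/eqchar_sym; apply: eqchar_trans Eu E.
  by rewrite E0 => /eqP; rewrite (negbTE m0).
move=> w Ww Zw ne J; have Aw : admissible D t w by apply/admissibleP.
have [m m0 hm] : exists2 m, m != 0 & weight_space D X rho (torus_act w t) m.
  apply: contrapT => h; apply: ne; apply/seteqP; split=> [m hm|m ->].
    by apply/eqP; apply: contrapT => /negP m0; apply: h; exists m.
  exact: wt_space0.
have FJ u : Fset D q t J u <-> in_region D q t w u by exact: Fset_in_region.
split; last first.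
  exists (tJ_rep T rho (t := t) (w0 := w) m); split.
    exact: (tJ_repM q_neq0 q2_neq1 HR M_module M_cal Hgen M_irr Tt Aw hm m0).
  exact: (tJ_rep_iso q_neq0 q2_neq1 HR M_module M_cal Hgen M_irr Tt Aw hm m0).
split.
  split=> //; first by move=> a [].
  by exists w; apply/FJ; exact: in_region_self.
move=> u /FJ.
exact: (in_region_calibratable q_neq0 q2_neq1 HR M_module M_cal Hgen M_irr Tt Aw hm m0).
Qed.
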